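(* Consider the second order differential equation $$y''(x)=B(x,y,y'),\qquad y(0)=a,\quad y'(0)=b,$$ and assume that $B$ is analytic in $(x,y,y')$. Then, after a smooth change of coordinates, $B(x,y,y')=\sum_{i,j\ge0} B_{ij}(y)\,x^i(y')^j$ satisfies $B_{ij}=0$ for the pairs of indices $(i,0)$, $(i,1)$ with $i\ge0$, and $(0,2)$, $(0,3)$, $(1,2)$, $(1,3)$. In particular, $$B=(y')^4\sum_{j=0}^\infty\bigl(B_{0,j+4}(y)+xB_{1,j+4}(y)\bigr)(y')^j+\sum_{i,j\ge2}B_{ij}(y)\,x^i(y')^j.$$
   Context: The statement is local: $B$ is analytic near $(x,y,y')=(0,0,0)$, and $a,b$ are small parameters. A change of coordinates means a local diffeomorphism $(x,y)\mapsto(\tilde x,\tilde y)$ of the $(x,y)$-plane near the origin (a point transformation), with a corresponding local reparametrization of the initial data $(a,b)$; it transforms the ODE into another ODE of the same form, whose right-hand side is again denoted $B$. *)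

(* Defs.v *)
From Stdlib Require Import Reals.
From Coquelicot Require Import Coquelicot.

Open Scope R_scope.

(* Unconditional sums of families indexed by nat^2 and nat^3: the bound on the
   absolute partial sums makes the value independent of the choice of boxes. *)
Definition is_sum2 (u : nat -> nat -> R) (s : R) : Prop :=
  (exists M : R, forall n : nat,
     sum_n (fun i => sum_n (fun j => Rabs (u i j)) n) n <= M) /\
  is_lim_seq (fun n => sum_n (fun i => sum_n (fun j => u i j) n) n) s.

Definition is_sum3 (u : nat -> nat -> nat -> R) (s : R) : Prop :=
  (exists M : R, forall n : nat,
     sum_n (fun i => sum_n (fun j => sum_n (fun k => Rabs (u i j k)) n) n) n
       <= M) /\
  is_lim_seq
    (fun n => sum_n (fun i => sum_n (fun j => sum_n (fun k => u i j k) n) n) n)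
    s.

Definition in_box (r x y p : R) : Prop :=
  Rabs x < r /\ Rabs y < r /\ Rabs p < r.

(* Real analyticity at the origin.  The sum of a power series is analytic on
   the whole open box, so this is analyticity in a neighbourhood. *)
Definition analytic_near_0 (B : R -> R -> R -> R) : Prop :=
  exists (c : nat -> nat -> nat -> R) (r : R), 0 < r /\
    forall x y p : R, in_box r x y p ->
      is_sum3 (fun i j k => c i j k * x ^ i * y ^ j * p ^ k) (B x y p).

(* C^infinity in a neighbourhood of the origin of R^2. *)
Definition smooth_near_0 (f : R -> R -> R) : Prop :=
  locally_2d (fun x y => forall n : nat, ex_diff_n f n x y) 0 0.

(* (F, G) is a diffeomorphism between neighbourhoods of the origin of R^2,
   fixing the origin. *)
Definition local_diffeo (F G : R -> R -> R) : Prop :=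
  F 0 0 = 0 /\ G 0 0 = 0 /\
  smooth_near_0 F /\ smooth_near_0 G /\
  exists F' G' : R -> R -> R,
    smooth_near_0 F' /\ smooth_near_0 G' /\
    locally_2d (fun x y => F' (F x y) (G x y) = x /\
                           G' (F x y) (G x y) = y) 0 0 /\
    locally_2d (fun u v => F (F' u v) (G' u v) = u /\
                           G (F' u v) (G' u v) = v) 0 0.

Definition solves_ivp (B : R -> R -> R -> R) (d a b : R) (y : R -> R) : Prop :=
  y 0 = a /\ Derive y 0 = b /\
  forall x : R, Rabs x < d ->
    ex_derive y x /\ is_derive (Derive y) x (B x (y x) (Derive y x)).

(* The point transformation (X, Y) of the plane, together with the map
   (alpha, beta) of the initial data, carries the initial value problems for B
   to those for Bt: it maps graphs of solutions into graphs of solutions.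
   Solvability for B is part of the definition, so that a large d does not make
   the transformation property vacuous; as (x, a, b) varies, the jets
   (x, y(x), y'(x)) fill a neighbourhood of the origin. *)
Definition transforms (B : R -> R -> R -> R) (X Y alpha beta : R -> R -> R)
    (Bt : R -> R -> R -> R) : Prop :=
  exists d e : R, 0 < d /\ 0 < e /\
    forall a b : R, Rabs a < e -> Rabs b < e ->
      (exists y : R -> R, solves_ivp B d a b y) /\
      forall y : R -> R, solves_ivp B d a b y ->
        exists yt : R -> R,
          solves_ivp Bt d (alpha a b) (beta a b) yt /\
          forall x : R, Rabs x < d -> Rabs (X x (y x)) < d ->
            Y x (y x) = yt (X x (y x)).

(* Main.v *)
Require Import Defs.
From Stdlib Require Import Reals Lra Lia List Arith Cantor FunctionalExtensionality Classical IndefiniteDescription.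
From Coquelicot Require Import Coquelicot.
Import ListNotations.

Open Scope R_scope.

(** A second order equation is a two-parameter family of curves in the plane.  A
    one-parameter subfamily gives coordinates [(s, t)]: [t] numbers the curves and [s] is a
    parameter along each of them.  The lines [t = const] are then solutions of the new
    equation, so its right-hand side vanishes when the slope does; and it has no linear term
    in the slope exactly when [s] is chosen so that the linearized equation along these
    lines becomes [u'' = 0].  What is left free are four functions of [t]: the curve [s = 0]
    (position [g], [h]), the slopes [b] of the subfamily along it, and the initial speed of
    the parametrization by [s].  The coefficients of indices (0,2), (0,3), (1,2), (1,3) are
    read off on [s = 0], and their vanishing is a system of ordinary differential equations
    for these four functions, which can be solved for the highest derivatives.

    In formulas, let [x = xi s t], [y = eta s t], let [q] be the slope of the curves
    [t = const] in the [(x, y)]-plane, [w = xi_s], and let [m], [n] be the derivatives of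
    the curves and of their slopes with respect to [t] at fixed [x] ([consistency]).  In
    [s] these six functions satisfy the system [frame_field].  When [B] is expanded at the
    slope [q], the new right-hand side becomes
    [tau^2 (defect2 + tau * defect3) / (m w)] plus a multiple of [tau^4] ([slope_law]).  The
    system [centre_field] in [t] says that [defect2], [defect3] and their [s]-derivatives
    vanish on [s = 0] ([defects_boundary], [defects_derive_boundary]).  Hence both defects
    are divisible by [s^2] ([divide_s2]), and the normal form can be read off
    ([normal_expansion]).

    Analytic germs are elements of the Banach algebra of power series with a weighted l1
    norm, in infinitely many variables.  Its completeness ([AnS_series]) gives products,
    compositions and, by Picard iteration, the flows of analytic vector fields
    ([analytic_flow]); parameters and initial values are further variables, so flows are
    analytic in them.  The inverse function theorem is deduced from flows
    ([inverse_function]).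

    The map of initial data takes the jet of a solution at [x = 0], writes it in the new
    coordinates and carries it to [s = 0] by the flow of the new equation.  That graphs go
    to graphs is uniqueness for the new equation, through Gronwall's inequality
    ([carries_solutions]). *)

(** * Calculus on the real line *)

(* Equalities between terms of a series are stated in an abstract module over R. *)
Ltac real_eq := lazymatch goal with |- @eq _ ?a ?b => change (@eq R a b) end.

Lemma common_radius4 a b c d : 0 < a -> 0 < b -> 0 < c -> 0 < d ->
  exists r, 0 < r /\ r <= a /\ r <= b /\ r <= c /\ r <= d.
Proof.
  intros Ha Hb Hc Hd. exists (Rmin (Rmin a b) (Rmin c d)).
  assert (A1 := Rmin_l (Rmin a b) (Rmin c d)). assert (A2 := Rmin_r (Rmin a b) (Rmin c d)).
  assert (A3 := Rmin_l a b). assert (A4 := Rmin_r a b).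
  assert (A5 := Rmin_l c d). assert (A6 := Rmin_r c d).
  split; [now repeat apply Rmin_pos | lra].
Qed.

Lemma locally_ball (x : R) (P : R -> Prop) :
  locally x P <-> exists r, 0 < r /\ forall y, Rabs (y - x) < r -> P y.
Proof.
  split.
  - intros [d Hd]. exists d. split; [apply cond_pos | exact Hd].
  - intros [r [Hr H]]. exists (mkposreal r Hr). exact H.
Qed.

Lemma locally_abs_ball (x r : R) : Rabs x < r -> locally x (fun y => Rabs y < r).
Proof.
  intros Hx. apply locally_ball. exists (r - Rabs x). split; [lra|]. intros y Hy.
  replace y with (x + (y - x)) by ring. apply Rle_lt_trans with (1 := Rabs_triang _ _). lra.
Qed.

Lemma is_lim_seq_val (y : nat -> R) (l l' : R) : l = l' -> is_lim_seq y l -> is_lim_seq y l'.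
Proof. now intros <-. Qed.

Lemma deriv_val (f : R -> R) (x a b : R) : is_derive f x a -> a = b -> is_derive f x b.
Proof. now intros H <-. Qed.

Lemma D_const (c x : R) : is_derive (fun _ : R => c) x 0.
Proof. apply (is_derive_const (K := R_AbsRing) (V := R_NormedModule)). Qed.

Lemma D_id (x : R) : is_derive (fun x : R => x) x 1.
Proof. apply (is_derive_id (K := R_AbsRing)). Qed.

Lemma D_plus (f g : R -> R) x a b : is_derive f x a -> is_derive g x b ->
  is_derive (fun x => f x + g x) x (a + b).
Proof. apply (is_derive_plus (K := R_AbsRing) (V := R_NormedModule)). Qed.

Lemma D_opp (f : R -> R) x a : is_derive f x a -> is_derive (fun x => - f x) x (- a).
Proof. apply (is_derive_opp (K := R_AbsRing) (V := R_NormedModule)). Qed.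

Lemma D_minus (f g : R -> R) x a b : is_derive f x a -> is_derive g x b ->
  is_derive (fun x => f x - g x) x (a - b).
Proof. apply (is_derive_minus (K := R_AbsRing) (V := R_NormedModule)). Qed.

Lemma D_mult (f g : R -> R) x a b : is_derive f x a -> is_derive g x b ->
  is_derive (fun x => f x * g x) x (a * g x + f x * b).
Proof. intros Hf Hg. exact (is_derive_mult f g x a b Hf Hg Rmult_comm). Qed.

Lemma D_sqr (f : R -> R) x a : is_derive f x a -> is_derive (fun x => f x ^ 2) x (2 * f x * a).
Proof.
  intros Hf. apply (is_derive_ext (fun x => f x * f x)); [intros; simpl; real_eq; ring|].
  apply (deriv_val _ _ _ _ (D_mult f f x a a Hf Hf)). ring.
Qed.

Lemma D_cube (f : R -> R) x a : is_derive f x a -> is_derive (fun x => f x ^ 3) x (3 * f x ^ 2 * a).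
Proof.
  intros Hf. apply (is_derive_ext (fun x => f x * f x ^ 2)); [intros; simpl; real_eq; ring|].
  apply (deriv_val _ _ _ _ (D_mult f _ x a _ Hf (D_sqr f x a Hf))). ring.
Qed.

Lemma D_div (f g : R -> R) x a b : g x <> 0 -> is_derive f x a -> is_derive g x b ->
  is_derive (fun x => f x / g x) x ((a * g x - f x * b) / g x ^ 2).
Proof. intros H0 Hf Hg. exact (is_derive_div f g x a b Hf Hg H0). Qed.

Lemma D_comp (f g : R -> R) x a b : is_derive f (g x) a -> is_derive g x b ->
  is_derive (fun x => f (g x)) x (b * a).
Proof. exact (is_derive_comp f g x a b). Qed.

Lemma D_ext_loc (f g : R -> R) x a :
  locally x (fun y => f y = g y) -> is_derive f x a -> is_derive g x a.
Proof. apply (is_derive_ext_loc (K := R_AbsRing) (V := R_NormedModule)). Qed.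

Ltac der := lazymatch goal with
  | |- is_derive (fun x => @?f x + @?g x) _ _ => eapply (D_plus f g); der
  | |- is_derive (fun x => @?f x - @?g x) _ _ => eapply (D_minus f g); der
  | |- is_derive (fun x => @?f x * @?g x) _ _ => eapply (D_mult f g); der
  | |- is_derive (fun x => @?f x / @?g x) _ _ => eapply (D_div f g); [assumption | der | der]
  | |- is_derive (fun x => @?f x ^ 2) _ _ => eapply (D_sqr f); der
  | |- is_derive (fun x => @?f x ^ 3) _ _ => eapply (D_cube f); der
  | |- is_derive (fun x => - @?f x) _ _ => eapply (D_opp f); der
  | |- is_derive (fun _ => ?c) _ _ => apply D_const
  | |- _ => eassumption
  end.

Lemma derivable_continuous (f : R -> R) x a : is_derive f x a -> continuous f x.
Proof.
  intros H. apply (ex_derive_continuous (K := R_AbsRing) (V := R_NormedModule)). now exists a.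
Qed.

Lemma locally_abs_lt (f : R -> R) x r :
  ex_derive f x -> Rabs (f x) < r -> locally x (fun y => Rabs (f y) < r).
Proof. intros [a Ha] Hx. exact (derivable_continuous f x a Ha _ (locally_abs_ball _ r Hx)). Qed.

Lemma ex_series_mult_l (c : R) (u : nat -> R) : ex_series u -> ex_series (fun k => c * u k).
Proof. apply (ex_series_scal (K := R_AbsRing) (V := R_NormedModule)). Qed.

(** * Absolutely convergent series *)

Definition ind (b : bool) (x : R) : R := if b then x else 0.

Lemma ind_abs b x : Rabs (ind b x) = ind b (Rabs x).
Proof. destruct b; simpl; [reflexivity | apply Rabs_R0]. Qed.

Lemma ind_0 b : ind b 0 = 0.
Proof. now destruct b. Qed.

Lemma ind_le b x : 0 <= x -> ind b x <= x.
Proof. destruct b; simpl; lra. Qed.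

Lemma ind_and b c x : ind b (ind c x) = ind (b && c) x.
Proof. destruct b, c; reflexivity. Qed.

Lemma ex_series_bounded (u : nat -> R) (M : R) :
  (forall k, 0 <= u k) -> (forall n, sum_n u n <= M) -> ex_series u /\ Series u <= M.
Proof.
  intros Hu HM.
  assert (Hinc : forall n, sum_n u n <= sum_n u (S n)).
  { intros n. rewrite sum_Sn. unfold plus; simpl. specialize (Hu (S n)). lra. }
  assert (He : ex_finite_lim_seq (sum_n u)).
  { apply ex_finite_lim_seq_incr with M; assumption. }
  destruct He as [s Hs].
  assert (Hser : is_series u s) by exact Hs.
  split.
  - exists s; exact Hser.
  - rewrite (is_series_unique _ _ Hser).
    assert (H := is_lim_seq_le (sum_n u) (fun _ => M) s M HM Hs (is_lim_seq_const M)).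
    exact H.
Qed.

Lemma sum_n_le_series (u : nat -> R) (n : nat) :
  (forall k, 0 <= u k) -> ex_series u -> sum_n u n <= Series u.
Proof.
  intros Hu Hs.
  apply Series_correct in Hs.
  apply (is_lim_seq_incr_compare (sum_n u) (Series u)).
  - exact Hs.
  - intros k. rewrite sum_Sn. unfold plus; simpl. specialize (Hu (S k)). lra.
Qed.

Lemma Series_nonneg (u : nat -> R) : (forall k, 0 <= u k) -> ex_series u -> 0 <= Series u.
Proof.
  intros Hu Hs.
  apply Rle_trans with (sum_n u 0).
  - rewrite sum_O. apply Hu.
  - apply sum_n_le_series; assumption.
Qed.

Lemma ex_series_dom (u v : nat -> R) :
  (forall k, Rabs (u k) <= v k) -> ex_series v -> ex_series (fun k => Rabs (u k)).
Proof.
  intros H Hv.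
  apply (ex_series_le (K := R_AbsRing) (V := R_CompleteNormedModule)) with v; [| exact Hv].
  intros n. unfold norm; simpl. unfold abs; simpl. rewrite Rabs_Rabsolu. apply H.
Qed.

Lemma Series_dom (u v : nat -> R) :
  (forall k, Rabs (u k) <= v k) -> ex_series v -> Rabs (Series u) <= Series v.
Proof.
  intros H Hv.
  apply Rle_trans with (Series (fun k => Rabs (u k))).
  - apply Series_Rabs. apply ex_series_dom with v; assumption.
  - apply Series_le; [| exact Hv].
    intros n. split; [apply Rabs_pos | apply H].
Qed.

Lemma ex_series_ind (b : nat -> bool) (u : nat -> R) :
  ex_series (fun k => Rabs (u k)) -> ex_series (fun k => Rabs (ind (b k) (u k))).
Proof.
  intros H. apply ex_series_dom with (fun k => Rabs (u k)); [| exact H].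
  intros k. rewrite ind_abs. apply ind_le, Rabs_pos.
Qed.

Lemma Series_ind_le (b : nat -> bool) (u : nat -> R) :
  ex_series (fun k => Rabs (u k)) ->
  Rabs (Series (fun k => ind (b k) (u k))) <= Series (fun k => Rabs (u k)).
Proof.
  intros H. apply Series_dom; [| exact H].
  intros k. rewrite ind_abs. apply ind_le, Rabs_pos.
Qed.

Lemma series_tail (u : nat -> R) (eps : R) :
  0 < eps -> ex_series u ->
  exists K, Rabs (Series u - sum_n u K) < eps.
Proof.
  intros He Hs. apply Series_correct in Hs.
  apply (is_lim_seq_spec (sum_n u) (Series u)) in Hs.
  destruct (Hs (mkposreal eps He)) as [K HK].
  exists K. rewrite <- Rabs_Ropp.
  replace (- (Series u - sum_n u K)) with (sum_n u K - Series u) by ring.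
  apply (HK K). lia.
Qed.

(** Dominated convergence in the form used below: the terms of [u] are switched on
    one after the other, and beyond a large index only a small tail is concerned. *)
Lemma series_dominated (u : nat -> R) (b : nat -> nat -> bool) :
  ex_series (fun k => Rabs (u k)) ->
  (forall k, exists n0, forall n, (n0 <= n)%nat -> b n k = true) ->
  is_lim_seq (fun n => Series (fun k => ind (b n k) (u k))) (Series u).
Proof.
  intros Hu Hb.
  apply is_lim_seq_spec. intros eps.
  destruct (series_tail _ eps (cond_pos eps) Hu) as [K HK].
  assert (Hn0 : exists n0, forall n, (n0 <= n)%nat ->
                 forall k, (k <= K)%nat -> b n k = true).
  { clear HK. induction K as [|K [dsn IH]].
    - destruct (Hb 0%nat) as [n0 H0]. exists n0. intros n Hn k Hk.
      replace k with 0%nat by lia. auto.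
    - destruct (Hb (S K)) as [n2 H2]. exists (max dsn n2). intros n Hn k Hk.
      destruct (Nat.eq_dec k (S K)) as [->|Hne].
      + apply H2; lia.
      + apply IH; lia. }
  destruct Hn0 as [n0 Hn0]. exists n0. intros n Hn.
  rewrite <- Series_minus.
  2: { apply ex_series_Rabs, ex_series_ind, Hu. }
  2: { apply ex_series_Rabs, Hu. }
  (* only the tail beyond K contributes *)
  set (t := fun k => ind (negb (k <=? K)%nat) (Rabs (u k))).
  assert (Htex : ex_series t).
  { apply ex_series_ext with (fun k => Rabs (ind (negb (k <=? K)%nat) (u k))).
    - intros k. apply ind_abs.
    - apply ex_series_ind, Hu. }
  apply Rle_lt_trans with (Series t).
  - apply Series_dom; [| exact Htex].
    intros k. unfold t. destruct (Nat.leb_spec k K) as [Hk|Hk]; simpl.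
    + rewrite (Hn0 n Hn k Hk). simpl. rewrite Rminus_diag, Rabs_R0. lra.
    + destruct (b n k); simpl.
      * rewrite Rminus_diag, Rabs_R0. apply Rabs_pos.
      * rewrite Rminus_0_l, Rabs_Ropp. lra.
  - assert (Heq : Series (fun k => Rabs (u k)) - sum_n (fun k => Rabs (u k)) K = Series t).
    { rewrite (Series_incr_n (fun k => Rabs (u k)) (S K)); [| lia | exact Hu].
      rewrite (Series_incr_n t (S K)); [| lia | exact Htex].
      simpl pred. rewrite sum_n_Reals.
      replace (sum_f_R0 t K) with 0.
      - rewrite (Series_ext (fun k => t (S K + k)%nat) (fun k => Rabs (u (S K + k)%nat))).
        + ring.
        + intros k. unfold t. destruct (Nat.leb_spec (S K + k) K); [lia | reflexivity].
      - symmetry. rewrite <- sum_n_Reals.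
        rewrite (sum_n_ext_loc t (fun _ => 0)).
        + rewrite sum_n_const. ring.
        + intros k Hk. unfold t. destruct (Nat.leb_spec k K); [reflexivity | lia]. }
    rewrite <- Heq. apply Rle_lt_trans with (2 := HK). apply Rle_abs.
Qed.

Lemma sum_n_Series (b : nat -> nat -> bool) (u : nat -> R) (n : nat) :
  ex_series (fun k => Rabs (u k)) ->
  sum_n (fun i => Series (fun k => ind (b i k) (u k))) n
  = Series (fun k => sum_n (fun i => ind (b i k) (u k)) n).
Proof.
  intros Hu.
  assert (H : sum_n (fun i => Series (fun k => ind (b i k) (u k))) n
    = Series (fun k => sum_n (fun i => ind (b i k) (u k)) n)
    /\ ex_series (fun k => sum_n (fun i => ind (b i k) (u k)) n)).
  { induction n as [|n [IH1 IH2]].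
    - rewrite sum_O. split.
      + apply Series_ext. intros k. rewrite sum_O. reflexivity.
      + apply ex_series_ext with (fun k => ind (b 0%nat k) (u k)).
        * intros k. rewrite sum_O. reflexivity.
        * apply ex_series_Rabs, ex_series_ind, Hu.
    - assert (Hb : ex_series (fun k => ind (b (S n) k) (u k)))
        by apply ex_series_Rabs, ex_series_ind, Hu.
      rewrite sum_Sn. unfold plus; simpl. rewrite IH1. split.
      + rewrite <- Series_plus by assumption.
        apply Series_ext. intros k. rewrite sum_Sn. reflexivity.
      + apply ex_series_ext with (fun k => plus (sum_n (fun i => ind (b i k) (u k)) n)
                                              (ind (b (S n) k) (u k))).
        * intros k. rewrite sum_Sn. reflexivity.
        * apply (ex_series_plus (K := R_AbsRing) (V := R_NormedModule)); assumption. }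
  apply H.
Qed.

Lemma sum_n_ind_eqb (c n : nat) (x : R) :
  sum_n (fun i => ind (c =? i)%nat x) n = ind (c <=? n)%nat x.
Proof.
  induction n as [|n IH].
  - rewrite sum_O. destruct c; reflexivity.
  - rewrite sum_Sn, IH. unfold plus; simpl.
    destruct (Nat.leb_spec c n), (Nat.eqb_spec c (S n)), (Nat.leb_spec c (S n));
      simpl; try lia; ring.
Qed.

Lemma sum_n_fibre (b : nat -> bool) (f : nat -> nat) (u : nat -> R) (n : nat) :
  ex_series (fun k => Rabs (u k)) ->
  sum_n (fun i => Series (fun k => ind (b k && (f k =? i)%nat) (u k))) n
  = Series (fun k => ind (b k && (f k <=? n)%nat) (u k)).
Proof.
  intros Hu.
  rewrite (sum_n_Series (fun i k => b k && (f k =? i)%nat)%bool) by exact Hu.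
  apply Series_ext. intros k. rewrite <- ind_and, <- sum_n_ind_eqb.
  destruct (b k); simpl.
  - reflexivity.
  - rewrite sum_n_const. ring.
Qed.

(** Dominated convergence, applied to the indicators of the fibres over [0..n]. *)
Lemma is_series_fibres (f : nat -> nat) (u : nat -> R) :
  ex_series (fun k => Rabs (u k)) ->
  is_series (fun i => Series (fun k => ind (f k =? i)%nat (u k))) (Series u).
Proof.
  intros Hu.
  assert (H := series_dominated u (fun n k => (f k <=? n)%nat) Hu).
  assert (H' : is_lim_seq (fun n => Series (fun k => ind (f k <=? n)%nat (u k))) (Series u)).
  { apply H. intros k. exists (f k). intros n Hn. apply Nat.leb_le. exact Hn. }
  apply (is_lim_seq_ext _ (sum_n (fun i => Series (fun k => ind (f k =? i)%nat (u k))))) in H'.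
  - exact H'.
  - intros n. symmetry. exact (sum_n_fibre (fun _ => true) f u n Hu).
Qed.

Lemma box_bound2 (f g : nat -> nat) (u : nat -> R) (n : nat) :
  ex_series (fun k => Rabs (u k)) ->
  sum_n (fun i => sum_n (fun j =>
    Rabs (Series (fun k => ind ((f k =? i)%nat && (g k =? j)%nat) (u k)))) n) n
  <= Series (fun k => Rabs (u k)).
Proof.
  intros Hu.
  assert (Hu' : ex_series (fun k => Rabs (Rabs (u k)))).
  { apply ex_series_ext with (2 := Hu). intros k. rewrite Rabs_Rabsolu. reflexivity. }
  apply Rle_trans with (sum_n (fun i => sum_n (fun j =>
    Series (fun k => ind ((f k =? i)%nat && (g k =? j)%nat) (Rabs (u k)))) n) n).
  - apply sum_n_m_le. intros i. apply sum_n_m_le. intros j.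
    apply Series_dom.
    + intros k. rewrite ind_abs. lra.
    + apply ex_series_Rabs, ex_series_ind, Hu'.
  - rewrite (sum_n_ext _ (fun i => Series (fun k =>
      ind ((fun k => (g k <=? n)%nat) k && (f k =? i)%nat) (Rabs (u k))))).
    + rewrite sum_n_fibre by exact Hu'.
      apply Rle_trans with (1 := Rle_abs _).
      apply Rle_trans with (1 := Series_ind_le _ _ Hu').
      right. apply Series_ext. intros k. apply Rabs_Rabsolu.
    + intros i. rewrite sum_n_fibre by exact Hu'.
      apply Series_ext. intros k. now rewrite Bool.andb_comm.
Qed.

Lemma box_sum2 (f g : nat -> nat) (u : nat -> R) (n : nat) :
  ex_series (fun k => Rabs (u k)) ->
  sum_n (fun i => sum_n (fun j =>
    Series (fun k => ind ((f k =? i)%nat && (g k =? j)%nat) (u k))) n) n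
  = Series (fun k => ind ((g k <=? n)%nat && (f k <=? n)%nat) (u k)).
Proof.
  intros Hu.
  rewrite (sum_n_ext _ (fun i => Series (fun k =>
      ind ((fun k => (g k <=? n)%nat) k && (f k =? i)%nat) (u k)))).
  - now rewrite sum_n_fibre by exact Hu.
  - intros i. rewrite sum_n_fibre by exact Hu.
    apply Series_ext. intros k. now rewrite Bool.andb_comm.
Qed.

(** Both conditions of [is_sum2] come from summing over the fibres of [f] and of [g]
    successively; the coefficients of an analytic function will be such fibre sums. *)
Lemma is_sum2_fibres (f g : nat -> nat) (u : nat -> R) :
  ex_series (fun k => Rabs (u k)) ->
  is_sum2 (fun i j => Series (fun k => ind ((f k =? i)%nat && (g k =? j)%nat) (u k)))
    (Series u).
Proof.
  intros Hu. split.
  - exists (Series (fun k => Rabs (u k))). intros n. now apply box_bound2.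
  - apply is_lim_seq_ext with
      (fun n => Series (fun k => ind ((g k <=? n)%nat && (f k <=? n)%nat) (u k))).
    + intros n. symmetry. now apply box_sum2.
    + apply series_dominated; [exact Hu |].
      intros k. exists (max (f k) (g k)). intros n Hn.
      apply Bool.andb_true_iff; split; apply Nat.leb_le; lia.
Qed.

Lemma box_sum3 (f g h : nat -> nat) (u : nat -> R) (n : nat) :
  ex_series (fun k => Rabs (u k)) ->
  sum_n (fun i => sum_n (fun j => sum_n (fun l =>
    Series (fun k => ind ((f k =? i)%nat && (g k =? j)%nat && (h k =? l)%nat) (u k))) n) n) n
  = Series (fun k => ind ((h k <=? n)%nat && (g k <=? n)%nat && (f k <=? n)%nat) (u k)).
Proof.
  intros Hu.
  rewrite (sum_n_ext _ (fun i => Series (fun k =>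
      ind ((fun k => (h k <=? n)%nat && (g k <=? n)%nat)%bool k && (f k =? i)%nat) (u k)))).
  - now rewrite sum_n_fibre by exact Hu.
  - intros i.
    rewrite (sum_n_ext _ (fun j => Series (fun k =>
      ind ((fun k => (h k <=? n)%nat && (f k =? i)%nat)%bool k && (g k =? j)%nat) (u k)))).
    + rewrite sum_n_fibre by exact Hu. apply Series_ext. intros k. f_equal.
      destruct (h k <=? n)%nat, (f k =? i)%nat, (g k <=? n)%nat; reflexivity.
    + intros j. rewrite sum_n_fibre by exact Hu.
      apply Series_ext. intros k. f_equal.
      destruct (h k <=? n)%nat, (f k =? i)%nat, (g k =? j)%nat; reflexivity.
Qed.

Lemma is_sum3_fibres (f g h : nat -> nat) (u : nat -> R) :
  ex_series (fun k => Rabs (u k)) ->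
  is_sum3 (fun i j l => Series (fun k =>
      ind ((f k =? i)%nat && (g k =? j)%nat && (h k =? l)%nat) (u k)))
    (Series u).
Proof.
  intros Hu.
  assert (Hu' : ex_series (fun k => Rabs (Rabs (u k)))).
  { apply ex_series_ext with (2 := Hu). intros k. rewrite Rabs_Rabsolu. reflexivity. }
  split.
  - exists (Series (fun k => Rabs (u k))). intros n.
    apply Rle_trans with (sum_n (fun i => sum_n (fun j => sum_n (fun l =>
      Series (fun k => ind ((f k =? i)%nat && (g k =? j)%nat && (h k =? l)%nat)
                           (Rabs (u k)))) n) n) n).
    + apply sum_n_m_le. intros i. apply sum_n_m_le. intros j. apply sum_n_m_le. intros l.
      apply Series_dom.
      * intros k. rewrite ind_abs. lra.
      * apply ex_series_Rabs, ex_series_ind, Hu'.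
    + rewrite box_sum3 by exact Hu'.
      apply Rle_trans with (1 := Rle_abs _).
      apply Rle_trans with (1 := Series_ind_le _ _ Hu').
      right. apply Series_ext. intros k. apply Rabs_Rabsolu.
  - apply is_lim_seq_ext with
      (fun n => Series (fun k => ind ((h k <=? n)%nat && (g k <=? n)%nat && (f k <=? n)%nat) (u k))).
    + intros n. symmetry. now apply box_sum3.
    + apply series_dominated; [exact Hu |].
      intros k. exists (max (h k) (max (f k) (g k))). intros n Hn.
      repeat (apply Bool.andb_true_iff; split); apply Nat.leb_le; lia.
Qed.

Lemma Series_single (c : nat) (u : nat -> R) :
  is_series (fun k => ind (k =? c)%nat (u k)) (u c).
Proof.
  assert (H : is_lim_seq (sum_n (fun k => ind (k =? c)%nat (u k))) (u c)).
  { apply is_lim_seq_ext_loc with (fun _ => u c); [| apply is_lim_seq_const].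
    exists c. intros n Hn.
    rewrite (sum_n_ext _ (fun k => ind (c =? k)%nat (u c))).
    - rewrite sum_n_ind_eqb. destruct (Nat.leb_spec c n); [reflexivity | lia].
    - intros k. rewrite Nat.eqb_sym. destruct (Nat.eqb_spec c k); subst; reflexivity. }
  exact H.
Qed.

Definition pr1 (k : nat) := fst (Cantor.of_nat k).
Definition pr2 (k : nat) := snd (Cantor.of_nat k).

Lemma pr_eqb (i j k : nat) :
  ((pr1 k =? i)%nat && (pr2 k =? j)%nat)%bool = (k =? Cantor.to_nat (i, j))%nat.
Proof.
  unfold pr1, pr2. rewrite <- (Cantor.cancel_to_of k) at 3.
  destruct (Cantor.of_nat k) as [a b]. simpl fst; simpl snd.
  destruct (Nat.eqb_spec (Cantor.to_nat (a, b)) (Cantor.to_nat (i, j))) as [H|H].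
  - apply Cantor.to_nat_inj in H. injection H as -> ->. now rewrite !Nat.eqb_refl.
  - destruct (Nat.eqb_spec a i), (Nat.eqb_spec b j); subst; try reflexivity.
    now contradiction H.
Qed.

Lemma pr_le k : (pr1 k <= k)%nat /\ (pr2 k <= k)%nat.
Proof.
  assert (H := Cantor.to_nat_non_decreasing (pr1 k) (pr2 k)).
  unfold pr1, pr2 in *. rewrite <- surjective_pairing, Cantor.cancel_to_of in H. lia.
Qed.

(** A pair has both entries at most its index in the diagonal enumeration. *)
Lemma pairing_partial (v : nat -> nat -> R) (n : nat) :
  (forall i j, 0 <= v i j) ->
  sum_n (fun k => v (pr1 k) (pr2 k)) n <= sum_n (fun i => sum_n (fun j => v i j) n) n.
Proof.
  intros Hv.
  (* insert the indicator of the fibre, exchange the sums *)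
  rewrite (sum_n_ext_loc _ (fun k => sum_n (fun i => sum_n (fun j =>
             ind (k =? Cantor.to_nat (i, j))%nat (v i j)) n) n)).
  - rewrite sum_n_switch. apply sum_n_m_le. intros i.
    rewrite sum_n_switch. apply sum_n_m_le. intros j.
    rewrite (sum_n_ext _ (fun k => ind (Cantor.to_nat (i,j) =? k)%nat (v i j)))
      by (intros k; now rewrite Nat.eqb_sym).
    rewrite sum_n_ind_eqb. apply ind_le, Hv.
  - intros k Hk. destruct (pr_le k) as [H1 H2].
    rewrite (sum_n_ext _ (fun i => ind (pr1 k =? i)%nat (v (pr1 k) (pr2 k)))).
    + rewrite sum_n_ind_eqb. destruct (Nat.leb_spec (pr1 k) n); [reflexivity | lia].
    + intros i.
      rewrite (sum_n_ext _ (fun j => ind (pr2 k =? j)%nat (ind (pr1 k =? i)%nat (v (pr1 k) (pr2 k))))).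
      * rewrite sum_n_ind_eqb. destruct (Nat.leb_spec (pr2 k) n); [reflexivity | lia].
      * intros j. rewrite <- pr_eqb.
        destruct (Nat.eqb_spec (pr1 k) i), (Nat.eqb_spec (pr2 k) j); subst; reflexivity.
Qed.

(** Fubini: the series along the diagonal enumeration is summed over the fibres of the
    first entry, and each of these over the fibres of the second. *)
Lemma series_pairing (u : nat -> nat -> R) (N : nat -> R) :
  (forall i, ex_series (fun j => Rabs (u i j))) ->
  (forall i, Series (fun j => Rabs (u i j)) <= N i) ->
  ex_series N ->
  ex_series (fun k => Rabs (u (pr1 k) (pr2 k))) /\
  Series (fun k => Rabs (u (pr1 k) (pr2 k))) <= Series N /\
  is_series (fun i => Series (u i)) (Series (fun k => u (pr1 k) (pr2 k))).
Proof.
  intros Hu HN HNs.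
  assert (HN0 : forall i, 0 <= N i).
  { intros i. apply Rle_trans with (2 := HN i). apply Series_nonneg; [| apply Hu].
    intros k. apply Rabs_pos. }
  assert (Hb : ex_series (fun k => Rabs (u (pr1 k) (pr2 k))) /\
     Series (fun k => Rabs (u (pr1 k) (pr2 k))) <= Series N).
  { apply ex_series_bounded; [intros; apply Rabs_pos |].
    intros n.
    apply Rle_trans with (1 := pairing_partial (fun i j => Rabs (u i j)) n
                                (fun i j => Rabs_pos _)).
    apply Rle_trans with (sum_n N n).
    - apply sum_n_m_le. intros i. apply Rle_trans with (2 := HN i).
      apply sum_n_le_series; [intros; apply Rabs_pos | apply Hu].
    - apply sum_n_le_series; assumption. }
  destruct Hb as [Hb1 Hb2]. split; [exact Hb1 | split; [exact Hb2 |]].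
  apply is_series_ext with (2 := is_series_fibres pr1 _ Hb1).
  intros i.
  assert (Hi := is_series_fibres pr2 _ (ex_series_ind (fun k => (pr1 k =? i)%nat) _ Hb1)).
  symmetry. rewrite <- (is_series_unique _ _ Hi).
  apply Series_ext. intros j. symmetry.
  rewrite (Series_ext _ (fun k => ind (k =? Cantor.to_nat (i, j))%nat (u (pr1 k) (pr2 k)))).
  - rewrite (is_series_unique _ _ (Series_single _ _)).
    unfold pr1, pr2. now rewrite Cantor.cancel_of_to.
  - intros k. rewrite ind_and, <- pr_eqb. f_equal. apply Bool.andb_comm.
Qed.

(** * Power series with a finite weighted norm *)

(** Points have infinitely many coordinates, so that the number of variables never has
    to be tracked: parameters and initial data of a differential equation are just
    further coordinates.  A monomial is a list of indices; multiplication is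
    concatenation. *)
Definition pt := nat -> R.
Definition pt0 : pt := fun _ => 0.

Fixpoint mon (l : list nat) (z : pt) : R :=
  match l with nil => 1 | i :: l => z i * mon l z end.

(** The open polydisc, with a uniform margin: with infinitely many coordinates the
    condition [Rabs (z i) < r] for all [i] would not leave room for one. *)
Definition box (r : R) (z : pt) : Prop :=
  exists r', r' < r /\ forall i, Rabs (z i) <= r'.

(** The functions of norm at most [N] in the algebra of power series with the weighted
    l1 norm of radius [r].  Monomials may be repeated in the enumeration, so sums and
    products of series need no collection of terms.  The predicate [S] records which
    monomials occur, which is how vanishing coefficients are read off. *)
Definition AnS (S : list nat -> Prop) (r N : R) (f : pt -> R) : Prop :=
  0 < r /\
  exists (a : nat -> R) (l : nat -> list nat),
    (forall k, a k <> 0 -> S (l k)) /\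
    ex_series (fun k => Rabs (a k) * r ^ length (l k)) /\
    Series (fun k => Rabs (a k) * r ^ length (l k)) <= N /\
    forall z, box r z -> is_series (fun k => a k * mon (l k) z) (f z).

Definition AnN := AnS (fun _ => True).

Lemma mon_bound l z r : (forall i, Rabs (z i) <= r) -> Rabs (mon l z) <= r ^ length l.
Proof.
  intros Hz. induction l as [|i l IH]; simpl.
  - rewrite Rabs_R1. lra.
  - rewrite Rabs_mult. apply Rmult_le_compat; auto using Rabs_pos.
Qed.

Lemma mon_app l l' z : mon (l ++ l') z = mon l z * mon l' z.
Proof. induction l as [|i l IH]; simpl; [ring | rewrite IH; ring]. Qed.

Lemma box_mono r r' z : r <= r' -> box r z -> box r' z.
Proof. intros H [s [H1 H2]]. exists s. split; [lra | exact H2]. Qed.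

Lemma box_le r z i : box r z -> Rabs (z i) < r.
Proof. intros [s [H1 H2]]. specialize (H2 i). lra. Qed.

Lemma box_bound r z : box r z -> exists r', 0 <= r' < r /\ forall i, Rabs (z i) <= r'.
Proof.
  intros [s [H1 H2]]. exists s. repeat split; auto.
  apply Rle_trans with (2 := H2 0%nat), Rabs_pos.
Qed.

Lemma term_bound a l z r : (forall i, Rabs (z i) <= r) ->
  Rabs (a * mon l z) <= Rabs a * r ^ length l.
Proof.
  intros Hz. rewrite Rabs_mult. apply Rmult_le_compat_l; [apply Rabs_pos|].
  now apply mon_bound.
Qed.

Lemma box_weak r z i : box r z -> Rabs (z i) <= r.
Proof. intros H. apply Rlt_le, box_le, H. Qed.

Lemma AnS_pos S r N f : AnS S r N f -> 0 < r.
Proof. now intros [H _]. Qed.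

Lemma AnS_bound S r N f z : AnS S r N f -> box r z -> Rabs (f z) <= N.
Proof.
  intros [Hr [a [l [_ [He [HN Hf]]]]]] Hz. apply Rle_trans with (2 := HN).
  rewrite <- (is_series_unique _ _ (Hf z Hz)).
  apply Series_dom; [| exact He].
  intros k. apply term_bound. intros i. now apply box_weak.
Qed.

Lemma box_zero r : 0 < r -> box r pt0.
Proof. intros H. exists 0. split; [lra|]. intros i. unfold pt0. rewrite Rabs_R0. lra. Qed.

Lemma AnS_N_nonneg S r N f : AnS S r N f -> 0 <= N.
Proof.
  intros H. apply Rle_trans with (Rabs (f pt0)); [apply Rabs_pos|].
  apply (AnS_bound _ _ _ _ _ H). apply box_zero. now apply AnS_pos in H.
Qed.

Lemma AnS_ext S r N f g : (forall z, box r z -> f z = g z) -> AnS S r N f -> AnS S r N g.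
Proof.
  intros H [Hr [a [l [HS [He [HN Hf]]]]]]. split; [exact Hr|].
  exists a, l. repeat split; auto. intros z Hz. rewrite <- H by exact Hz. now apply Hf.
Qed.

Lemma AnS_mono (S S' : list nat -> Prop) r r' N N' f :
  (forall l, S l -> S' l) -> 0 < r' <= r -> N <= N' -> AnS S r N f -> AnS S' r' N' f.
Proof.
  intros HSS Hr' HNN [Hr [a [l [HS [He [HN Hf]]]]]]. split; [lra|].
  assert (Hle : forall k, 0 <= Rabs (a k) * r' ^ length (l k) <= Rabs (a k) * r ^ length (l k)).
  { intros k. split.
    - apply Rmult_le_pos; [apply Rabs_pos | apply pow_le; lra].
    - apply Rmult_le_compat_l; [apply Rabs_pos | apply pow_incr; lra]. }
  exists a, l. repeat split.
  - auto.
  - apply ex_series_ext with (fun k => Rabs (Rabs (a k) * r' ^ length (l k))).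
    + intros k. apply Rabs_pos_eq, Hle.
    + apply ex_series_dom with (2 := He). intros k. rewrite Rabs_pos_eq; apply Hle.
  - apply Rle_trans with (2 := HNN). apply Rle_trans with (2 := HN).
    apply Series_le; [exact Hle | exact He].
  - intros z Hz. apply Hf. apply box_mono with (2 := Hz). lra.
Qed.

Lemma AnN_mono r r' N N' f : 0 < r' <= r -> N <= N' -> AnN r N f -> AnN r' N' f.
Proof. apply AnS_mono. trivial. Qed.

(** Completeness of the algebra.  Because monomials may be repeated, the double family
    of terms is merely re-enumerated along the diagonal.  Products, composition,
    inversion, differentiation and the limit of Picard iterates are all obtained from
    this closure property. *)
Lemma AnS_series S r (N : nat -> R) (f : nat -> pt -> R) F :
  0 < r -> (forall j, AnS S r (N j) (f j)) -> ex_series N ->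
  (forall z, box r z -> is_series (fun j => f j z) (F z)) ->
  AnS S r (Series N) F.
Proof.
  intros Hr Hf HN HF. split; [exact Hr|].
  assert (Hch : forall j, exists p : (nat -> R) * (nat -> list nat),
    (forall k, fst p k <> 0 -> S (snd p k)) /\
    ex_series (fun k => Rabs (fst p k) * r ^ length (snd p k)) /\
    Series (fun k => Rabs (fst p k) * r ^ length (snd p k)) <= N j /\
    forall z, box r z -> is_series (fun k => fst p k * mon (snd p k) z) (f j z)).
  { intros j. destruct (Hf j) as [_ [a [l H]]]. now exists (a, l). }
  destruct (functional_choice _ Hch) as [p Hp]. clear Hf.
  set (w := fun i j => fst (p i) j * r ^ length (snd (p i) j)).
  assert (Hw : forall i j, Rabs (w i j) = Rabs (fst (p i) j) * r ^ length (snd (p i) j)).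
  { intros i j. unfold w. rewrite Rabs_mult. f_equal. apply Rabs_pos_eq, pow_le. lra. }
  assert (Hw1 : forall i, ex_series (fun j => Rabs (w i j))).
  { intros i. apply ex_series_ext with (2 := proj1 (proj2 (Hp i))).
    intros k. now rewrite Hw. }
  assert (Hw2 : forall i, Series (fun j => Rabs (w i j)) <= N i).
  { intros i. apply Rle_trans with (2 := proj1 (proj2 (proj2 (Hp i)))).
    right. apply Series_ext. intros k. now rewrite Hw. }
  destruct (series_pairing w N Hw1 Hw2 HN) as [H1 [H2 _]].
  exists (fun k => fst (p (pr1 k)) (pr2 k)), (fun k => snd (p (pr1 k)) (pr2 k)).
  repeat split.
  - intros k. apply (Hp (pr1 k)).
  - apply ex_series_ext with (2 := H1). intros k. apply Hw.
  - apply Rle_trans with (2 := H2). right. apply Series_ext. intros k. symmetry. apply Hw.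
  - intros z Hz.
    set (u := fun i j => fst (p i) j * mon (snd (p i) j) z).
    assert (Huw : forall i j, Rabs (u i j) <= Rabs (w i j)).
    { intros i j. rewrite Hw. apply term_bound. intros m. now apply box_weak. }
    assert (Hu1 : forall i, ex_series (fun j => Rabs (u i j))).
    { intros i. apply ex_series_dom with (2 := Hw1 i). apply Huw. }
    assert (Hu2 : forall i, Series (fun j => Rabs (u i j)) <= N i).
    { intros i. apply Rle_trans with (2 := Hw2 i). apply Series_le; [| apply Hw1].
      intros k. split; [apply Rabs_pos | apply Huw]. }
    destruct (series_pairing u N Hu1 Hu2 HN) as [G1 [_ G3]].
    assert (Heq : F z = Series (fun k => u (pr1 k) (pr2 k))).
    { rewrite <- (is_series_unique _ _ G3). symmetry. apply is_series_unique.
      apply is_series_ext with (2 := HF z Hz).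
      intros j. symmetry. apply is_series_unique. now apply (Hp j). }
    rewrite Heq. apply Series_correct. apply ex_series_Rabs. exact G1.
Qed.

Lemma is_series_two (x y : R) :
  is_series (fun j => match j with 0%nat => x | 1%nat => y | _ => 0 end) (x + y).
Proof.
  assert (H : is_lim_seq (sum_n (fun j => match j with 0%nat => x | 1%nat => y | _ => 0 end)) (x + y)).
  { apply is_lim_seq_ext_loc with (fun _ => x + y); [| apply is_lim_seq_const].
    exists 1%nat. intros n Hn. induction n as [|n IH]; [lia|].
    rewrite sum_Sn. destruct n as [|n].
    - rewrite sum_O. reflexivity.
    - rewrite <- IH by lia. unfold plus; simpl. ring. }
  exact H.
Qed.

Lemma is_series_zero : is_series (fun _ : nat => 0) 0.
Proof.
  assert (H := is_series_two 0 0). rewrite Rplus_0_r in H.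
  apply is_series_ext with (2 := H). intros [|[|n]]; reflexivity.
Qed.

Lemma AnS_zero S r : 0 < r -> AnS S r 0 (fun _ => 0).
Proof.
  intros Hr. split; [exact Hr|]. exists (fun _ => 0), (fun _ => nil).
  assert (H0 := is_series_zero).
  assert (H1 : is_series (fun k => Rabs 0 * r ^ length (@nil nat)) 0).
  { apply is_series_ext with (2 := H0). intros n. real_eq. rewrite Rabs_R0. ring. }
  repeat split.
  - intros k H. now contradiction H.
  - eexists. exact H1.
  - rewrite (is_series_unique _ _ H1). lra.
  - intros z _. apply is_series_ext with (2 := H0). intros n. real_eq. ring.
Qed.

Lemma AnS_plus S r N M f g : AnS S r N f -> AnS S r M g -> AnS S r (N + M) (fun z => f z + g z).
Proof.
  intros Hf Hg. assert (Hr := AnS_pos _ _ _ _ Hf).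
  rewrite <- (is_series_unique _ _ (is_series_two N M)).
  apply (AnS_series S r _ (fun j => match j with 0%nat => f | 1%nat => g | _ => fun _ => 0 end)).
  - exact Hr.
  - intros [|[|j]]; [exact Hf | exact Hg | now apply AnS_zero].
  - eexists. apply is_series_two.
  - intros z _. apply is_series_ext with (2 := is_series_two (f z) (g z)).
    intros [|[|j]]; reflexivity.
Qed.

Lemma AnS_scal_mon (S S' : list nat -> Prop) r N f c l0 :
  (forall l, S l -> S' (l0 ++ l)) -> AnS S r N f ->
  AnS S' r (Rabs c * r ^ length l0 * N) (fun z => c * mon l0 z * f z).
Proof.
  intros HSS [Hr [a [l [HS [He [HN Hf]]]]]]. split; [exact Hr|].
  assert (Hw : forall k, Rabs c * r ^ length l0 * (Rabs (a k) * r ^ length (l k))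
                = Rabs (c * a k) * r ^ length (l0 ++ l k)).
  { intros k. rewrite Rabs_mult, length_app, pow_add. ring. }
  exists (fun k => c * a k), (fun k => l0 ++ l k). repeat split.
  - intros k Hk. apply HSS, HS. intros H. apply Hk. rewrite H. ring.
  - apply ex_series_ext with (1 := Hw).
    apply ex_series_mult_l. exact He.
  - rewrite <- (Series_ext _ _ Hw), Series_scal_l.
    apply Rmult_le_compat_l; [| exact HN].
    apply Rmult_le_pos; [apply Rabs_pos | apply pow_le; lra].
  - intros z Hz.
    apply is_series_ext with (fun k => scal (c * mon l0 z) (a k * mon (l k) z)).
    + intros k. rewrite mon_app. unfold scal; simpl. unfold mult; simpl. ring.
    + apply (is_series_scal (K := R_AbsRing) (V := R_NormedModule)). now apply Hf.
Qed.

Lemma AnN_const r c : 0 < r -> AnN r (Rabs c) (fun _ => c).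
Proof.
  intros Hr. split; [exact Hr|].
  exists (fun k => ind (k =? 0)%nat c), (fun _ => nil).
  assert (H0 := Series_single 0 (fun _ => Rabs c)).
  assert (H1 : is_series (fun k => Rabs (ind (k =? 0)%nat c) * r ^ length (@nil nat)) (Rabs c)).
  { apply is_series_ext with (2 := H0). intros k. real_eq. rewrite ind_abs. simpl. ring. }
  repeat split.
  - eexists; exact H1.
  - rewrite (is_series_unique _ _ H1). lra.
  - intros z _. apply is_series_ext with (2 := Series_single 0 (fun _ => c)).
    intros k. real_eq. simpl. ring.
Qed.

Lemma AnN_scal r N f c : AnN r N f -> AnN r (Rabs c * N) (fun z => c * f z).
Proof.
  intros H. assert (Hr := AnS_pos _ _ _ _ H).
  apply AnS_ext with (fun z => c * mon nil z * f z); [intros; simpl; ring|].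
  apply (AnN_mono r r (Rabs c * r ^ length (@nil nat) * N)); [lra | simpl; lra |].
  apply AnS_scal_mon with (2 := H). trivial.
Qed.

Lemma AnN_opp r N f : AnN r N f -> AnN r N (fun z => - f z).
Proof.
  intros H. assert (Hr := AnS_pos _ _ _ _ H).
  apply AnS_ext with (fun z => -1 * f z); [intros; simpl; ring|].
  apply (AnN_mono r r (Rabs (-1) * N)); [lra | |now apply AnN_scal].
  rewrite Rabs_m1. lra.
Qed.

(** The product is the series of the products of [g] with the terms of [f]. *)
Lemma AnN_mult r N M f g : AnN r N f -> AnN r M g -> AnN r (N * M) (fun z => f z * g z).
Proof.
  intros Hf Hg. assert (HM := AnS_N_nonneg _ _ _ _ Hg).
  destruct Hf as [Hr [a [l [_ [He [HN Hf]]]]]].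
  apply (AnN_mono r r (Series (fun k => Rabs (a k) * r ^ length (l k) * M))); [lra | |].
  - rewrite Series_scal_r. now apply Rmult_le_compat_r.
  - apply (AnS_series _ r _ (fun k z => a k * mon (l k) z * g z)).
    + exact Hr.
    + intros k. apply AnS_scal_mon with (2 := Hg). trivial.
    + apply (ex_series_scal_r M). exact He.
    + intros z Hz. apply (is_series_scal_r (g z)). now apply Hf.
Qed.

Lemma AnN_var r i : 0 < r -> AnN r r (fun z => z i).
Proof.
  intros Hr. apply AnS_ext with (fun z => 1 * mon (i :: nil) z * 1); [intros; simpl; ring|].
  apply (AnN_mono r r (Rabs 1 * r ^ length (i :: nil) * Rabs 1)); [lra | |].
  - rewrite Rabs_R1. simpl. lra.
  - apply (AnS_scal_mon (fun _ => True)); [trivial|]. now apply AnN_const.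
Qed.

Lemma AnN_mon_comp rho r l (v : nat -> pt -> R) : 0 < rho ->
  (forall i, AnN rho r (v i)) -> AnN rho (r ^ length l) (fun z => mon l (fun i => v i z)).
Proof.
  intros Hrho Hv. induction l as [|i l IH]; simpl.
  - rewrite <- Rabs_R1 at 1. now apply AnN_const.
  - apply AnN_mult; [apply Hv | exact IH].
Qed.

Lemma AnN_box rho r r' (v : nat -> pt -> R) z :
  (forall i, AnN rho r' (v i)) -> r' < r -> box rho z -> box r (fun i => v i z).
Proof.
  intros Hv Hr Hz. exists r'. split; [exact Hr|].
  intros i. now apply (AnS_bound _ _ _ _ _ (Hv i)).
Qed.

(** The norm is submultiplicative, so a monomial of length k in functions of norm at
    most [r] has norm at most [r ^ k].  The strict inequality makes the values fall in
    the open polydisc. *)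
Lemma AnN_comp rho r r' N f (v : nat -> pt -> R) :
  AnN r N f -> r' < r -> (forall i, AnN rho r' (v i)) ->
  AnN rho N (fun z => f (fun i => v i z)).
Proof.
  intros [Hr [a [l [_ [He [HN Hf]]]]]] Hr' Hv.
  assert (Hrho := AnS_pos _ _ _ _ (Hv 0%nat)).
  assert (H0 := AnS_N_nonneg _ _ _ _ (Hv 0%nat)).
  apply (AnN_mono rho rho (Series (fun k => Rabs (a k) * r ^ length (l k)))); [lra | exact HN |].
  apply (AnS_series _ rho _ (fun k z => a k * mon (l k) (fun i => v i z))).
  - exact Hrho.
  - intros k. apply AnN_scal.
    apply (AnN_mono rho rho (r' ^ length (l k))); [lra | apply pow_incr; lra |].
    now apply AnN_mon_comp.
  - exact He.
  - intros z Hz. apply Hf. now apply (AnN_box rho r r').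
Qed.

(** Cauchy estimate for differences: the factors of the monomial are changed one at a
    time, and shrinking the radius from [r] to [r'] pays for the number of factors. *)
Lemma AnN_mon_lip rho r r' d l (v v' : nat -> pt -> R) :
  r' < r -> (forall i, AnN rho r' (v i)) -> (forall i, AnN rho r' (v' i)) ->
  (forall i, AnN rho d (fun z => v i z - v' i z)) ->
  AnN rho (r ^ length l * (d / (r - r')))
    (fun z => mon l (fun i => v i z) - mon l (fun i => v' i z)).
Proof.
  intros Hr Hv Hv' Hd.
  assert (Hrho := AnS_pos _ _ _ _ (Hv 0%nat)).
  assert (H0 := AnS_N_nonneg _ _ _ _ (Hv 0%nat)).
  assert (Hd0 := AnS_N_nonneg _ _ _ _ (Hd 0%nat)).
  assert (Hdd : 0 <= d / (r - r')) by (apply Rdiv_le_0_compat; lra).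
  induction l as [|i l IH]; simpl.
  - apply AnS_ext with (fun _ => 0); [intros; ring|].
    apply AnS_mono with (S := fun _ => True) (4 := AnS_zero _ rho Hrho); auto; lra.
  - apply AnS_ext with (fun z => (v i z - v' i z) * mon l (fun i => v i z)
        + v' i z * (mon l (fun i => v i z) - mon l (fun i => v' i z))); [intros; ring|].
    apply (AnN_mono rho rho (d * r' ^ length l + r' * (r ^ length l * (d / (r - r'))))); [lra| |].
    + assert (Hp : r' ^ length l <= r ^ length l) by (apply pow_incr; lra).
      assert (Hq : d * r' ^ length l <= d * r ^ length l) by now apply Rmult_le_compat_l.
      replace (r * r ^ length l * (d / (r - r'))) with
        (d * r ^ length l + r' * (r ^ length l * (d / (r - r')))) by (field; lra).
      lra.
    + apply AnS_plus; apply AnN_mult; auto. now apply AnN_mon_comp.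
Qed.

Lemma AnN_lip rho r r' d N f (v v' : nat -> pt -> R) :
  AnN r N f ->
  r' < r -> (forall i, AnN rho r' (v i)) -> (forall i, AnN rho r' (v' i)) ->
  (forall i, AnN rho d (fun z => v i z - v' i z)) ->
  AnN rho (N * (d / (r - r'))) (fun z => f (fun i => v i z) - f (fun i => v' i z)).
Proof.
  intros [Hr [a [l [_ [He [HN Hf]]]]]] Hr' Hv Hv' Hd.
  assert (Hrho := AnS_pos _ _ _ _ (Hv 0%nat)).
  assert (Hd0 := AnS_N_nonneg _ _ _ _ (Hd 0%nat)).
  assert (Hdd : 0 <= d / (r - r')) by (apply Rdiv_le_0_compat; lra).
  apply (AnN_mono rho rho (Series (fun k => Rabs (a k) * r ^ length (l k) * (d / (r - r'))))); [lra | |].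
  - rewrite Series_scal_r. now apply Rmult_le_compat_r.
  - apply (AnS_series _ rho _ (fun k z => a k *
       (mon (l k) (fun i => v i z) - mon (l k) (fun i => v' i z)))).
    + exact Hrho.
    + intros k. rewrite Rmult_assoc. apply AnN_scal. now apply AnN_mon_lip.
    + apply (ex_series_scal_r (d / (r - r'))). exact He.
    + intros z Hz.
      assert (H1 := Hf _ (AnN_box rho r r' v z Hv Hr' Hz)).
      assert (H2 := Hf _ (AnN_box rho r r' v' z Hv' Hr' Hz)).
      assert (H3 := is_series_minus _ _ _ _ H1 H2).
      apply is_series_ext with (2 := H3).
      intros k. unfold plus, opp; simpl. ring.
Qed.

Lemma AnN_lip_pt r r' d N f z w :
  AnN r N f -> r' < r -> (forall i, Rabs (z i) <= r') -> (forall i, Rabs (w i) <= r') ->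
  (forall i, Rabs (z i - w i) <= d) -> Rabs (f z - f w) <= N * (d / (r - r')).
Proof.
  intros Hf Hr Hz Hw Hd.
  assert (H := AnN_lip 1 r r' d N f (fun i _ => z i) (fun i _ => w i) Hf Hr).
  apply (AnS_bound (fun _ => True) 1 _ (fun _ => f (fun i => z i) - f (fun i => w i)) pt0).
  - apply H; intros i.
    + apply (AnN_mono 1 1 (Rabs (z i))); [lra | apply Hz | apply AnN_const; lra].
    + apply (AnN_mono 1 1 (Rabs (w i))); [lra | apply Hw | apply AnN_const; lra].
    + apply (AnN_mono 1 1 (Rabs (z i - w i))); [lra | apply Hd | apply AnN_const; lra].
  - apply box_zero; lra.
Qed.

Definition upd (z : pt) (i : nat) (x : R) : pt := fun j => if (j =? i)%nat then x else z j.

Lemma upd_same z i : upd z i (z i) = z.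
Proof.
  apply functional_extensionality. intros j. unfold upd.
  destruct (Nat.eqb_spec j i); subst; reflexivity.
Qed.

Lemma upd_upd z i x y : upd (upd z i x) i y = upd z i y.
Proof.
  apply functional_extensionality. intros j. unfold upd.
  destruct (Nat.eqb_spec j i); subst; reflexivity.
Qed.

Lemma upd_eq z i x : upd z i x i = x.
Proof. unfold upd. now rewrite Nat.eqb_refl. Qed.

Lemma box_upd r z i x : box r z -> Rabs x < r -> box r (upd z i x).
Proof.
  intros [s [H1 H2]] Hx. exists (Rmax s (Rabs x)). split.
  - now apply Rmax_lub_lt.
  - intros j. unfold upd. destruct (j =? i)%nat.
    + apply Rmax_r.
    + apply Rle_trans with (2 := Rmax_l _ _). apply H2.
Qed.

(** Division of a monomial by a coordinate, when it occurs. *)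
Fixpoint rem1 (i : nat) (l : list nat) : option (list nat) :=
  match l with
  | nil => None
  | j :: l => if (j =? i)%nat then Some l else
              match rem1 i l with Some l' => Some (j :: l') | None => None end
  end.

Lemma rem1_spec i l z :
  match rem1 i l with
  | Some l' => length l = S (length l') /\ mon l z = z i * mon l' z /\ mon l (upd z i 0) = 0
  | None => mon l (upd z i 0) = mon l z
  end.
Proof.
  induction l as [|j l IH]; simpl; [reflexivity|].
  destruct (Nat.eqb_spec j i) as [->|H].
  - rewrite upd_eq. repeat split; ring.
  - assert (E : upd z i 0 j = z j).
    { unfold upd. destruct (Nat.eqb_spec j i); [contradiction|reflexivity]. }
    rewrite E. destruct (rem1 i l) as [l'|].
    + destruct IH as [H1 [H2 H3]]. simpl. rewrite H1, H2, H3. repeat split; ring.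
    + now rewrite IH.
Qed.

(** Hadamard's lemma, monomial by monomial. *)
Lemma AnN_hadamard r N f i : AnN r N f ->
  exists g, AnN r (N / r) g /\ forall z, box r z -> f z = f (upd z i 0) + z i * g z.
Proof.
  intros [Hr [a [l [_ [He [HN Hf]]]]]].
  set (b := fun k => match rem1 i (l k) with Some _ => a k | None => 0 end).
  set (m := fun k => match rem1 i (l k) with Some l' => l' | None => nil end).
  assert (Hb : forall k, Rabs (b k) * r ^ length (m k) <= / r * (Rabs (a k) * r ^ length (l k))).
  { intros k. unfold b, m. assert (S := rem1_spec i (l k) (fun _ => 0)).
    destruct (rem1 i (l k)) as [l'|].
    - destruct S as [S _]. rewrite S. simpl. right. field. lra.
    - rewrite Rabs_R0, Rmult_0_l. apply Rmult_le_pos; [apply Rlt_le, Rinv_0_lt_compat, Hr|].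
      apply Rmult_le_pos; [apply Rabs_pos | apply pow_le; lra]. }
  assert (Hb0 : forall k, 0 <= Rabs (b k) * r ^ length (m k)).
  { intros k. apply Rmult_le_pos; [apply Rabs_pos | apply pow_le; lra]. }
  assert (Hra : ex_series (fun k => / r * (Rabs (a k) * r ^ length (l k)))).
  { apply (ex_series_mult_l (/ r)). exact He. }
  assert (Hex : ex_series (fun k => Rabs (b k) * r ^ length (m k))).
  { apply ex_series_ext with (fun k => Rabs (Rabs (b k) * r ^ length (m k))).
    - intros k. now apply Rabs_pos_eq.
    - apply ex_series_dom with (2 := Hra). intros k. rewrite Rabs_pos_eq; auto. }
  assert (Hg : forall z, box r z -> ex_series (fun k => b k * mon (m k) z)).
  { intros z Hz. apply ex_series_Rabs. apply ex_series_dom with (2 := Hex).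
    intros k. apply term_bound. intros j. now apply box_weak. }
  exists (fun z => Series (fun k => b k * mon (m k) z)). split.
  - split; [exact Hr|]. exists b, m. repeat split; auto.
    + apply Rle_trans with (1 := Series_le _ _ (fun k => conj (Hb0 k) (Hb k)) Hra).
      rewrite Series_scal_l. unfold Rdiv. rewrite Rmult_comm.
      apply Rmult_le_compat_r; [apply Rlt_le, Rinv_0_lt_compat, Hr | exact HN].
    + intros z Hz. apply Series_correct. now apply Hg.
  - intros z Hz.
    assert (Hz0 : box r (upd z i 0)) by (apply box_upd; [exact Hz | now rewrite Rabs_R0]).
    assert (H1 := Hf _ Hz). assert (H2 := Hf _ Hz0).
    rewrite <- (is_series_unique _ _ H1), <- (is_series_unique _ _ H2).
    rewrite <- Series_scal_l, <- Series_plus.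
    + apply Series_ext. intros k. unfold b, m. assert (S := rem1_spec i (l k) z).
      destruct (rem1 i (l k)) as [l'|].
      * destruct S as [_ [S1 S2]]. rewrite S1, S2. ring.
      * rewrite S. ring.
    + eexists; exact H2.
    + apply (ex_series_mult_l (z i)). now apply Hg.
Qed.

(** * Differentiation and integration of power series *)

Fixpoint fsum (n : nat) (f : nat -> R) : R :=
  match n with O => 0 | S n => fsum n f + f n end.

Lemma fsum_ext n f g : (forall i, (i < n)%nat -> f i = g i) -> fsum n f = fsum n g.
Proof.
  induction n as [|n IH]; simpl; intros H; [reflexivity|].
  rewrite IH, H; auto.
Qed.

Lemma fsum_scal n c f : fsum n (fun i => c * f i) = c * fsum n f.
Proof. induction n as [|n IH]; simpl; [ring | rewrite IH; ring]. Qed.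

Lemma fsum_plus n f g : fsum n (fun i => f i + g i) = fsum n f + fsum n g.
Proof. induction n as [|n IH]; simpl; [ring | rewrite IH; ring]. Qed.

Lemma fsum_single n j (h : nat -> R) :
  fsum n (fun i => h i * (if (j =? i)%nat then 1 else 0)) = if (j <? n)%nat then h j else 0.
Proof.
  induction n as [|n IH]; simpl.
  - destruct (Nat.ltb_spec j 0); [lia | reflexivity].
  - rewrite IH. destruct (Nat.ltb_spec j n), (Nat.eqb_spec j n), (Nat.ltb_spec j (S n));
      try lia; try subst; ring.
Qed.

Lemma is_derive_fsum n (f : nat -> R -> R) (f' : nat -> R) x :
  (forall i, (i < n)%nat -> is_derive (f i) x (f' i)) ->
  is_derive (fun x => fsum n (fun i => f i x)) x (fsum n f').
Proof.
  induction n as [|n IH]; simpl; intros H.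
  - apply D_const.
  - apply D_plus; auto.
Qed.

Lemma is_derive_quadratic (e : R -> R) x0 C :
  e x0 = 0 -> locally x0 (fun x => Rabs (e x) <= C * (x - x0) ^ 2) -> is_derive e x0 0.
Proof.
  intros H0 [d Hd]. apply is_derive_Reals. intros eps Heps.
  assert (Hm : 0 < Rmin d (eps / (Rabs C + 1))).
  { apply Rmin_pos; [apply cond_pos|]. apply Rdiv_lt_0_compat; [lra|].
    assert (H := Rabs_pos C). lra. }
  exists (mkposreal _ Hm). intros h Hh Hlt. simpl in Hlt.
  assert (H1 : Rabs h < d) by (apply Rlt_le_trans with (1 := Hlt), Rmin_l).
  assert (H2 : Rabs h < eps / (Rabs C + 1)) by (apply Rlt_le_trans with (1 := Hlt), Rmin_r).
  rewrite H0, Rminus_0_r, Rminus_0_r.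
  assert (H3 : Rabs (e (x0 + h)) <= C * h ^ 2).
  { replace h with (x0 + h - x0) at 2 by ring. apply Hd.
    change (Rabs (x0 + h - x0) < d). now replace (x0 + h - x0) with h by ring. }
  unfold Rdiv. rewrite Rabs_mult, Rabs_inv.
  assert (Hp : 0 < Rabs h) by now apply Rabs_pos_lt.
  apply Rmult_lt_reg_r with (Rabs h); [exact Hp|].
  rewrite Rmult_assoc, Rinv_l, Rmult_1_r by lra.
  apply Rle_lt_trans with (1 := H3).
  assert (HC := Rabs_pos C).
  assert (H4 : C * h ^ 2 <= Rabs C * Rabs h * Rabs h).
  { rewrite <- Rsqr_pow2, Rsqr_abs. unfold Rsqr. rewrite Rmult_assoc.
    apply Rmult_le_compat_r; [nra | apply Rle_abs]. }
  apply Rle_lt_trans with (1 := H4).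
  apply Rmult_lt_compat_r; [exact Hp|].
  apply Rle_lt_trans with ((Rabs C + 1) * Rabs h); [nra|].
  apply Rlt_le_trans with ((Rabs C + 1) * (eps / (Rabs C + 1))).
  - apply Rmult_lt_compat_l; lra.
  - right. field. lra.
Qed.

(** The differential of a monomial at [w] in the direction [h]. *)
Fixpoint dmon (l : list nat) (w h : pt) : R :=
  match l with nil => 0 | i :: l => h i * mon l w + w i * dmon l w h end.

Definition unit_pt (i : nat) : pt := fun j => if (j =? i)%nat then 1 else 0.

Lemma dmon_coord l w h n : (forall i, (n <= i)%nat -> h i = 0) ->
  dmon l w h = fsum n (fun i => h i * dmon l w (unit_pt i)).
Proof.
  intros Hh. induction l as [|j l IH]; simpl.
  - symmetry. rewrite (fsum_ext n _ (fun i => 0 * 0)) by (intros; ring).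
    rewrite fsum_scal. ring.
  - rewrite (fsum_ext n _ (fun i => mon l w * (h i * (if (j =? i)%nat then 1 else 0))
        + w j * (h i * dmon l w (unit_pt i)))) by (intros; unfold unit_pt; ring).
    rewrite fsum_plus, !fsum_scal, <- IH, fsum_single.
    destruct (Nat.ltb_spec j n) as [H|H]; [ring | rewrite Hh by lia; ring].
Qed.

Lemma dmon_bound l w h r r' d : 0 <= r' < r -> 0 <= d ->
  (forall i, Rabs (w i) <= r') -> (forall i, Rabs (h i) <= d) ->
  Rabs (dmon l w h) <= r ^ length l * (d / (r - r')).
Proof.
  intros Hr Hd Hw Hh.
  assert (Hdd : 0 <= d / (r - r')) by (apply Rdiv_le_0_compat; lra).
  induction l as [|i l IH]; simpl.
  - rewrite Rabs_R0. lra.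
  - apply Rle_trans with (1 := Rabs_triang _ _). rewrite !Rabs_mult.
    assert (Hm := mon_bound l w r' Hw).
    assert (Hp : r' ^ length l <= r ^ length l) by (apply pow_incr; lra).
    assert (E1 : Rabs (h i) * Rabs (mon l w) <= d * r ^ length l).
    { apply Rmult_le_compat; auto using Rabs_pos. lra. }
    assert (E2 : Rabs (w i) * Rabs (dmon l w h) <= r' * (r ^ length l * (d / (r - r')))).
    { apply Rmult_le_compat; auto using Rabs_pos. }
    replace (r * r ^ length l * (d / (r - r'))) with
        (d * r ^ length l + r' * (r ^ length l * (d / (r - r')))) by (field; lra).
    lra.
Qed.

Lemma mon_lip l z w r r' d : 0 <= r' < r -> 0 <= d ->
  (forall i, Rabs (z i) <= r') -> (forall i, Rabs (w i) <= r') ->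
  (forall i, Rabs (z i - w i) <= d) ->
  Rabs (mon l z - mon l w) <= r ^ length l * (d / (r - r')).
Proof.
  intros Hr Hd Hz Hw Hh.
  assert (Hc : forall c e, Rabs c <= e -> AnN 1 e (fun _ => c)).
  { intros c e He. apply (AnN_mono 1 1 (Rabs c)); [lra | exact He | apply AnN_const; lra]. }
  apply (AnS_bound (fun _ => True) 1 _ (fun _ => mon l z - mon l w) pt0); [|apply box_zero; lra].
  apply (AnN_mon_lip 1 r r' d l (fun i _ => z i) (fun i _ => w i)); auto; lra.
Qed.

(** As for [mon_lip], by induction on the factors; the bound is that of a second
    derivative under a Cauchy estimate. *)
Lemma mon_taylor l z w r r' d : 0 <= r' < r -> 0 <= d ->
  (forall i, Rabs (z i) <= r') -> (forall i, Rabs (w i) <= r') ->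
  (forall i, Rabs (z i - w i) <= d) ->
  Rabs (mon l z - mon l w - dmon l w (fun i => z i - w i)) <= r ^ length l * (d / (r - r')) ^ 2.
Proof.
  intros Hr Hd Hz Hw Hh.
  assert (Hdd : 0 <= d / (r - r')) by (apply Rdiv_le_0_compat; lra).
  induction l as [|i l IH].
  - simpl. rewrite Rminus_diag, Rminus_0_r, Rabs_R0. nra.
  - assert (E0 := mon_lip l z w r r' d Hr Hd Hz Hw Hh).
    cbn [mon dmon length].
    replace (z i * mon l z - w i * mon l w -
       ((z i - w i) * mon l w + w i * dmon l w (fun i => z i - w i))) with
      ((z i - w i) * (mon l z - mon l w) +
        w i * (mon l z - mon l w - dmon l w (fun i => z i - w i))) by ring.
    apply Rle_trans with (1 := Rabs_triang _ _). rewrite !Rabs_mult.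
    assert (E1 : Rabs (z i - w i) * Rabs (mon l z - mon l w) <= d * (r ^ length l * (d / (r - r')))).
    { apply Rmult_le_compat; auto using Rabs_pos. }
    assert (E2 : Rabs (w i) * Rabs (mon l z - mon l w - dmon l w (fun i => z i - w i))
       <= r' * (r ^ length l * (d / (r - r')) ^ 2)).
    { apply Rmult_le_compat; auto using Rabs_pos. }
    rewrite <- tech_pow_Rmult.
    replace (r * r ^ length l * (d / (r - r')) ^ 2) with
        (d * (r ^ length l * (d / (r - r'))) + r' * (r ^ length l * (d / (r - r')) ^ 2))
      by (field; lra).
    lra.
Qed.

(** Power series with named terms: the termwise derivative [dser] has to refer to them. *)
Definition ser (a : nat -> R) (l : nat -> list nat) (r : R) (f : pt -> R) : Prop :=
  0 < r /\ ex_series (fun k => Rabs (a k) * r ^ length (l k)) /\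
  forall z, box r z -> is_series (fun k => a k * mon (l k) z) (f z).

Definition dser (a : nat -> R) (l : nat -> list nat) (i : nat) (z : pt) : R :=
  Series (fun k => a k * dmon (l k) z (unit_pt i)).

Lemma unit_pt_le i j : Rabs (unit_pt i j) <= 1.
Proof. unfold unit_pt. destruct (j =? i)%nat; rewrite ?Rabs_R1, ?Rabs_R0; lra. Qed.

Lemma dser_bound a l r r' z : 
  ex_series (fun k => Rabs (a k) * r ^ length (l k)) -> 0 <= r' < r ->
  (forall i, Rabs (z i) <= r') -> forall h d, 0 <= d -> (forall i, Rabs (h i) <= d) ->
  ex_series (fun k => a k * dmon (l k) z h).
Proof.
  intros He Hr Hz h d Hd Hh. apply ex_series_Rabs.
  apply ex_series_dom with (fun k => Rabs (a k) * r ^ length (l k) * (d / (r - r'))).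
  - intros k. rewrite Rabs_mult, Rmult_assoc. apply Rmult_le_compat_l; [apply Rabs_pos|].
    now apply dmon_bound.
  - apply (ex_series_scal_r (d / (r - r'))). exact He.
Qed.

Lemma Series_dmon a l r r' z h d n :
  ex_series (fun k => Rabs (a k) * r ^ length (l k)) -> 0 <= r' < r ->
  (forall i, Rabs (z i) <= r') -> 0 <= d -> (forall i, Rabs (h i) <= d) ->
  (forall i, (n <= i)%nat -> h i = 0) ->
  Series (fun k => a k * dmon (l k) z h) = fsum n (fun i => h i * dser a l i z).
Proof.
  intros He Hr Hz Hd Hh Hn.
  rewrite (Series_ext _ (fun k => fsum n (fun i => h i * (a k * dmon (l k) z (unit_pt i))))).
  2: { intros k. rewrite (dmon_coord _ _ _ n Hn), <- fsum_scal.
       apply fsum_ext. intros i _. ring. }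
  assert (Hu : forall i, ex_series (fun k => h i * (a k * dmon (l k) z (unit_pt i)))).
  { intros i. apply (ex_series_mult_l (h i)).
    apply (dser_bound a l r r' z He Hr Hz _ 1); [lra | apply unit_pt_le]. }
  clear Hn.
  assert (H : forall n, Series (fun k => fsum n (fun i => h i * (a k * dmon (l k) z (unit_pt i))))
      = fsum n (fun i => h i * dser a l i z) /\
      ex_series (fun k => fsum n (fun i => h i * (a k * dmon (l k) z (unit_pt i))))).
  { clear n. intros n. induction n as [|n [IH1 IH2]]; simpl.
    - split.
      + apply is_series_unique, is_series_zero.
      + exists 0. apply is_series_zero.
    - split.
      + rewrite Series_plus by auto. rewrite IH1. f_equal.
        apply Series_scal_l.
      + apply (ex_series_plus (K := R_AbsRing) (V := R_NormedModule)); auto. }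
  apply H.
Qed.

Lemma ser_taylor a l r f z w r' d :
  ser a l r f -> 0 <= r' < r -> 0 <= d ->
  (forall i, Rabs (z i) <= r') -> (forall i, Rabs (w i) <= r') ->
  (forall i, Rabs (z i - w i) <= d) ->
  Rabs (f z - f w - Series (fun k => a k * dmon (l k) w (fun i => z i - w i)))
  <= Series (fun k => Rabs (a k) * r ^ length (l k)) * (d / (r - r')) ^ 2.
Proof.
  intros [Hr0 [He Hf]] Hr Hd Hz Hw Hh.
  assert (Bz : box r z) by (exists r'; split; [lra | exact Hz]).
  assert (Bw : box r w) by (exists r'; split; [lra | exact Hw]).
  assert (E1 := Hf z Bz). assert (E2 := Hf w Bw).
  assert (E3 := dser_bound a l r r' w He Hr Hw _ d Hd Hh).
  rewrite <- (is_series_unique _ _ E1), <- (is_series_unique _ _ E2).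
  rewrite <- Series_minus; [| eexists; exact E1 | eexists; exact E2].
  rewrite <- Series_minus; [| | exact E3].
  2: { apply (ex_series_minus (K := R_AbsRing) (V := R_NormedModule)); eexists; eassumption. }
  rewrite <- Series_scal_r. apply Series_dom.
  - intros k. replace (a k * mon (l k) z - a k * mon (l k) w - a k * dmon (l k) w (fun i => z i - w i))
      with (a k * (mon (l k) z - mon (l k) w - dmon (l k) w (fun i => z i - w i))) by ring.
    rewrite Rabs_mult, Rmult_assoc. apply Rmult_le_compat_l; [apply Rabs_pos|].
    now apply mon_taylor.
  - apply (ex_series_scal_r ((d / (r - r')) ^ 2)). exact He.
Qed.

Lemma curve_lip n (v : nat -> R -> R) (v' : nat -> R) x0 :
  (forall i, (i < n)%nat -> is_derive (v i) x0 (v' i)) ->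
  (forall i, (n <= i)%nat -> forall x, v i x = v i x0) ->
  exists K, 0 <= K /\ locally x0 (fun x => forall i, Rabs (v i x - v i x0) <= K * Rabs (x - x0)).
Proof.
  intros Hd Hc.
  assert (H : forall m, exists K, 0 <= K /\
     locally x0 (fun x => forall i, (i < m)%nat -> Rabs (v i x - v i x0) <= K * Rabs (x - x0))).
  { induction m as [|m [K [HK IH]]].
    - exists 0. split; [lra|]. apply filter_forall. intros x i Hi. lia.
    - destruct (le_lt_dec n m) as [Hnm|Hnm].
      + exists K. split; [exact HK|]. apply filter_imp with (2 := IH). intros x Hx i Hi.
        destruct (Nat.eq_dec i m) as [->|Hne]; [| apply Hx; lia].
        rewrite Hc by exact Hnm. rewrite Rminus_diag, Rabs_R0.
        apply Rmult_le_pos; [exact HK | apply Rabs_pos].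
      + assert (Hdm := Hd m Hnm). apply is_derive_Reals in Hdm.
        destruct (Hdm 1 Rlt_0_1) as [dl Hdl].
        exists (Rmax K (Rabs (v' m) + 1)). split.
        { apply Rle_trans with (2 := Rmax_l _ _). exact HK. }
        apply filter_imp with (fun x => (forall i, (i < m)%nat ->
          Rabs (v i x - v i x0) <= K * Rabs (x - x0)) /\ Rabs (x - x0) < dl).
        * intros x [Hx1 Hx2] i Hi. destruct (Nat.eq_dec i m) as [->|Hne].
          -- apply Rle_trans with ((Rabs (v' m) + 1) * Rabs (x - x0)).
             2: { apply Rmult_le_compat_r; [apply Rabs_pos | apply Rmax_r]. }
             destruct (Req_dec x x0) as [->|Hxx].
             { rewrite !Rminus_diag, Rabs_R0. lra. }
             assert (Hq := Hdl (x - x0) ltac:(lra) Hx2).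
             replace (x0 + (x - x0)) with x in Hq by ring.
             assert (Hq2 : Rabs ((v m x - v m x0) / (x - x0)) <= Rabs (v' m) + 1).
             { replace ((v m x - v m x0) / (x - x0)) with
                 (v' m + ((v m x - v m x0) / (x - x0) - v' m)) by ring.
               apply Rle_trans with (1 := Rabs_triang _ _). lra. }
             replace (v m x - v m x0) with ((v m x - v m x0) / (x - x0) * (x - x0))
               by (field; lra).
             rewrite Rabs_mult. apply Rmult_le_compat_r; [apply Rabs_pos | exact Hq2].
          -- apply Rle_trans with (1 := Hx1 i ltac:(lia)).
             apply Rmult_le_compat_r; [apply Rabs_pos | apply Rmax_l].
        * apply filter_and; [exact IH|]. exists dl. intros y Hy. exact Hy. }
  destruct (H n) as [K [HK HL]]. exists K. split; [exact HK|].
  apply filter_imp with (2 := HL). intros x Hx i.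
  destruct (le_lt_dec n i) as [Hi|Hi]; [| now apply Hx].
  rewrite Hc by exact Hi. rewrite Rminus_diag, Rabs_R0.
  apply Rmult_le_pos; [exact HK | apply Rabs_pos].
Qed.

(** The first order Taylor remainder is quadratic in the displacement, with a constant
    that does not depend on the number of variables; along a differentiable curve the
    displacement is at most linear in the parameter ([curve_lip]), and only the finitely
    many moving coordinates contribute to the differential. *)
Lemma ser_chain a l r f n (v : nat -> R -> R) (v' : nat -> R) x0 :
  ser a l r f -> box r (fun i => v i x0) ->
  (forall i, (i < n)%nat -> is_derive (v i) x0 (v' i)) ->
  (forall i, (n <= i)%nat -> forall x, v i x = v i x0) ->
  is_derive (fun x => f (fun i => v i x)) x0
    (fsum n (fun i => v' i * dser a l i (fun i => v i x0))).
Proof.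
  intros Hs Hb Hd Hc.
  destruct (box_bound _ _ Hb) as [r0 [Hr0 Hv0]].
  set (r' := (r0 + r) / 2).
  assert (Hr' : r0 < r' < r) by (unfold r'; lra).
  destruct (curve_lip n v v' x0 Hd Hc) as [K [HK HL]].
  set (w := fun i => v i x0).
  set (g := fun x => fsum n (fun i => v i x * dser a l i w)).
  assert (Hg : is_derive g x0 (fsum n (fun i => v' i * dser a l i w))).
  { apply is_derive_fsum. intros i Hi.
    exact (is_derive_scal_l (v i) x0 (v' i) (dser a l i w) (Hd i Hi)). }
  set (C := Series (fun k => Rabs (a k) * r ^ length (l k)) * (K / (r - r')) ^ 2).
  set (e := fun x => f (fun i => v i x) - f w - (g x - g x0)).
  assert (He : is_derive e x0 0).
  { apply is_derive_quadratic with C.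
    - unfold e, w. ring.
    - assert (Hdel : 0 < (r' - r0) / (K + 1)) by (apply Rdiv_lt_0_compat; lra).
      apply filter_imp with (fun x => (forall i, Rabs (v i x - v i x0) <= K * Rabs (x - x0)) /\
         Rabs (x - x0) < (r' - r0) / (K + 1)).
      + intros x [Hx1 Hx2].
        assert (Hsmall : K * Rabs (x - x0) <= r' - r0).
        { apply Rle_trans with ((K + 1) * Rabs (x - x0)).
          - assert (H := Rabs_pos (x - x0)). nra.
          - apply Rle_trans with ((K + 1) * ((r' - r0) / (K + 1))).
            + apply Rmult_le_compat_l; lra.
            + right. field. lra. }
        assert (Hzx : forall i, Rabs (v i x) <= r').
        { intros i. replace (v i x) with (v i x0 + (v i x - v i x0)) by ring.
          apply Rle_trans with (1 := Rabs_triang _ _).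
          specialize (Hv0 i). specialize (Hx1 i). simpl in Hv0. lra. }
        assert (Hwx : forall i, Rabs (w i) <= r').
        { intros i. apply Rle_trans with (1 := Hv0 i). lra. }
        assert (HKx : 0 <= K * Rabs (x - x0)) by (apply Rmult_le_pos; [lra | apply Rabs_pos]).
        assert (HT := ser_taylor a l r f (fun i => v i x) w r' (K * Rabs (x - x0)) Hs
           ltac:(lra) HKx Hzx Hwx Hx1).
        rewrite (Series_dmon a l r r' w _ (K * Rabs (x - x0)) n) in HT; auto.
        * unfold e. unfold C. unfold g at 1 2.
          replace (fsum n (fun i => v i x * dser a l i w) - fsum n (fun i => v i x0 * dser a l i w))
            with (fsum n (fun i => (v i x - w i) * dser a l i w)).
          -- apply Rle_trans with (1 := HT). right.
             replace ((K * Rabs (x - x0) / (r - r')) ^ 2) with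
               ((K / (r - r')) ^ 2 * (Rabs (x - x0)) ^ 2) by (field; lra).
             rewrite pow2_abs. ring.
          -- assert (E : forall m, fsum m (fun i => (v i x - w i) * dser a l i w) =
               fsum m (fun i => v i x * dser a l i w) - fsum m (fun i => v i x0 * dser a l i w)).
             { induction m as [|m IH]; simpl; [ring | rewrite IH; unfold w; ring]. }
             apply E.
        * apply Hs.
        * lra.
        * intros i Hi. unfold w. rewrite Hc by exact Hi. ring.
      + apply filter_and; [exact HL|]. exists (mkposreal _ Hdel). intros y Hy. exact Hy. }
  apply (is_derive_ext (fun x => e x + g x + (f w - g x0))).
  - intros x. unfold e. real_eq. ring.
  - apply (deriv_val _ _ _ _ (D_plus _ _ _ _ _ (D_plus _ _ _ _ _ He Hg) (D_const _ _))). ring.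
Qed.

Lemma AnN_dmon r r' l i : 0 < r' < r ->
  AnN r' (r ^ length l * / (r - r')) (fun z => dmon l z (unit_pt i)).
Proof.
  intros Hr. assert (Hi : 0 < / (r - r')) by (apply Rinv_0_lt_compat; lra).
  induction l as [|j l IH]; simpl.
  - apply AnS_mono with (S := fun _ => True) (4 := AnS_zero _ r' (proj1 Hr)); auto; lra.
  - apply (AnN_mono r' r' (Rabs (unit_pt i j) * r' ^ length l
        + r' * (r ^ length l * / (r - r')))); [lra | |].
    + assert (Hp : r' ^ length l <= r ^ length l) by (apply pow_incr; lra).
      assert (H1 : Rabs (unit_pt i j) * r' ^ length l <= 1 * r ^ length l).
      { apply Rmult_le_compat; [apply Rabs_pos | apply pow_le; lra | apply unit_pt_le | exact Hp]. }
      replace (r * r ^ length l * / (r - r')) with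
        (1 * r ^ length l + r' * (r ^ length l * / (r - r'))) by (field; lra).
      lra.
    + apply AnS_plus.
      * apply AnN_scal. apply (AnN_mon_comp r' r' l (fun i z => z i)); [lra|].
        intros k. apply AnN_var. lra.
      * apply AnN_mult; [apply AnN_var; lra | exact IH].
Qed.

Lemma AnN_dser a l r r' f i : ser a l r f -> 0 < r' < r ->
  AnN r' (Series (fun k => Rabs (a k) * r ^ length (l k)) * / (r - r')) (dser a l i).
Proof.
  intros [Hr [He Hf]] Hr'.
  rewrite <- Series_scal_r.
  apply (AnS_series _ r' _ (fun k z => a k * dmon (l k) z (unit_pt i))).
  - lra.
  - intros k. rewrite Rmult_assoc. apply AnN_scal. now apply AnN_dmon.
  - apply (ex_series_scal_r (/ (r - r'))). exact He.
  - intros z Hz. apply Series_correct.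
    apply (dser_bound a l r r' z He ltac:(lra)) with 1.
    + intros j. now apply box_weak.
    + lra.
    + apply unit_pt_le.
Qed.

Definition pd (i : nat) (f : pt -> R) (z : pt) : R := Derive (fun x => f (upd z i x)) (z i).

Lemma ser_pd a l r f i z : ser a l r f -> box r z ->
  is_derive (fun x => f (upd z i x)) (z i) (dser a l i z).
Proof.
  intros Hs Hz.
  set (v := fun j x => upd z i x j).
  assert (E : (fun j => v j (z i)) = z) by (unfold v; apply upd_same).
  assert (H := ser_chain a l r f (S i) v (unit_pt i) (z i) Hs).
  rewrite E in H.
  replace (dser a l i z) with (fsum (S i) (fun j => unit_pt i j * dser a l j z)).
  - apply H.
    + exact Hz.
    + intros j _. unfold v, unit_pt, upd. destruct (j =? i)%nat.
      * apply D_id.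
      * apply D_const.
    + intros j Hj x. unfold v, upd. destruct (Nat.eqb_spec j i); [lia | reflexivity].
  - simpl. unfold unit_pt at 2. rewrite Nat.eqb_refl.
    rewrite (fsum_ext i _ (fun j => 0 * 0)).
    + rewrite fsum_scal. ring.
    + intros j Hj. unfold unit_pt. destruct (Nat.eqb_spec j i); [lia | ring].
Qed.

Lemma AnN_ser r N f : AnN r N f -> exists a l, ser a l r f /\
   Series (fun k => Rabs (a k) * r ^ length (l k)) <= N.
Proof. intros [Hr [a [l [_ [He [HN Hf]]]]]]. exists a, l. repeat split; auto. Qed.

Lemma AnN_pd r N f i z : AnN r N f -> box r z ->
  is_derive (fun x => f (upd z i x)) (z i) (pd i f z).
Proof.
  intros Hf Hz. destruct (AnN_ser _ _ _ Hf) as [a [l [Hs _]]].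
  assert (H := ser_pd a l r f i z Hs Hz).
  apply (deriv_val _ _ _ _ H). symmetry. exact (is_derive_unique _ _ _ H).
Qed.

Lemma AnN_pd_at r N f i z x : AnN r N f -> box r z -> Rabs x < r ->
  is_derive (fun x => f (upd z i x)) x (pd i f (upd z i x)).
Proof.
  intros Hf Hz Hx.
  assert (H := AnN_pd r N f i (upd z i x) Hf (box_upd r z i x Hz Hx)).
  rewrite upd_eq in H. apply is_derive_ext with (2 := H).
  intros t. now rewrite upd_upd.
Qed.

Lemma AnN_pd_An r r' N f i : AnN r N f -> 0 < r' < r -> AnN r' (N / (r - r')) (pd i f).
Proof.
  intros Hf Hr'. destruct (AnN_ser _ _ _ Hf) as [a [l [Hs HN]]].
  apply AnS_ext with (dser a l i).
  - intros z Hz. symmetry. apply is_derive_unique. apply (ser_pd a l r f i z Hs).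
    apply box_mono with (2 := Hz). lra.
  - apply (AnN_mono r' r' (Series (fun k => Rabs (a k) * r ^ length (l k)) * / (r - r'))).
    + lra.
    + apply Rmult_le_compat_r; [apply Rlt_le, Rinv_0_lt_compat; lra | exact HN].
    + apply (AnN_dser a l r r' f); [exact Hs | lra].
Qed.

Lemma AnN_chain r N f n (v : nat -> R -> R) (v' : nat -> R) x0 :
  AnN r N f -> box r (fun i => v i x0) ->
  (forall i, (i < n)%nat -> is_derive (v i) x0 (v' i)) ->
  (forall i, (n <= i)%nat -> forall x, v i x = v i x0) ->
  is_derive (fun x => f (fun i => v i x)) x0
    (fsum n (fun i => v' i * pd i f (fun i => v i x0))).
Proof.
  intros Hf Hb Hd Hc. destruct (AnN_ser _ _ _ Hf) as [a [l [Hs HN]]].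
  assert (H := ser_chain a l r f n v v' x0 Hs Hb Hd Hc).
  rewrite (fsum_ext n _ (fun i => v' i * dser a l i (fun i => v i x0))); [exact H|].
  intros i _. f_equal. apply is_derive_unique. now apply (ser_pd a l r f).
Qed.

(** Primitive with respect to the coordinate of index 0, which plays the role of time. *)
Definition prim (f : pt -> R) (z : pt) : R := RInt (fun x => f (upd z 0 x)) 0 (z 0%nat).

Lemma dmon0_count l w :
  w 0%nat * dmon l w (unit_pt 0) = INR (count_occ Nat.eq_dec l 0%nat) * mon l w.
Proof.
  induction l as [|j l IH]; simpl; [ring|].
  rewrite Rmult_plus_distr_l.
  replace (w 0%nat * (w j * dmon l w (unit_pt 0))) with
    (w j * (w 0%nat * dmon l w (unit_pt 0))) by ring.
  rewrite IH. unfold unit_pt. destruct (Nat.eq_dec j 0) as [->|H].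
  - rewrite Nat.eqb_refl, S_INR. ring.
  - destruct (Nat.eqb_spec j 0); [contradiction | ring].
Qed.

(** Termwise integration: [z_0 ^ c] becomes [z_0 ^ (c + 1) / (c + 1)], where [c] is the
    number of occurrences of 0 in the monomial. *)
Lemma AnN_is_prim r N f : AnN r N f ->
  exists G, AnN r (r * N) G /\
    (forall z, box r z -> is_derive (fun x => G (upd z 0 x)) (z 0%nat) (f z)) /\
    (forall z, box r z -> G (upd z 0 0) = 0).
Proof.
  intros Hf. destruct (AnN_ser _ _ _ Hf) as [a [l [[Hr [He Hs]] HN]]].
  set (b := fun k => a k / (INR (count_occ Nat.eq_dec (l k) 0%nat) + 1)).
  set (m := fun k => (0 :: l k)%nat).
  assert (Hc : forall k, 0 < INR (count_occ Nat.eq_dec (l k) 0%nat) + 1).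
  { intros k. assert (H := pos_INR (count_occ Nat.eq_dec (l k) 0%nat)). lra. }
  assert (Hb : forall k, Rabs (b k) * r ^ length (m k) <= r * (Rabs (a k) * r ^ length (l k))).
  { intros k. unfold b, m. simpl.
    replace (r * (Rabs (a k) * r ^ length (l k))) with (Rabs (a k) * (r * r ^ length (l k))) by ring.
    apply Rmult_le_compat_r; [apply Rmult_le_pos; [lra | apply pow_le; lra]|].
    unfold Rdiv. rewrite Rabs_mult, <- (Rmult_1_r (Rabs (a k))) at 1.
    rewrite Rmult_1_r.
    apply Rle_trans with (Rabs (a k) * 1); [|lra].
    apply Rmult_le_compat_l; [apply Rabs_pos|].
    rewrite Rabs_pos_eq by (apply Rlt_le, Rinv_0_lt_compat, Hc).
    rewrite <- Rinv_1. apply Rinv_le_contravar; [lra|].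
    assert (H := pos_INR (count_occ Nat.eq_dec (l k) 0%nat)). lra. }
  assert (Hb0 : forall k, 0 <= Rabs (b k) * r ^ length (m k)).
  { intros k. apply Rmult_le_pos; [apply Rabs_pos | apply pow_le; lra]. }
  assert (Hra : ex_series (fun k => r * (Rabs (a k) * r ^ length (l k)))).
  { apply (ex_series_mult_l r). exact He. }
  assert (Hex : ex_series (fun k => Rabs (b k) * r ^ length (m k))).
  { apply ex_series_ext with (fun k => Rabs (Rabs (b k) * r ^ length (m k))).
    - intros k. now apply Rabs_pos_eq.
    - apply ex_series_dom with (2 := Hra). intros k. rewrite Rabs_pos_eq; auto. }
  set (G := fun z => Series (fun k => b k * mon (m k) z)).
  assert (HG : ser b m r G).
  { split; [exact Hr|]. split; [exact Hex|]. intros z Hz. apply Series_correct.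
    apply ex_series_Rabs. apply ex_series_dom with (2 := Hex).
    intros k. apply term_bound. intros j. now apply box_weak. }
  exists G. split; [|split].
  - split; [exact Hr|]. exists b, m. repeat split; auto.
    + apply Rle_trans with (1 := Series_le _ _ (fun k => conj (Hb0 k) (Hb k)) Hra).
      rewrite Series_scal_l. apply Rmult_le_compat_l; lra.
    + apply HG.
  - intros z Hz. assert (H := ser_pd b m r G 0 z HG Hz).
    replace (f z) with (dser b m 0 z); [exact H|].
    rewrite <- (is_series_unique _ _ (Hs z Hz)). apply Series_ext. intros k.
    unfold b, m. simpl. rewrite dmon0_count. unfold unit_pt. simpl.
    specialize (Hc k). field. lra.
  - intros z Hz. apply is_series_unique.
    apply is_series_ext with (2 := is_series_zero).
    intros k. real_eq. unfold m. simpl. rewrite upd_eq. ring.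
Qed.

Lemma continuous_upd r N f z x : AnN r N f -> box r z -> Rabs x < r ->
  continuous (fun x => f (upd z 0 x)) x.
Proof.
  intros Hf Hz Hx. exact (derivable_continuous _ _ _ (AnN_pd_at r N f 0 z x Hf Hz Hx)).
Qed.

Lemma between_box x y r : Rabs y < r -> Rmin 0 y <= x <= Rmax 0 y -> Rabs x < r.
Proof.
  intros Hy Hx. apply Rabs_def2 in Hy. apply Rabs_def1;
  unfold Rmin, Rmax in Hx; destruct (Rle_dec 0 y); lra.
Qed.

Lemma ex_RInt_upd r N f z : AnN r N f -> box r z ->
  ex_RInt (fun x => f (upd z 0 x)) 0 (z 0%nat).
Proof.
  intros Hf Hz. apply (ex_RInt_continuous (V := R_CompleteNormedModule)).
  intros x Hx. apply (continuous_upd r N); auto.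
  apply between_box with (2 := Hx). now apply box_le.
Qed.

Lemma AnN_prim r N f : AnN r N f -> AnN r (r * N) (prim f).
Proof.
  intros Hf. destruct (AnN_is_prim _ _ _ Hf) as [G [HG [HG1 HG2]]].
  apply AnS_ext with (2 := HG). intros z Hz. unfold prim. symmetry.
  apply is_RInt_unique.
  replace (G z) with (minus (G (upd z 0 (z 0%nat))) (G (upd z 0 0))).
  2: { rewrite HG2 by exact Hz. rewrite upd_same. unfold minus, plus, opp; simpl. ring. }
  apply (is_RInt_derive (V := R_CompleteNormedModule) (fun x => G (upd z 0 x))
     (fun x => f (upd z 0 x))).
  - intros x Hx. assert (Hxr := between_box _ _ _ (box_le r z 0 Hz) Hx).
    assert (H := HG1 (upd z 0 x) (box_upd _ _ _ _ Hz Hxr)).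
    rewrite upd_eq in H. apply is_derive_ext with (2 := H).
    intros t. now rewrite upd_upd.
  - intros x Hx. apply (continuous_upd r N); auto.
    apply between_box with (2 := Hx). now apply box_le.
Qed.

Lemma prim_minus r N M f g z : AnN r N f -> AnN r M g -> box r z ->
  prim f z - prim g z = prim (fun z => f z - g z) z.
Proof.
  intros Hf Hg Hz. unfold prim. symmetry.
  apply (RInt_minus (V := R_CompleteNormedModule) (fun x => f (upd z 0 x)) (fun x => g (upd z 0 x))).
  - now apply (ex_RInt_upd r N).
  - now apply (ex_RInt_upd r M).
Qed.

Lemma is_derive_prim r N f z : AnN r N f -> box r z ->
  is_derive (fun x => prim f (upd z 0 x)) (z 0%nat) (f z).
Proof.
  intros Hf Hz.
  apply is_derive_ext with (fun y => RInt (fun x => f (upd z 0 x)) 0 y).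
  - intros t. unfold prim. rewrite upd_eq. apply RInt_ext. intros x _. now rewrite upd_upd.
  - apply deriv_val with (f (upd z 0 (z 0%nat))); [| now rewrite upd_same].
    apply (is_derive_RInt (V := R_CompleteNormedModule) (fun x => f (upd z 0 x)) _ 0).
    + apply filter_imp with (2 := locally_abs_ball _ _ (box_le r z 0 Hz)). intros y Hyr.
      apply (RInt_correct (V := R_CompleteNormedModule)).
      assert (H := ex_RInt_upd r N f (upd z 0 y) Hf (box_upd _ _ _ _ Hz Hyr)).
      rewrite upd_eq in H.
      apply (ex_RInt_ext (V := R_CompleteNormedModule)) with (2 := H).
      intros x _. now rewrite upd_upd.
    + apply (continuous_upd r N); auto. now apply box_le.
Qed.

Lemma prim_at_0 f z : prim f (upd z 0 0) = 0.
Proof. unfold prim. rewrite upd_eq. apply (RInt_point (V := R_CompleteNormedModule)). Qed.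

(** * Germs of analytic functions *)

Definition An (f : pt -> R) : Prop := exists r N, AnN r N f.
(** Families bounded in norm on a common polydisc: composition with infinitely many
    functions, and vector fields in infinitely many coordinates, need this uniformity. *)
Definition AnF (v : nat -> pt -> R) : Prop := exists r N, forall i, AnN r N (v i).
Definition near (P : pt -> Prop) : Prop := exists r, 0 < r /\ forall z, box r z -> P z.

Lemma near_and P Q : near P -> near Q -> near (fun z => P z /\ Q z).
Proof.
  intros [r [Hr HP]] [s [Hs HQ]]. exists (Rmin r s). split; [now apply Rmin_pos|].
  intros z Hz. split.
  - apply HP. apply box_mono with (2 := Hz), Rmin_l.
  - apply HQ. apply box_mono with (2 := Hz), Rmin_r.
Qed.

Lemma near_imp (P Q : pt -> Prop) : (forall z, P z -> Q z) -> near P -> near Q.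
Proof. intros H [r [Hr HP]]. exists r. split; auto. Qed.

Lemma near_all (P : pt -> Prop) : (forall z, P z) -> near P.
Proof. intros H. exists 1. split; [lra | auto]. Qed.

Lemma near_pt0 P : near P -> P pt0.
Proof. intros [r [Hr HP]]. apply HP. now apply box_zero. Qed.

Lemma An_ext f g : near (fun z => f z = g z) -> An f -> An g.
Proof.
  intros [s [Hs H]] [r [N Hf]]. exists (Rmin r s), N.
  assert (Hr := AnS_pos _ _ _ _ Hf).
  apply AnS_ext with f.
  - intros z Hz. apply H. apply box_mono with (2 := Hz), Rmin_r.
  - apply (AnN_mono r (Rmin r s) N); [| lra | exact Hf].
    split; [now apply Rmin_pos | apply Rmin_l].
Qed.

Lemma An_exteq f g : (forall z, f z = g z) -> An f -> An g.
Proof. intros H. apply An_ext. now apply near_all. Qed.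

Lemma An_common f g : An f -> An g -> exists r N M, AnN r N f /\ AnN r M g.
Proof.
  intros [r [N Hf]] [s [M Hg]].
  assert (Hr := AnS_pos _ _ _ _ Hf). assert (Hs := AnS_pos _ _ _ _ Hg).
  assert (Hm : 0 < Rmin r s) by now apply Rmin_pos.
  exists (Rmin r s), N, M. split.
  - apply (AnN_mono r (Rmin r s) N); [| lra | exact Hf]. split; [exact Hm | apply Rmin_l].
  - apply (AnN_mono s (Rmin r s) M); [| lra | exact Hg]. split; [exact Hm | apply Rmin_r].
Qed.

Lemma An_plus f g : An f -> An g -> An (fun z => f z + g z).
Proof.
  intros Hf Hg. destruct (An_common f g Hf Hg) as [r [N [M [H1 H2]]]].
  exists r, (N + M). now apply AnS_plus.
Qed.

Lemma An_mult f g : An f -> An g -> An (fun z => f z * g z).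
Proof.
  intros Hf Hg. destruct (An_common f g Hf Hg) as [r [N [M [H1 H2]]]].
  exists r, (N * M). now apply AnN_mult.
Qed.

Lemma An_opp f : An f -> An (fun z => - f z).
Proof. intros [r [N H]]. exists r, N. now apply AnN_opp. Qed.

Lemma An_minus f g : An f -> An g -> An (fun z => f z - g z).
Proof. intros Hf Hg. apply An_plus; [exact Hf | now apply An_opp]. Qed.

Lemma An_const c : An (fun _ => c).
Proof. exists 1, (Rabs c). apply AnN_const. lra. Qed.

Lemma An_var i : An (fun z => z i).
Proof. exists 1, 1. apply AnN_var. lra. Qed.

Lemma An_pow f n : An f -> An (fun z => f z ^ n).
Proof.
  intros H. induction n as [|n IH]; simpl.
  - apply An_const.
  - now apply An_mult.
Qed.

Lemma AnN_small r r' N f : AnN r N f -> f pt0 = 0 -> 0 < r' < r ->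
  AnN r' (N * (r' / (r - r'))) f.
Proof.
  intros Hf H0 Hr'.
  apply AnS_ext with (fun z => f (fun i => z i) - f (fun i => 0)).
  - intros z _. change (f (fun i => 0)) with (f pt0). rewrite H0.
    change (fun i => z i) with z. ring.
  - apply (AnN_lip r' r r' r' N f (fun i z => z i) (fun i _ => 0) Hf).
    + lra.
    + intros i. apply AnN_var. lra.
    + intros i. apply (AnN_mono r' r' (Rabs 0)); [lra | rewrite Rabs_R0; lra |].
      apply AnN_const. lra.
    + intros i. apply AnS_ext with (fun z => z i); [intros; ring|]. apply AnN_var. lra.
Qed.

(** A function that vanishes at the origin has a norm that tends to 0 with the radius
    (Cauchy estimate for the difference with the value at the origin).  This is what
    puts a composition into the domain of the outer function. *)
Lemma AnF_small v : AnF v -> (forall i, v i pt0 = 0) -> forall eps, 0 < eps ->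
  exists r, 0 < r /\ forall r', 0 < r' <= r -> forall i, AnN r' eps (v i).
Proof.
  intros [r [N Hv]] H0 eps He.
  assert (Hr := AnS_pos _ _ _ _ (Hv 0%nat)).
  assert (HN := AnS_N_nonneg _ _ _ _ (Hv 0%nat)).
  assert (Hq : 0 < eps * r / (2 * (N + 1))) by (apply Rdiv_lt_0_compat; nra).
  exists (Rmin (r / 2) (eps * r / (2 * (N + 1)))). split; [apply Rmin_pos; lra|].
  intros r' [H1 H2] i.
  assert (H3 := Rle_trans _ _ _ H2 (Rmin_l _ _)).
  assert (H4 := Rle_trans _ _ _ H2 (Rmin_r _ _)).
  apply (AnN_mono r' r' (N * (r' / (r - r')))); [lra | | apply AnN_small; auto; lra].
  apply Rle_trans with ((N + 1) * (r' / (r / 2))).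
  - apply Rmult_le_compat; try lra.
    + apply Rdiv_le_0_compat; lra.
    + apply Rmult_le_compat_l; [lra|]. apply Rinv_le_contravar; lra.
  - apply Rle_trans with ((N + 1) * (eps * r / (2 * (N + 1)) / (r / 2))).
    + apply Rmult_le_compat_l; [lra|]. apply Rmult_le_compat_r; [|exact H4].
      apply Rlt_le, Rinv_0_lt_compat. lra.
    + right. field. lra.
Qed.

Lemma An_comp f v : An f -> AnF v -> (forall i, v i pt0 = 0) ->
  An (fun z => f (fun i => v i z)).
Proof.
  intros [r [N Hf]] Hv H0. assert (Hr := AnS_pos _ _ _ _ Hf).
  destruct (AnF_small v Hv H0 (r / 2)) as [s [Hs H]]; [lra|].
  exists s, N. apply (AnN_comp s r (r / 2)); [exact Hf | lra |].
  apply H. lra.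
Qed.

Lemma near_comp P v : near P -> AnF v -> (forall i, v i pt0 = 0) -> near (fun z => P (fun i => v i z)).
Proof.
  intros [r [Hr HP]] Hv H0.
  destruct (AnF_small v Hv H0 (r / 2)) as [s [Hs H]]; [lra|].
  exists s. split; [exact Hs|]. intros z Hz. apply HP.
  apply (AnN_box s r (r / 2)); [| lra | exact Hz]. apply H. lra.
Qed.

Definition vec (l : list R) : pt := fun i => nth i l 0.
Definition fam (l : list (pt -> R)) (i : nat) : pt -> R := fun z => vec (map (fun f => f z) l) i.

Lemma AnF_fam l : List.Forall An l -> AnF (fam l).
Proof.
  induction 1 as [|f l [s [M Hf]] _ [r [N Hl]]].
  - exists 1, 0. intros i. apply AnS_ext with (fun _ => 0); [|apply AnS_zero; lra].
    intros z _. destruct i; reflexivity.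
  - assert (Hr := AnS_pos _ _ _ _ (Hl 0%nat)). assert (Hs := AnS_pos _ _ _ _ Hf).
    assert (Hm : 0 < Rmin r s) by now apply Rmin_pos.
    exists (Rmin r s), (Rmax N M). intros [|i].
    + apply (AnN_mono s (Rmin r s) M); [split; [exact Hm | apply Rmin_r] | apply Rmax_r | exact Hf].
    + apply (AnN_mono r (Rmin r s) N); [split; [exact Hm | apply Rmin_l] | apply Rmax_l | apply Hl].
Qed.

Lemma fam_pt0 l : List.Forall (fun f => f pt0 = 0) l -> forall i, fam l i pt0 = 0.
Proof.
  induction 1 as [|f l Hf _ IH]; intros [|i]; try reflexivity; [exact Hf | apply (IH i)].
Qed.

Lemma vec_out l i : (length l <= i)%nat -> vec l i = 0.
Proof. intros H. unfold vec. now apply nth_overflow. Qed.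

Lemma An_of_AnF v i : AnF v -> An (v i).
Proof. intros [r [N H]]. now exists r, N. Qed.

Lemma near_small f eps : An f -> 0 < eps -> near (fun z => Rabs (f z - f pt0) < eps).
Proof.
  intros Hf He.
  assert (Hg : An (fun z => f z - f pt0)) by (apply An_minus; [exact Hf | apply An_const]).
  assert (HF : AnF (fun _ : nat => fun z => f z - f pt0)).
  { destruct Hg as [r [N H]]. now exists r, N. }
  destruct (AnF_small _ HF (fun _ => Rminus_diag _) (eps / 2)) as [s [Hs H]]; [lra|].
  exists s. split; [exact Hs|]. intros z Hz.
  apply Rle_lt_trans with (eps / 2); [|lra].
  apply (AnS_bound _ _ _ _ _ (H s ltac:(lra) 0%nat) Hz).
Qed.

Lemma near_neq0 f : An f -> f pt0 <> 0 -> near (fun z => f z <> 0).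
Proof.
  intros Hf H0. apply near_imp with (2 := near_small f (Rabs (f pt0)) Hf (Rabs_pos_lt _ H0)).
  intros z Hz E. rewrite E, Rminus_0_l, Rabs_Ropp in Hz. lra.
Qed.

Lemma AnN_pow r N f n : AnN r N f -> AnN r (N ^ n) (fun z => f z ^ n).
Proof.
  intros H. assert (Hr := AnS_pos _ _ _ _ H). induction n as [|n IH]; simpl.
  - rewrite <- Rabs_R1 at 1. now apply AnN_const.
  - now apply AnN_mult.
Qed.

(** The geometric series. *)
Lemma An_geom c : c <> 0 -> An (fun z => / (c + z 0%nat)).
Proof.
  intros Hc. assert (Hc' := Rabs_pos_lt c Hc).
  set (r := Rabs c / 2).
  assert (Hr : 0 < r) by (unfold r; lra).
  assert (Hq : Rabs (- / c) * r = / 2).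
  { rewrite Rabs_Ropp, Rabs_inv. unfold r. field. lra. }
  exists r, (Series (fun n => Rabs (/ c) * (/ 2) ^ n)).
  apply (AnS_series _ r _ (fun n z => / c * (- / c * z 0%nat) ^ n)).
  - exact Hr.
  - intros n. apply AnN_scal. apply AnN_pow.
    rewrite <- Hq. apply AnN_scal. now apply AnN_var.
  - apply (ex_series_mult_l (Rabs (/ c))).
    apply ex_series_geom. rewrite Rabs_pos_eq; lra.
  - intros z Hz. assert (H0 := box_weak r z 0 Hz).
    assert (Hz1 : Rabs (- / c * z 0%nat) < 1).
    { rewrite Rabs_mult. apply Rle_lt_trans with (Rabs (- / c) * r).
      - apply Rmult_le_compat_l; [apply Rabs_pos | exact H0].
      - rewrite Hq. lra. }
    assert (Hne : c + z 0%nat <> 0).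
    { intros E. replace (z 0%nat) with (- c) in H0 by lra. rewrite Rabs_Ropp in H0.
      unfold r in H0. lra. }
    replace (/ (c + z 0%nat)) with (scal (/ c) (/ (1 - (- / c * z 0%nat)))).
    + apply (is_series_scal (K := R_AbsRing) (V := R_NormedModule)).
      now apply is_series_geom.
    + unfold scal; simpl. unfold mult; simpl. field. split; [lra|].
      intros E. apply Hne. lra.
Qed.

Lemma An_inv f : An f -> f pt0 <> 0 -> An (fun z => / f z).
Proof.
  intros Hf H0.
  assert (H : An (fun z => / (f pt0 + fam ((fun z => f z - f pt0) :: nil) 0 z))).
  { apply (An_comp _ (fam ((fun z => f z - f pt0) :: nil)) (An_geom (f pt0) H0)).
    - apply AnF_fam. repeat constructor. apply An_minus; [exact Hf | apply An_const].
    - apply fam_pt0. repeat constructor. ring. }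
  apply An_exteq with (2 := H).
  intros z. unfold fam, vec; simpl. f_equal. ring.
Qed.

Lemma An_div f g : An f -> An g -> g pt0 <> 0 -> An (fun z => f z / g z).
Proof. intros Hf Hg H0. apply An_mult; [exact Hf | now apply An_inv]. Qed.

Lemma An_pd i f : An f -> An (pd i f).
Proof.
  intros [r [N Hf]]. assert (Hr := AnS_pos _ _ _ _ Hf).
  exists (r / 2), (N / (r - r / 2)). apply AnN_pd_An; [exact Hf | lra].
Qed.

Lemma near_pd i f : An f -> near (fun z => is_derive (fun x => f (upd z i x)) (z i) (pd i f z)).
Proof.
  intros [r [N Hf]]. exists r. split; [now apply AnS_pos in Hf|].
  intros z Hz. now apply (AnN_pd r N).
Qed.

Lemma box_locally r z i : box r z -> locally (z i) (fun x => box r (upd z i x)).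
Proof.
  intros Hz. apply filter_imp with (2 := locally_abs_ball _ _ (box_le r z i Hz)).
  intros y Hy. now apply box_upd.
Qed.

Lemma near_pd_ext i f g : near (fun z => f z = g z) -> near (fun z => pd i f z = pd i g z).
Proof.
  intros [r [Hr H]]. exists r. split; [exact Hr|]. intros z Hz.
  apply Derive_ext_loc. apply filter_imp with (2 := box_locally r z i Hz).
  intros x Hx. now apply H.
Qed.

(** * Flows of analytic vector fields *)

Fixpoint picard (P phi : nat -> pt -> R) (n : nat) : nat -> pt -> R :=
  match n with
  | O => phi
  | S n => fun i z => phi i z + prim (fun z => P i (fun j => picard P phi n j z)) z
  end.

Lemma is_series_telescope (y : nat -> R) (l : R) n :
  is_lim_seq y l -> is_series (fun k => y (S (n + k)) - y (n + k)%nat) (l - y n).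
Proof.
  intros H.
  assert (G : is_lim_seq (sum_n (fun k => y (S (n + k)) - y (n + k)%nat)) (l - y n)).
  { apply is_lim_seq_ext with (fun k => y (k + S n)%nat - y n).
    - intros k. induction k as [|k IH].
      + rewrite sum_O. now replace (n + 0)%nat with n by lia.
      + rewrite sum_Sn, <- IH. unfold plus; simpl.
        replace (S (k + S n)) with (S (n + S k)) by lia.
        replace (k + S n)%nat with (n + S k)%nat by lia. ring.
    - apply is_lim_seq_minus'.
      + now apply is_lim_seq_incr_n.
      + apply is_lim_seq_const. }
  exact G.
Qed.

(** Picard iteration in the Banach algebra.  Integration over a polydisc of radius [rho]
    has norm at most [rho], so for small [rho] the iterates stay in a ball and their
    differences decrease geometrically; the limit is again a power series. *)
Lemma picard_limit R N rho (P phi : nat -> pt -> Rdefinitions.R) :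
  0 < R -> 0 < rho -> (forall i, AnN R N (P i)) -> rho * N <= R / 8 ->
  (forall i, AnN rho (R / 8) (phi i)) ->
  exists u, (forall i, AnN rho (R / 2) (u i)) /\
    forall z, box rho z -> forall i, u i z = phi i z + prim (fun z => P i (fun j => u j z)) z.
Proof.
  intros HR Hrho HP HN Hphi.
  assert (HN0 := AnS_N_nonneg _ _ _ _ (HP 0%nat)).
  set (y := picard P phi).
  assert (HA : forall n i, AnN rho (R / 4) (y n i)).
  { induction n as [|n IH]; intros i; simpl.
    - apply (AnN_mono rho rho (R / 8)); [lra | lra | apply Hphi].
    - apply (AnN_mono rho rho (R / 8 + rho * N)); [lra | lra |].
      apply AnS_plus; [apply Hphi|]. apply AnN_prim.
      apply (AnN_comp rho R (R / 4)); [apply HP | lra | exact IH]. }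
  assert (HC : forall n i, AnN rho N (fun z => P i (fun j => y n j z))).
  { intros n i. apply (AnN_comp rho R (R / 4)); [apply HP | lra | apply HA]. }
  assert (HB : forall n i, AnN rho (R / 8 * (/ 2) ^ n) (fun z => y (S n) i z - y n i z)).
  { induction n as [|n IH]; intros i.
    - apply AnS_ext with (prim (fun z => P i (fun j => y 0%nat j z))).
      + intros z Hz.
        change (y 1%nat i z) with (phi i z + prim (fun z => P i (fun j => y 0%nat j z)) z).
        change (y 0%nat i z) with (phi i z). ring.
      + apply (AnN_mono rho rho (rho * N)); [lra | simpl; lra | apply AnN_prim, HC].
    - apply AnS_ext with (prim (fun z => P i (fun j => y (S n) j z) - P i (fun j => y n j z))).
      + intros z Hz.
        rewrite <- (prim_minus rho N N (fun z => P i (fun j => y (S n) j z))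
           (fun z => P i (fun j => y n j z))); auto.
        change (y (S (S n)) i z) with (phi i z + prim (fun z => P i (fun j => y (S n) j z)) z).
        change (y (S n) i z) with (phi i z + prim (fun z => P i (fun j => y n j z)) z).
        ring.
      + apply (AnN_mono rho rho (rho * (N * (R / 8 * (/ 2) ^ n / (R - R / 4))))); [lra | |].
        * replace (rho * (N * (R / 8 * (/ 2) ^ n / (R - R / 4)))) with
            ((rho * N) * ((/ 2) ^ n / 6)) by (field; lra).
          assert (Hp : 0 < (/ 2) ^ n) by (apply pow_lt; lra).
          simpl. apply Rle_trans with (R / 8 * ((/ 2) ^ n / 6)); [apply Rmult_le_compat_r; lra|].
          apply Rmult_le_compat_l; lra.
        * apply AnN_prim. apply (AnN_lip rho R (R / 4)); auto; lra. }
  assert (Hgeo : forall n, is_series (fun k => R / 8 * (/ 2) ^ (n + k)) (R / 4 * (/ 2) ^ n)).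
  { intros n. replace (R / 4 * (/ 2) ^ n) with (scal (R / 8 * (/ 2) ^ n) (/ (1 - / 2))).
    - apply is_series_ext with (fun k => scal (R / 8 * (/ 2) ^ n) ((/ 2) ^ k)).
      + intros k. unfold scal; simpl. unfold mult; simpl. rewrite pow_add. ring.
      + apply (is_series_scal (K := R_AbsRing) (V := R_NormedModule)).
        apply is_series_geom. rewrite Rabs_pos_eq; lra.
    - unfold scal; simpl. unfold mult; simpl. field. }
  set (u := fun i z => phi i z + Series (fun n => y (S n) i z - y n i z)).
  assert (Hlim : forall z, box rho z -> forall i, is_lim_seq (fun n => y n i z) (u i z)).
  { intros z Hz i.
    assert (Hex : ex_series (fun n => y (S n) i z - y n i z)).
    { apply ex_series_Rabs. apply ex_series_dom with (fun k => R / 8 * (/ 2) ^ (0 + k)).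
      - intros k. apply (AnS_bound _ _ _ _ _ (HB k i) Hz).
      - eexists. apply Hgeo. }
    apply Series_correct in Hex.
    assert (Hp : is_lim_seq (fun n => phi i z + sum_n (fun n => y (S n) i z - y n i z) n) (u i z)).
    { apply is_lim_seq_plus'; [apply is_lim_seq_const | exact Hex]. }
    apply is_lim_seq_incr_1. apply is_lim_seq_ext with (2 := Hp).
    intros n. induction n as [|n IH].
    - rewrite sum_O. change (phi i z) with (y 0%nat i z). ring.
    - rewrite sum_Sn.
      change (phi i z + (sum_n (fun n => y (S n) i z - y n i z) n +
        (y (S (S n)) i z - y (S n) i z)) = y (S (S n)) i z).
      rewrite <- Rplus_assoc, IH. ring. }
  assert (Hun : forall n i, AnN rho (R / 4 * (/ 2) ^ n) (fun z => u i z - y n i z)).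
  { intros n i. rewrite <- (is_series_unique _ _ (Hgeo n)).
    apply (AnS_series _ rho _ (fun k z => y (S (n + k)) i z - y (n + k)%nat i z)).
    - exact Hrho.
    - intros k. apply HB.
    - eexists. apply Hgeo.
    - intros z Hz. apply (is_series_telescope (fun n => y n i z)). now apply Hlim. }
  assert (HAu : forall i, AnN rho (R / 2) (u i)).
  { intros i. apply AnS_ext with (fun z => (u i z - y 0%nat i z) + y 0%nat i z); [intros; ring|].
    apply (AnN_mono rho rho (R / 4 * (/ 2) ^ 0 + R / 4)); [lra | simpl; lra |].
    apply AnS_plus; [apply Hun | apply HA]. }
  exists u. split; [exact HAu|].
  intros z Hz i.
  assert (HPu : AnN rho N (fun z => P i (fun j => u j z))).
  { apply (AnN_comp rho R (R / 2)); [apply HP | lra | exact HAu]. }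
  (* both sides are limits of the iterates *)
  assert (L1 := Hlim z Hz i). apply is_lim_seq_incr_1 in L1.
  assert (L2 : is_lim_seq (fun n => y (S n) i z)
      (phi i z + prim (fun z => P i (fun j => u j z)) z)).
  { apply (is_lim_seq_ext (fun n => phi i z + (prim (fun z => P i (fun j => u j z)) z -
       prim (fun z => P i (fun j => u j z) - P i (fun j => y n j z)) z))).
    { intros n. rewrite <- (prim_minus rho N N (fun z => P i (fun j => u j z))
           (fun z => P i (fun j => y n j z))); auto.
      change (y (S n) i z) with (phi i z + prim (fun z => P i (fun j => y n j z)) z). ring. }
    apply is_lim_seq_plus'; [apply is_lim_seq_const|].
    apply (is_lim_seq_val _ (prim (fun z => P i (fun j => u j z)) z - 0)); [ring|].
    apply is_lim_seq_minus'; [apply is_lim_seq_const|].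
    apply is_lim_seq_abs_0.
    apply (is_lim_seq_le_le (fun _ => 0) _ (fun n => rho * N / 2 * (/ 2) ^ n)).
    - intros n. split; [apply Rabs_pos|].
      apply (AnS_bound (fun _ => True) rho); [| exact Hz].
      apply (AnN_mono rho rho (rho * (N * (R / 4 * (/ 2) ^ n / (R - R / 2))))); [lra | |].
      + right. field. lra.
      + apply AnN_prim. apply (AnN_lip rho R (R / 2)); auto; [lra|].
        intros j. apply (AnN_mono rho rho (R / 4)); auto; lra.
    - apply is_lim_seq_const.
    - replace 0 with (rho * N / 2 * 0) by ring.
      apply (is_lim_seq_scal_l _ (rho * N / 2) 0).
      apply is_lim_seq_geom. rewrite Rabs_pos_eq; lra. }
  assert (E1 := is_lim_seq_unique _ _ L1). assert (E2 := is_lim_seq_unique _ _ L2).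
  rewrite E1 in E2. now injection E2.
Qed.

(** The initial data [phi] may depend on all coordinates except time.  So the flow is
    analytic in time, parameters and initial values together. *)
Theorem analytic_flow (P phi : nat -> pt -> R) :
  AnF P -> AnF phi -> (forall i, phi i pt0 = 0) ->
  (forall i z x, phi i (upd z 0 x) = phi i z) ->
  exists u, AnF u /\ (forall i, u i pt0 = 0) /\
    near (fun z => forall i, u i (upd z 0 0) = phi i z) /\
    near (fun z => forall i, is_derive (fun x => u i (upd z 0 x)) (z 0%nat)
                               (P i (fun j => u j z))).
Proof.
  intros [R [N HP]] Hphi H0 Hind.
  assert (HR := AnS_pos _ _ _ _ (HP 0%nat)).
  assert (HN := AnS_N_nonneg _ _ _ _ (HP 0%nat)).
  destruct (AnF_small phi Hphi H0 (R / 8)) as [s [Hs Hphis]]; [lra|].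
  set (rho := Rmin s (R / (8 * (N + 1)))).
  assert (Hq : 0 < R / (8 * (N + 1))) by (apply Rdiv_lt_0_compat; lra).
  assert (Hrho : 0 < rho) by (apply Rmin_pos; lra).
  assert (HrN : rho * N <= R / 8).
  { apply Rle_trans with (R / (8 * (N + 1)) * (N + 1)).
    - apply Rmult_le_compat; try lra. apply Rmin_r.
    - right. field. lra. }
  destruct (picard_limit R N rho P phi) as [u [Hu1 Hu2]]; auto.
  { apply Hphis. split; [exact Hrho | apply Rmin_l]. }
  assert (HPu : forall i, AnN rho N (fun z => P i (fun j => u j z))).
  { intros i. apply (AnN_comp rho R (R / 2)); [apply HP | lra | exact Hu1]. }
  assert (Hinit : forall z, box rho z -> forall i, u i (upd z 0 0) = phi i z).
  { intros z Hz i. rewrite Hu2.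
    - rewrite prim_at_0, Hind. ring.
    - apply box_upd; [exact Hz | rewrite Rabs_R0; exact Hrho]. }
  exists u. split; [|split; [|split]].
  - now exists rho, (R / 2).
  - intros i. assert (E := Hinit pt0 (box_zero rho Hrho) i). rewrite H0 in E.
    assert (Ho : upd pt0 0 0 = pt0) by apply (upd_same pt0 0). now rewrite Ho in E.
  - now exists rho.
  - exists rho. split; [exact Hrho|]. intros z Hz i.
    apply (D_ext_loc
      (fun x => phi i z + prim (fun z => P i (fun j => u j z)) (upd z 0 x))).
    + apply filter_imp with (2 := box_locally rho z 0 Hz). intros x Hx.
      rewrite (Hu2 _ Hx), Hind. reflexivity.
    + apply (deriv_val _ _ _ _ (D_plus _ _ _ _ _ (D_const _ _) (is_derive_prim rho N _ _ (HPu i) Hz))).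
      ring.
Qed.

(** * Functions of finitely many variables *)

Lemma An_comp_vec F l : An F -> List.Forall An l -> List.Forall (fun f => f pt0 = 0) l ->
  An (fun z => F (vec (map (fun f => f z) l))).
Proof. intros HF H1 H2. apply (An_comp F (fam l) HF); [now apply AnF_fam | now apply fam_pt0]. Qed.

Lemma near_comp_vec P l : near P -> List.Forall An l -> List.Forall (fun f => f pt0 = 0) l ->
  near (fun z => P (vec (map (fun f => f z) l))).
Proof. intros HF H1 H2. apply (near_comp P (fam l) HF); [now apply AnF_fam | now apply fam_pt0]. Qed.

Lemma box_vec r l : 0 < r -> List.Forall (fun x => Rabs x < r) l -> box r (vec l).
Proof.
  intros Hr. induction 1 as [|x l Hx _ [s [H1 H2]]].
  - exists 0. split; [exact Hr|]. intros [|i]; unfold vec; simpl; rewrite Rabs_R0; lra.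
  - exists (Rmax s (Rabs x)). split; [now apply Rmax_lub_lt|]. intros [|i].
    + apply Rmax_r.
    + apply Rle_trans with (2 := Rmax_l _ _). apply (H2 i).
Qed.

Lemma near_vec Q : near Q ->
  exists r, 0 < r /\ forall l, List.Forall (fun x => Rabs x < r) l -> Q (vec l).
Proof.
  intros [r [Hr H]]. exists r. split; [exact Hr|]. intros l Hl. apply H. now apply box_vec.
Qed.

Definition An1 (F : R -> R) := An (fun z => F (z 0%nat)).
Definition An2 (F : R -> R -> R) := An (fun z => F (z 0%nat) (z 1%nat)).
Definition An3 (F : R -> R -> R -> R) := An (fun z => F (z 0%nat) (z 1%nat) (z 2%nat)).
Definition An4 (F : R -> R -> R -> R -> R) :=
  An (fun z => F (z 0%nat) (z 1%nat) (z 2%nat) (z 3%nat)).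

Definition d1 (F : R -> R -> R) x y := Derive (fun t => F t y) x.
Definition d2 (F : R -> R -> R) x y := Derive (fun t => F x t) y.
Definition e1 (F : R -> R -> R -> R) x y p := Derive (fun t => F t y p) x.
Definition e2 (F : R -> R -> R -> R) x y p := Derive (fun t => F x t p) y.
Definition e3 (F : R -> R -> R -> R) x y p := Derive (fun t => F x y t) p.

Lemma An_comp1 F f : An1 F -> An f -> f pt0 = 0 -> An (fun z => F (f z)).
Proof. intros HF Hf H0. apply (An_comp_vec _ [f] HF); repeat constructor; auto. Qed.

Lemma An_comp2 F f g : An2 F -> An f -> An g -> f pt0 = 0 -> g pt0 = 0 ->
  An (fun z => F (f z) (g z)).
Proof. intros HF Hf Hg H0 H1. apply (An_comp_vec _ [f; g] HF); repeat constructor; auto. Qed.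

Lemma An_comp3 F f g h : An3 F -> An f -> An g -> An h -> f pt0 = 0 -> g pt0 = 0 -> h pt0 = 0 ->
  An (fun z => F (f z) (g z) (h z)).
Proof. intros. apply (An_comp_vec _ [f; g; h] H); repeat constructor; auto. Qed.

Lemma An_comp4 F f g h k : An4 F -> An f -> An g -> An h -> An k ->
  f pt0 = 0 -> g pt0 = 0 -> h pt0 = 0 -> k pt0 = 0 -> An (fun z => F (f z) (g z) (h z) (k z)).
Proof. intros. apply (An_comp_vec _ [f; g; h; k] H); repeat constructor; auto. Qed.

Lemma An2_d1 F : An2 F -> An2 (d1 F).
Proof. exact (An_pd 0 _). Qed.
Lemma An2_d2 F : An2 F -> An2 (d2 F).
Proof. exact (An_pd 1 _). Qed.
Lemma An3_e1 F : An3 F -> An3 (e1 F).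
Proof. exact (An_pd 0 _). Qed.
Lemma An3_e2 F : An3 F -> An3 (e2 F).
Proof. exact (An_pd 1 _). Qed.
Lemma An3_e3 F : An3 F -> An3 (e3 F).
Proof. exact (An_pd 2 _). Qed.

Lemma chain2 F : An2 F -> exists r, 0 < r /\ forall (u v : R -> R) x u' v',
  Rabs (u x) < r -> Rabs (v x) < r -> is_derive u x u' -> is_derive v x v' ->
  is_derive (fun x => F (u x) (v x)) x (u' * d1 F (u x) (v x) + v' * d2 F (u x) (v x)).
Proof.
  intros [r [N HF]]. assert (Hr := AnS_pos _ _ _ _ HF). exists r. split; [exact Hr|].
  intros u v x u' v' Hu Hv Du Dv.
  assert (H := AnN_chain r N _ 2 (fun i x => vec [u x; v x] i) (vec [u'; v']) x HF).
  eapply deriv_val.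
  - apply H.
    + apply box_vec; [exact Hr | repeat constructor; assumption].
    + intros [|[|i]] Hi; [exact Du | exact Dv | lia].
    + intros i Hi y. now rewrite !vec_out.
  - change (0 + u' * d1 F (u x) (v x) + v' * d2 F (u x) (v x) =
      u' * d1 F (u x) (v x) + v' * d2 F (u x) (v x)). ring.
Qed.

Lemma chain3 F : An3 F -> exists r, 0 < r /\ forall (u v w : R -> R) x u' v' w',
  Rabs (u x) < r -> Rabs (v x) < r -> Rabs (w x) < r ->
  is_derive u x u' -> is_derive v x v' -> is_derive w x w' ->
  is_derive (fun x => F (u x) (v x) (w x)) x
    (u' * e1 F (u x) (v x) (w x) + v' * e2 F (u x) (v x) (w x) + w' * e3 F (u x) (v x) (w x)).
Proof.
  intros [r [N HF]]. assert (Hr := AnS_pos _ _ _ _ HF). exists r. split; [exact Hr|].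
  intros u v w x u' v' w' Hu Hv Hw Du Dv Dw.
  assert (H := AnN_chain r N _ 3 (fun i x => vec [u x; v x; w x] i) (vec [u'; v'; w']) x HF).
  eapply deriv_val.
  - apply H.
    + apply box_vec; [exact Hr | repeat constructor; assumption].
    + intros [|[|[|i]]] Hi; [exact Du | exact Dv | exact Dw | lia].
    + intros i Hi y. now rewrite !vec_out.
  - change (0 + u' * e1 F (u x) (v x) (w x) + v' * e2 F (u x) (v x) (w x) + w' * e3 F (u x) (v x) (w x)
     = u' * e1 F (u x) (v x) (w x) + v' * e2 F (u x) (v x) (w x) + w' * e3 F (u x) (v x) (w x)). ring.
Qed.

Lemma chain4 F : An4 F -> exists r, 0 < r /\ forall (u v w k : R -> R) x u' v' w' k',
  Rabs (u x) < r -> Rabs (v x) < r -> Rabs (w x) < r -> Rabs (k x) < r ->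
  is_derive u x u' -> is_derive v x v' -> is_derive w x w' -> is_derive k x k' ->
  is_derive (fun x => F (u x) (v x) (w x) (k x)) x
    (u' * Derive (fun t => F t (v x) (w x) (k x)) (u x) + v' * Derive (fun t => F (u x) t (w x) (k x)) (v x)
     + w' * Derive (fun t => F (u x) (v x) t (k x)) (w x) + k' * Derive (fun t => F (u x) (v x) (w x) t) (k x)).
Proof.
  intros [r [N HF]]. assert (Hr := AnS_pos _ _ _ _ HF). exists r. split; [exact Hr|].
  intros u v w k x u' v' w' k' Hu Hv Hw Hk Du Dv Dw Dk.
  assert (H := AnN_chain r N _ 4 (fun i x => vec [u x; v x; w x; k x] i) (vec [u'; v'; w'; k']) x HF).
  eapply deriv_val.
  - apply H.
    + apply box_vec; [exact Hr | repeat constructor; assumption].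
    + intros [|[|[|[|i]]]] Hi; [exact Du | exact Dv | exact Dw | exact Dk | lia].
    + intros i Hi y. now rewrite !vec_out.
  - match goal with |- _ = ?rhs => change (0 + u' * Derive (fun t => F t (v x) (w x) (k x)) (u x)
      + v' * Derive (fun t => F (u x) t (w x) (k x)) (v x)
      + w' * Derive (fun t => F (u x) (v x) t (k x)) (w x) + k' * Derive (fun t => F (u x) (v x) (w x) t) (k x) = rhs) end.
    ring.
Qed.

Lemma hadamard2 F : An2 F ->
  exists G, An2 G /\ near (fun z => F (z 0%nat) (z 1%nat) = F 0 (z 1%nat) + z 0%nat * G (z 0%nat) (z 1%nat)).
Proof.
  intros [r [N HF]]. destruct (AnN_hadamard r N _ 0 HF) as [g [Hg E]].
  exists (fun s t => g (vec [s; t])). split.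
  - apply (An_comp_vec g [fun z => z 0%nat; fun z => z 1%nat]).
    + now exists r, (N / r).
    + repeat constructor; apply An_var.
    + repeat constructor.
  - exists r. assert (Hr := AnS_pos _ _ _ _ HF). split; [exact Hr|]. intros z Hz.
    apply (E (vec [z 0%nat; z 1%nat])). apply box_vec; [exact Hr|].
    repeat constructor; now apply box_le.
Qed.

Lemma hadamard4 F : An4 F ->
  exists G, An4 G /\ near (fun z => F (z 0%nat) (z 1%nat) (z 2%nat) (z 3%nat) =
     F (z 0%nat) (z 1%nat) (z 2%nat) 0 + z 3%nat * G (z 0%nat) (z 1%nat) (z 2%nat) (z 3%nat)).
Proof.
  intros [r [N HF]]. destruct (AnN_hadamard r N _ 3 HF) as [g [Hg E]].
  exists (fun x y p s => g (vec [x; y; p; s])). split.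
  - apply (An_comp_vec g [fun z => z 0%nat; fun z => z 1%nat; fun z => z 2%nat; fun z => z 3%nat]).
    + now exists r, (N / r).
    + repeat constructor; apply An_var.
    + repeat constructor.
  - exists r. assert (Hr := AnS_pos _ _ _ _ HF). split; [exact Hr|]. intros z Hz.
    apply (E (vec [z 0%nat; z 1%nat; z 2%nat; z 3%nat])). apply box_vec; [exact Hr|].
    repeat constructor; now apply box_le.
Qed.

(** * Smoothness *)

(** Analyticity on all smaller polydiscs.  Unlike a bound on a fixed polydisc this is
    inherited by derivatives, so derivatives of all orders exist on one common domain. *)
Definition An_within (r : R) (F : R -> R -> R) : Prop :=
  forall r', 0 < r' < r -> exists N, AnN r' N (fun z => F (z 0%nat) (z 1%nat)).

Lemma An_within_d r F : An_within r F -> An_within r (d1 F) /\ An_within r (d2 F).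
Proof.
  intros H. split; intros r' Hr'.
  - destruct (H ((r' + r) / 2)) as [N HN]; [lra|].
    eexists. apply (AnN_pd_An _ _ _ _ 0 HN). lra.
  - destruct (H ((r' + r) / 2)) as [N HN]; [lra|].
    eexists. apply (AnN_pd_An _ _ _ _ 1 HN). lra.
Qed.

Lemma An_within_point r F x y : An_within r F -> Rabs x < r -> Rabs y < r ->
  exists s N, Rabs x < s /\ Rabs y < s /\ 0 < s < r /\ AnN s N (fun z => F (z 0%nat) (z 1%nat)).
Proof.
  intros H Hx Hy. assert (Hm : Rmax (Rabs x) (Rabs y) < r) by now apply Rmax_lub_lt.
  assert (H1 := Rmax_l (Rabs x) (Rabs y)). assert (H2 := Rmax_r (Rabs x) (Rabs y)).
  assert (H3 := Rabs_pos x).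
  destruct (H ((Rmax (Rabs x) (Rabs y) + r) / 2)) as [N HN]; [lra|].
  exists ((Rmax (Rabs x) (Rabs y) + r) / 2), N.
  split; [lra|]. split; [lra|]. split; [lra|]. exact HN.
Qed.

Lemma An_within_derive r F x y : An_within r F -> Rabs x < r -> Rabs y < r ->
  is_derive (fun t => F t y) x (d1 F x y) /\ is_derive (fun t => F x t) y (d2 F x y).
Proof.
  intros H Hx Hy. destruct (An_within_point r F x y H Hx Hy) as [s [N [Hxs [Hys [Hs HN]]]]].
  assert (Hb : box s (vec [x; y])) by (apply box_vec; [lra | repeat constructor; assumption]).
  split.
  - exact (AnN_pd s N _ 0 _ HN Hb).
  - exact (AnN_pd s N _ 1 _ HN Hb).
Qed.

Lemma An_within_continuous r F x y : An_within r F -> Rabs x < r -> Rabs y < r -> continuity_2d_pt F x y.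
Proof.
  intros H Hx Hy. destruct (An_within_point r F x y H Hx Hy) as [s [N [Hxs [Hys [Hs HN]]]]].
  intros [eps He]. simpl.
  assert (HN0 := AnS_N_nonneg _ _ _ _ HN).
  set (m := Rmax (Rabs x) (Rabs y)).
  assert (Hm : m < s) by now apply Rmax_lub_lt.
  assert (Hmx : Rabs x <= m) by apply Rmax_l. assert (Hmy : Rabs y <= m) by apply Rmax_r.
  assert (Hm0 : 0 <= m) by (apply Rle_trans with (2 := Hmx), Rabs_pos).
  set (t := (m + s) / 2).
  assert (Ht : m < t < s) by (unfold t; lra).
  set (del := Rmin (t - m) (eps * (s - t) / (2 * (N + 1)))).
  assert (Hdel : 0 < del).
  { apply Rmin_pos; [lra|]. apply Rdiv_lt_0_compat; nra. }
  exists (mkposreal _ Hdel). simpl. intros u v Hu Hv.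
  assert (Hd1 : del <= t - m) by apply Rmin_l.
  assert (Hd2 : del <= eps * (s - t) / (2 * (N + 1))) by apply Rmin_r.
  assert (L := AnN_lip_pt s t del N _ (vec [u; v]) (vec [x; y]) HN ltac:(lra)).
  cbn in L. apply Rle_lt_trans with (N * (del / (s - t))).
  - apply L.
    + intros [|[|i]]; unfold vec; simpl.
      * replace u with (x + (u - x)) by ring. apply Rle_trans with (1 := Rabs_triang _ _). lra.
      * replace v with (y + (v - y)) by ring. apply Rle_trans with (1 := Rabs_triang _ _). lra.
      * destruct i; rewrite Rabs_R0; lra.
    + intros [|[|i]]; unfold vec; simpl; try lra. destruct i; rewrite Rabs_R0; lra.
    + intros [|[|i]]; unfold vec; simpl; try lra.
      destruct i; rewrite Rminus_diag, Rabs_R0; lra.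
  - apply Rle_lt_trans with ((N + 1) * (eps * (s - t) / (2 * (N + 1)) / (s - t))).
    + apply Rmult_le_compat; try lra.
      * apply Rdiv_le_0_compat; lra.
      * apply Rmult_le_compat_r; [|exact Hd2]. apply Rlt_le, Rinv_0_lt_compat; lra.
    + replace ((N + 1) * (eps * (s - t) / (2 * (N + 1)) / (s - t))) with (eps / 2) by (field; lra).
      lra.
Qed.

Lemma An_within_ex_diff_n n : forall r F x y, An_within r F -> Rabs x < r -> Rabs y < r -> ex_diff_n F n x y.
Proof.
  induction n as [|n IH]; intros r F x y H Hx Hy; simpl; split; auto.
  - now apply (An_within_continuous r).
  - now apply (An_within_continuous r).
  - destruct (An_within_derive r F x y H Hx Hy) as [D1 D2]. destruct (An_within_d r F H) as [O1 O2].
    split; [eexists; exact D1|]. split; [eexists; exact D2|].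
    split; [exact (IH r (d1 F) x y O1 Hx Hy) | exact (IH r (d2 F) x y O2 Hx Hy)].
Qed.

Lemma An2_within F : An2 F -> exists r, 0 < r /\ An_within r F.
Proof.
  intros [r [N HF]]. assert (Hr := AnS_pos _ _ _ _ HF). exists r. split; [exact Hr|].
  intros r' Hr'. exists N. apply (AnN_mono r r' N N); auto; lra.
Qed.

Lemma An2_smooth F : An2 F -> smooth_near_0 F.
Proof.
  intros HF. destruct (An2_within F HF) as [r [Hr HO]].
  exists (mkposreal r Hr). simpl. intros x y Hx Hy n. rewrite Rminus_0_r in Hx, Hy.
  now apply (An_within_ex_diff_n n r).
Qed.

Lemma near_box2 r (P : R -> R -> Prop) : 0 < r ->
  (forall s t, Rabs s < r -> Rabs t < r -> P s t) -> near (fun z => P (z 0%nat) (z 1%nat)).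
Proof. intros Hr H. exists r. split; [exact Hr|]. intros z Hz. apply H; now apply box_le. Qed.

Lemma near_d F : An2 F -> near (fun z =>
  is_derive (fun s => F s (z 1%nat)) (z 0%nat) (d1 F (z 0%nat) (z 1%nat)) /\
  is_derive (fun t => F (z 0%nat) t) (z 1%nat) (d2 F (z 0%nat) (z 1%nat))).
Proof.
  intros HF. destruct (An2_within F HF) as [r [Hr HO]].
  exists r. split; [exact Hr|]. intros z Hz.
  apply (An_within_derive r F); [exact HO | | ]; now apply box_le.
Qed.

(** Schwarz's theorem. *)
Lemma near_mixed F : An2 F -> near (fun z => d1 (d2 F) (z 0%nat) (z 1%nat) = d2 (d1 F) (z 0%nat) (z 1%nat)).
Proof.
  intros HF. destruct (An2_within F HF) as [r [Hr HO]].
  destruct (An_within_d r F HO) as [O1 O2]. destruct (An_within_d r _ O1) as [O11 O12].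
  destruct (An_within_d r _ O2) as [O21 O22].
  apply (near_box2 r (fun s t => d1 (d2 F) s t = d2 (d1 F) s t)); [exact Hr|]. intros s t Hs Ht.
  apply Schwarz.
  - assert (Hm : Rmax (Rabs s) (Rabs t) < r) by now apply Rmax_lub_lt.
    assert (Hd : 0 < r - Rmax (Rabs s) (Rabs t)) by lra.
    assert (H1 := Rmax_l (Rabs s) (Rabs t)). assert (H2 := Rmax_r (Rabs s) (Rabs t)).
    exists (mkposreal _ Hd). simpl. intros u v Hu Hv.
    assert (Hur : Rabs u < r).
    { replace u with (s + (u - s)) by ring. apply Rle_lt_trans with (1 := Rabs_triang _ _). lra. }
    assert (Hvr : Rabs v < r).
    { replace v with (t + (v - t)) by ring. apply Rle_lt_trans with (1 := Rabs_triang _ _). lra. }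
    destruct (An_within_derive r F u v HO Hur Hvr) as [D1 D2].
    destruct (An_within_derive r _ u v O1 Hur Hvr) as [D3 D4].
    destruct (An_within_derive r _ u v O2 Hur Hvr) as [D5 D6].
    split; [eexists; exact D1|]. split; [eexists; exact D2|].
    split; [eexists; exact D5 | eexists; exact D4].
  - exact (An_within_continuous r (d1 (d2 F)) s t O21 Hs Ht).
  - exact (An_within_continuous r (d2 (d1 F)) s t O12 Hs Ht).
Qed.

(** * Differential inequalities *)

(** The function [(e^2 + f^2) exp (- 4 C x)] does not increase. *)
Lemma gronwall_pos (e f : R -> R) d C :
  e 0 = 0 -> f 0 = 0 ->
  (forall x, 0 <= x < d -> exists e' f', is_derive e x e' /\ is_derive f x f' /\
     Rabs e' <= C * (Rabs (e x) + Rabs (f x)) /\ Rabs f' <= C * (Rabs (e x) + Rabs (f x))) ->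
  forall x, 0 <= x < d -> e x = 0 /\ f x = 0.
Proof.
  intros He0 Hf0 H x Hx.
  set (E := fun x => (e x * e x + f x * f x) * exp (- (4 * C) * x)).
  assert (HE : forall y, 0 <= y < d -> exists E', is_derive E y E' /\ E' <= 0).
  { intros y Hy. destruct (H y Hy) as [e' [f' [De [Df [He Hf]]]]].
    exists ((2 * e y * e' + 2 * f y * f' - 4 * C * (e y * e y + f y * f y)) * exp (- (4 * C) * y)).
    split.
    - unfold E. assert (Dx : is_derive (fun x => exp (- (4 * C) * x)) y (- (4 * C) * exp (- (4 * C) * y))).
      { auto_derive; [trivial | ring]. }
      eapply deriv_val; [der|]. ring.
    - assert (Hp := exp_pos (- (4 * C) * y)).
      assert (B1 : e y * e' <= Rabs (e y) * (C * (Rabs (e y) + Rabs (f y)))).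
      { apply Rle_trans with (1 := Rle_abs _). rewrite Rabs_mult.
        apply Rmult_le_compat_l; [apply Rabs_pos | exact He]. }
      assert (B2 : f y * f' <= Rabs (f y) * (C * (Rabs (e y) + Rabs (f y)))).
      { apply Rle_trans with (1 := Rle_abs _). rewrite Rabs_mult.
        apply Rmult_le_compat_l; [apply Rabs_pos | exact Hf]. }
      assert (S1 : e y * e y = Rabs (e y) * Rabs (e y)).
      { rewrite <- Rabs_mult, Rabs_pos_eq; [reflexivity | apply Rle_0_sqr]. }
      assert (S2 : f y * f y = Rabs (f y) * Rabs (f y)).
      { rewrite <- Rabs_mult, Rabs_pos_eq; [reflexivity | apply Rle_0_sqr]. }
      assert (P1 := Rabs_pos (e y)). assert (P2 := Rabs_pos (f y)).
      rewrite S1, S2.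
      destruct (Req_dec (Rabs (e y) + Rabs (f y)) 0) as [Z|Z].
      + assert (Z1 : Rabs (e y) = 0) by lra. assert (Z2 : Rabs (f y) = 0) by lra.
        rewrite Z1, Z2 in *. apply Rle_trans with (0 * exp (- (4 * C) * y)); [|lra].
        apply Rmult_le_compat_r; lra.
      + assert (HC : 0 <= C).
        { apply Rmult_le_reg_r with (Rabs (e y) + Rabs (f y)); [lra|].
          rewrite Rmult_0_l. apply Rle_trans with (2 := He), Rabs_pos. }
        apply Rle_trans with (0 * exp (- (4 * C) * y)); [|lra].
        apply Rmult_le_compat_r; [lra|].
        assert (S : 0 <= C * ((Rabs (e y) - Rabs (f y)) * (Rabs (e y) - Rabs (f y)))).
        { apply Rmult_le_pos; [exact HC | apply Rle_0_sqr]. }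
        nra. }
  assert (HEx : E x <= E 0).
  { destruct (Req_dec x 0) as [->|Hx0]; [lra|].
    destruct (MVT_gen E 0 x (Derive E)) as [c [Hc HM]].
    - intros y Hy. rewrite Rmin_left, Rmax_right in Hy by lra.
      destruct (HE y ltac:(lra)) as [E' [DE _]]. apply Derive_correct. now exists E'.
    - intros y Hy. rewrite Rmin_left, Rmax_right in Hy by lra.
      destruct (HE y ltac:(lra)) as [E' [DE _]].
      apply continuity_pt_filterlim. exact (derivable_continuous _ _ _ DE).
    - rewrite Rmin_left, Rmax_right in Hc by lra.
      destruct (HE c ltac:(lra)) as [E' [DE HE']].
      rewrite (is_derive_unique _ _ _ DE) in HM. nra. }
  unfold E in HEx at 2. rewrite He0, Hf0 in HEx.
  assert (Hp := exp_pos (- (4 * C) * x)).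
  assert (Hs : e x * e x + f x * f x <= 0).
  { unfold E in HEx. apply Rmult_le_reg_r with (1 := Hp). rewrite Rmult_0_l. lra. }
  split; nra.
Qed.

Lemma gronwall (e f : R -> R) d C :
  e 0 = 0 -> f 0 = 0 ->
  (forall x, Rabs x < d -> exists e' f', is_derive e x e' /\ is_derive f x f' /\
     Rabs e' <= C * (Rabs (e x) + Rabs (f x)) /\ Rabs f' <= C * (Rabs (e x) + Rabs (f x))) ->
  forall x, Rabs x < d -> e x = 0 /\ f x = 0.
Proof.
  intros He0 Hf0 H x Hx. destruct (Rle_lt_dec 0 x) as [H0|H0].
  - apply (gronwall_pos e f d C); auto.
    + intros y Hy. apply H. rewrite Rabs_pos_eq; lra.
    + rewrite Rabs_pos_eq in Hx; lra.
  - (* reflect the negative half-line *)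
    assert (G := gronwall_pos (fun x => e (- x)) (fun x => f (- x)) d C).
    cbv beta in G. rewrite Ropp_0 in G.
    rewrite <- (Ropp_involutive x). apply G; auto.
    + intros y Hy. destruct (H (- y)) as [e' [f' [De [Df [He Hf]]]]].
      { rewrite Rabs_Ropp, Rabs_pos_eq; lra. }
      exists (- e'), (- f').
      assert (Dn : is_derive (fun y => - y) y (-1)) by (auto_derive; [trivial | ring]).
      assert (D1 := D_comp e (fun y => - y) y e' (-1) De Dn).
      assert (D2 := D_comp f (fun y => - y) y f' (-1) Df Dn).
      rewrite !Rabs_Ropp. split; [|split; [|split; assumption]].
      * apply (deriv_val _ _ _ _ D1). ring.
      * apply (deriv_val _ _ _ _ D2). ring.
    + rewrite Rabs_left in Hx by lra. lra.
Qed.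

Lemma constant_of_derive (f : R -> R) d :
  (forall x, Rabs x < d -> is_derive f x 0) -> forall x, Rabs x < d -> f x = f 0.
Proof.
  intros H x Hx.
  assert (G := gronwall (fun x => f x - f 0) (fun _ => 0) d 0 (Rminus_diag _) eq_refl).
  apply Rminus_diag_uniq. apply G; [|exact Hx].
  intros y Hy. exists 0, 0. rewrite Rabs_R0. split; [|split; [|lra]].
  - apply (deriv_val _ _ _ _ (D_minus _ _ _ _ _ (H y Hy) (D_const (f 0) y))). ring.
  - apply D_const.
Qed.

(** * The inverse function theorem *)

Lemma vec_pt0 l : List.Forall (fun x => x = 0) l -> vec l = pt0.
Proof.
  intros H. apply functional_extensionality. induction H as [|x l Hx _ IH]; intros [|i]; try reflexivity.
  - exact Hx.
  - apply (IH i).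
Qed.

Lemma An_small f eps : An f -> f pt0 = 0 -> 0 < eps -> near (fun z => Rabs (f z) < eps).
Proof.
  intros Hf H0 He. apply near_imp with (2 := near_small f eps Hf He).
  intros z. now rewrite H0, Rminus_0_r.
Qed.

(** A right inverse of [(F, G)] is reached by following, from the origin and for a short
    time, the vector field that moves the image [(F, G)] with constant velocity: it is
    the inverse Jacobian applied to the velocity.  The velocity is a parameter of the
    flow, hence the inverse is analytic.  The states are the point (indices 0, 1) and
    the constant velocity (indices 2, 3); the time is fixed at [th]. *)
Lemma right_inverse (F G : R -> R -> R) :
  An2 F -> An2 G -> F 0 0 = 0 -> G 0 0 = 0 ->
  d1 F 0 0 * d2 G 0 0 - d2 F 0 0 * d1 G 0 0 <> 0 ->
  exists P Q, An2 P /\ An2 Q /\ P 0 0 = 0 /\ Q 0 0 = 0 /\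
    near (fun z => F (P (z 0%nat) (z 1%nat)) (Q (z 0%nat) (z 1%nat)) = z 0%nat /\
                   G (P (z 0%nat) (z 1%nat)) (Q (z 0%nat) (z 1%nat)) = z 1%nat).
Proof.
  intros HF HG F0 G0 HD.
  set (D := fun z : pt => d1 F (z 0%nat) (z 1%nat) * d2 G (z 0%nat) (z 1%nat)
                        - d2 F (z 0%nat) (z 1%nat) * d1 G (z 0%nat) (z 1%nat)).
  assert (HDA : An D).
  { apply An_minus; apply An_mult.
    - exact (An2_d1 F HF).
    - exact (An2_d2 G HG).
    - exact (An2_d2 F HF).
    - exact (An2_d1 G HG). }
  set (p0 := fun z : pt => (d2 G (z 0%nat) (z 1%nat) * z 2%nat - d2 F (z 0%nat) (z 1%nat) * z 3%nat) / D z).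
  set (p1 := fun z : pt => (d1 F (z 0%nat) (z 1%nat) * z 3%nat - d1 G (z 0%nat) (z 1%nat) * z 2%nat) / D z).
  assert (Hp0 : An p0).
  { apply An_div; [apply An_minus; apply An_mult; try apply An_var | exact HDA | exact HD].
    - exact (An2_d2 G HG).
    - exact (An2_d2 F HF). }
  assert (Hp1 : An p1).
  { apply An_div; [apply An_minus; apply An_mult; try apply An_var | exact HDA | exact HD].
    - exact (An2_d1 F HF).
    - exact (An2_d1 G HG). }
  destruct (analytic_flow (fam [p0; p1])
     (fam [fun _ => 0; fun _ => 0; fun z => z 1%nat; fun z => z 2%nat])) as [u [Hu [Hu0 [Hui Hud]]]].
  { apply AnF_fam. repeat constructor; assumption. }
  { apply AnF_fam. repeat constructor; try apply An_const; apply An_var. }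
  { apply fam_pt0. repeat constructor. }
  { intros i z x. reflexivity. }
  destruct (chain2 F HF) as [rF [HrF CF]]. destruct (chain2 G HG) as [rG [HrG CG]].
  assert (S0F := An_small (u 0%nat) rF (An_of_AnF u 0 Hu) (Hu0 _) HrF).
  assert (S1F := An_small (u 1%nat) rF (An_of_AnF u 1 Hu) (Hu0 _) HrF).
  assert (S0G := An_small (u 0%nat) rG (An_of_AnF u 0 Hu) (Hu0 _) HrG).
  assert (S1G := An_small (u 1%nat) rG (An_of_AnF u 1 Hu) (Hu0 _) HrG).
  assert (SD := near_comp _ u (near_neq0 D HDA HD) Hu Hu0).
  destruct (near_and _ _ Hui (near_and _ _ Hud (near_and _ _ S0F (near_and _ _ S1F
     (near_and _ _ S0G (near_and _ _ S1G SD)))))) as [r0 [Hr0 Hnear]].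
  destruct Hu as [ru [N Hu]]. assert (Hru := AnS_pos _ _ _ _ (Hu 0%nat)).
  set (r := Rmin r0 ru). assert (Hr : 0 < r) by now apply Rmin_pos.
  assert (HuN : forall i, AnN r N (u i)).
  { intros i. apply (AnN_mono ru r N); [split; [exact Hr | apply Rmin_r] | lra | apply Hu]. }
  set (th := r / 2). assert (Hth : 0 < th < r) by (unfold th; lra).
  assert (Hflow : forall z x, box r z -> Rabs x < r ->
     forall i, is_derive (fun x => u i (upd z 0 x)) x (fam [p0; p1] i (fun j => u j (upd z 0 x)))).
  { intros z x Hz Hx i. assert (Hzx := box_upd r z 0 x Hz Hx).
    destruct (Hnear _ (box_mono _ _ _ (Rmin_l _ _) Hzx)) as [_ [H _]].
    specialize (H i). rewrite upd_eq in H. apply is_derive_ext with (2 := H).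
    intros t. now rewrite upd_upd. }
  assert (Hinit : forall z, box r z -> u 0%nat (upd z 0 0) = 0 /\ u 1%nat (upd z 0 0) = 0 /\
     u 2%nat (upd z 0 0) = z 1%nat /\ u 3%nat (upd z 0 0) = z 2%nat).
  { intros z Hz. destruct (Hnear _ (box_mono _ _ _ (Rmin_l _ _) Hz)) as [H _].
    split; [exact (H 0%nat)|]. split; [exact (H 1%nat)|]. split; [exact (H 2%nat) | exact (H 3%nat)]. }
  assert (Hpar : forall z x, box r z -> Rabs x < r ->
      u 2%nat (upd z 0 x) = z 1%nat /\ u 3%nat (upd z 0 x) = z 2%nat).
  { intros z x Hz Hx. destruct (Hinit z Hz) as [_ [_ [I2 I3]]]. rewrite <- I2, <- I3. split.
    - apply (constant_of_derive (fun x => u 2%nat (upd z 0 x)) r); [|exact Hx].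
      intros y Hy. exact (Hflow z y Hz Hy 2%nat).
    - apply (constant_of_derive (fun x => u 3%nat (upd z 0 x)) r); [|exact Hx].
      intros y Hy. exact (Hflow z y Hz Hy 3%nat). }
  assert (Himage : forall z x, box r z -> Rabs x < r ->
      F (u 0%nat (upd z 0 x)) (u 1%nat (upd z 0 x)) = x * z 1%nat /\
      G (u 0%nat (upd z 0 x)) (u 1%nat (upd z 0 x)) = x * z 2%nat).
  { intros z x Hz Hx. destruct (Hinit z Hz) as [I0 [I1 _]].
    assert (Hder : forall y, Rabs y < r ->
       is_derive (fun x => F (u 0%nat (upd z 0 x)) (u 1%nat (upd z 0 x))) y (z 1%nat) /\
       is_derive (fun x => G (u 0%nat (upd z 0 x)) (u 1%nat (upd z 0 x))) y (z 2%nat)).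
    { intros y Hy. assert (Hzy := box_upd r z 0 y Hz Hy).
      destruct (Hnear _ (box_mono _ _ _ (Rmin_l _ _) Hzy)) as [_ [_ [B0 [B1 [B2 [B3 BD]]]]]].
      destruct (Hpar z y Hz Hy) as [P2 P3].
      assert (V0 : fam [p0; p1] 0 (fun j => u j (upd z 0 y)) = p0 (fun j => u j (upd z 0 y))) by reflexivity.
      assert (V1 : fam [p0; p1] 1 (fun j => u j (upd z 0 y)) = p1 (fun j => u j (upd z 0 y))) by reflexivity.
      assert (D0 := Hflow z y Hz Hy 0%nat). assert (D1 := Hflow z y Hz Hy 1%nat).
      rewrite V0 in D0. rewrite V1 in D1. unfold p0, p1 in D0, D1. rewrite P2, P3 in D0, D1.
      split.
      - apply (deriv_val _ _ _ _ (CF _ _ _ _ _ B0 B1 D0 D1)). unfold D in *. field. exact BD.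
      - apply (deriv_val _ _ _ _ (CG _ _ _ _ _ B2 B3 D0 D1)). unfold D in *. field. exact BD. }
    assert (Hlin : forall c y, is_derive (fun x => x * c) y c).
    { intros c y. auto_derive; [trivial | ring]. }
    split.
    - assert (E := constant_of_derive (fun x => F (u 0%nat (upd z 0 x)) (u 1%nat (upd z 0 x)) - x * z 1%nat) r).
      cbv beta in E. rewrite I0, I1, F0, Rmult_0_l in E.
      apply Rminus_diag_uniq. rewrite E; [ring | | exact Hx].
      intros y Hy. apply (deriv_val _ _ _ _ (D_minus _ _ _ _ _ (proj1 (Hder y Hy)) (Hlin _ y))).
      apply Rminus_diag.
    - assert (E := constant_of_derive (fun x => G (u 0%nat (upd z 0 x)) (u 1%nat (upd z 0 x)) - x * z 2%nat) r).
      cbv beta in E. rewrite I0, I1, G0, Rmult_0_l in E.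
      apply Rminus_diag_uniq. rewrite E; [ring | | exact Hx].
      intros y Hy. apply (deriv_val _ _ _ _ (D_minus _ _ _ _ _ (proj2 (Hder y Hy)) (Hlin _ y))).
      apply Rminus_diag. }
  (* zero velocity does not move *)
  assert (Hrest : forall x, Rabs x < r -> u 0%nat (upd pt0 0 x) = 0 /\ u 1%nat (upd pt0 0 x) = 0).
  { intros x Hx. assert (Ho := box_zero r Hr). destruct (Hinit pt0 Ho) as [I0 [I1 _]].
    rewrite <- I0 at 1. rewrite <- I1 at 2. split.
    - apply (constant_of_derive (fun x => u 0%nat (upd pt0 0 x)) r); [|exact Hx].
      intros y Hy. apply (deriv_val _ _ _ _ (Hflow pt0 y Ho Hy 0%nat)).
      destruct (Hpar pt0 y Ho Hy) as [P2 P3].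
      change (p0 (fun j => u j (upd pt0 0 y)) = 0). unfold p0. rewrite P2, P3. unfold pt0, Rdiv. ring.
    - apply (constant_of_derive (fun x => u 1%nat (upd pt0 0 x)) r); [|exact Hx].
      intros y Hy. apply (deriv_val _ _ _ _ (Hflow pt0 y Ho Hy 1%nat)).
      destruct (Hpar pt0 y Ho Hy) as [P2 P3].
      change (p1 (fun j => u j (upd pt0 0 y)) = 0). unfold p1. rewrite P2, P3. unfold pt0, Rdiv. ring. }
  set (Z := fun a b : R => vec [th; a / th; b / th]).
  assert (HZ : forall a b, upd (vec [0; a / th; b / th]) 0 th = Z a b).
  { intros a b. apply functional_extensionality. intros [|i]; reflexivity. }
  set (rho := th * r / 2). assert (Hrho : 0 < rho) by (unfold rho; nra).
  assert (HZA : forall i, AnN rho (r / 2) (fam [fun _ => th; fun z => / th * z 0%nat; fun z => / th * z 1%nat] i)).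
  { assert (Hv : forall j, AnN rho (r / 2) (fun z => / th * z j)).
    { intros j. apply (AnN_mono rho rho (Rabs (/ th) * rho)); [lra | | apply AnN_scal, AnN_var, Hrho].
      rewrite Rabs_pos_eq by (apply Rlt_le, Rinv_0_lt_compat; lra).
      right. unfold rho. field. lra. }
    intros [|[|[|i]]].
    - apply (AnN_mono rho rho (Rabs th)); [lra | rewrite Rabs_pos_eq; unfold th; lra |].
      now apply AnN_const.
    - apply Hv.
    - apply Hv.
    - apply (AnN_mono rho rho 0); [lra | lra |].
      apply AnS_ext with (fun _ => 0); [|now apply AnS_zero].
      intros z _. destruct i; reflexivity. }
  assert (HPA : forall i, An2 (fun a b => u i (Z a b))).
  { intros i. exists rho, N.
    apply AnS_ext with (fun z => u i (fun j => fam [fun _ => th; fun z => / th * z 0%nat; fun z => / th * z 1%nat] j z)).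
    - intros z _. f_equal. apply functional_extensionality.
      intros [|[|[|j]]]; unfold Z, fam, vec; simpl; try reflexivity; unfold Rdiv; apply Rmult_comm.
    - apply (AnN_comp rho r (r / 2)); [apply HuN | lra | exact HZA]. }
  exists (fun a b => u 0%nat (Z a b)), (fun a b => u 1%nat (Z a b)).
  assert (Hz0 : Z 0 0 = upd pt0 0 th).
  { rewrite <- HZ. f_equal. apply vec_pt0. repeat constructor; unfold Rdiv; ring. }
  split; [apply HPA|]. split; [apply HPA|].
  assert (Hthr : Rabs th < r) by (rewrite Rabs_pos_eq; lra).
  destruct (Hrest th Hthr) as [R0 R1]. rewrite <- Hz0 in R0, R1.
  split; [exact R0|]. split; [exact R1|].
  exists rho. split; [exact Hrho|]. intros z Hz.
  assert (Hb : box r (vec [0; z 0%nat / th; z 1%nat / th])).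
  { apply box_vec; [exact Hr|].
    assert (Hc : forall j, Rabs (z j / th) < r).
    { intros j. unfold Rdiv. rewrite Rabs_mult, (Rabs_pos_eq (/ th)) by (apply Rlt_le, Rinv_0_lt_compat; lra).
      apply Rmult_lt_reg_r with th; [lra|]. rewrite Rmult_assoc, Rinv_l, Rmult_1_r by lra.
      apply Rlt_trans with rho; [now apply box_le | unfold rho; nra]. }
    repeat constructor; auto. rewrite Rabs_R0; lra. }
  destruct (Himage _ th Hb Hthr) as [E1 E2]. rewrite HZ in E1, E2.
  split; [rewrite E1 | rewrite E2]; unfold vec; simpl; field; lra.
Qed.

(** Chain rule at the origin: the two Jacobian determinants have product 1. *)
Lemma jacobian_inverse F G P Q : An2 F -> An2 G -> An2 P -> An2 Q ->
  P 0 0 = 0 -> Q 0 0 = 0 ->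
  near (fun z => F (P (z 0%nat) (z 1%nat)) (Q (z 0%nat) (z 1%nat)) = z 0%nat /\
                 G (P (z 0%nat) (z 1%nat)) (Q (z 0%nat) (z 1%nat)) = z 1%nat) ->
  d1 P 0 0 * d2 Q 0 0 - d2 P 0 0 * d1 Q 0 0 <> 0.
Proof.
  intros HF HG HP HQ P0 Q0 Hinv.
  destruct (chain2 F HF) as [rF [HrF CF]]. destruct (chain2 G HG) as [rG [HrG CG]].
  destruct (near_pt0 _ (near_d P HP)) as [DP1 DP2]. destruct (near_pt0 _ (near_d Q HQ)) as [DQ1 DQ2].
  unfold pt0 in *.
  destruct (near_vec _ Hinv) as [r [Hr Hv]].
  assert (L : forall x, Rabs x < r -> 
    (F (P x 0) (Q x 0) = x /\ G (P x 0) (Q x 0) = 0) /\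
    (F (P 0 x) (Q 0 x) = 0 /\ G (P 0 x) (Q 0 x) = x)).
  { intros x Hx. split.
    - apply (Hv [x]). repeat constructor. exact Hx.
    - apply (Hv [0; x]). repeat constructor; [rewrite Rabs_R0; lra | exact Hx]. }
  assert (Hloc : locally 0 (fun x => Rabs x < r)).
  { apply locally_abs_ball. rewrite Rabs_R0. exact Hr. }
  assert (U : forall (f g : R -> R) a b, is_derive f 0 a -> is_derive g 0 b ->
     (forall x, Rabs x < r -> f x = g x) -> a = b).
  { intros f g a b Hf Hg E. rewrite <- (is_derive_unique f 0 a Hf), <- (is_derive_unique g 0 b Hg).
    apply Derive_ext_loc. apply filter_imp with (2 := Hloc). exact E. }
  assert (Hid : is_derive (fun x : R => x) 0 1) by apply D_id.
  assert (H0 : is_derive (fun x : R => 0) 0 0) by apply D_const.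
  assert (RF : Rabs 0 < rF) by (rewrite Rabs_R0; lra).
  assert (RG : Rabs 0 < rG) by (rewrite Rabs_R0; lra).
  assert (BP : Rabs (P 0 0) < rF) by now rewrite P0. assert (BQ : Rabs (Q 0 0) < rF) by now rewrite Q0.
  assert (BP' : Rabs (P 0 0) < rG) by now rewrite P0. assert (BQ' : Rabs (Q 0 0) < rG) by now rewrite Q0.
  assert (E1 := U _ _ _ _ (CF (fun x => P x 0) (fun x => Q x 0) 0 _ _ BP BQ DP1 DQ1) Hid (fun x Hx => proj1 (proj1 (L x Hx)))).
  assert (E2 := U _ _ _ _ (CG (fun x => P x 0) (fun x => Q x 0) 0 _ _ BP' BQ' DP1 DQ1) H0 (fun x Hx => proj2 (proj1 (L x Hx)))).
  assert (E3 := U _ _ _ _ (CF (fun x => P 0 x) (fun x => Q 0 x) 0 _ _ BP BQ DP2 DQ2) H0 (fun x Hx => proj1 (proj2 (L x Hx)))).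
  assert (E4 := U _ _ _ _ (CG (fun x => P 0 x) (fun x => Q 0 x) 0 _ _ BP' BQ' DP2 DQ2) Hid (fun x Hx => proj2 (proj2 (L x Hx)))).
  cbv beta in E1, E2, E3, E4. rewrite P0, Q0 in E1, E2, E3, E4.
  intros E.
  assert (K : 1 = (d1 F 0 0 * d2 G 0 0 - d2 F 0 0 * d1 G 0 0) * (d1 P 0 0 * d2 Q 0 0 - d2 P 0 0 * d1 Q 0 0)).
  { transitivity ((d1 P 0 0 * d1 F 0 0 + d1 Q 0 0 * d2 F 0 0) * (d2 P 0 0 * d1 G 0 0 + d2 Q 0 0 * d2 G 0 0)
      - (d2 P 0 0 * d1 F 0 0 + d2 Q 0 0 * d2 F 0 0) * (d1 P 0 0 * d1 G 0 0 + d1 Q 0 0 * d2 G 0 0)).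
    - rewrite E1, E2, E3, E4. ring.
    - ring. }
  rewrite E in K. lra.
Qed.

(** The right inverse of [(F, G)] has itself a right inverse, which must be [(F, G)]. *)
Theorem inverse_function (F G : R -> R -> R) :
  An2 F -> An2 G -> F 0 0 = 0 -> G 0 0 = 0 ->
  d1 F 0 0 * d2 G 0 0 - d2 F 0 0 * d1 G 0 0 <> 0 ->
  exists P Q, An2 P /\ An2 Q /\ P 0 0 = 0 /\ Q 0 0 = 0 /\
    near (fun z => F (P (z 0%nat) (z 1%nat)) (Q (z 0%nat) (z 1%nat)) = z 0%nat /\
                   G (P (z 0%nat) (z 1%nat)) (Q (z 0%nat) (z 1%nat)) = z 1%nat) /\
    near (fun z => P (F (z 0%nat) (z 1%nat)) (G (z 0%nat) (z 1%nat)) = z 0%nat /\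
                   Q (F (z 0%nat) (z 1%nat)) (G (z 0%nat) (z 1%nat)) = z 1%nat).
Proof.
  intros HF HG F0 G0 HD.
  destruct (right_inverse F G HF HG F0 G0 HD) as [P [Q [HP [HQ [P0 [Q0 HPQ]]]]]].
  exists P, Q. do 5 (split; [assumption|]).
  assert (HD' := jacobian_inverse F G P Q HF HG HP HQ P0 Q0 HPQ).
  destruct (right_inverse P Q HP HQ P0 Q0 HD') as [F' [G' [HF' [HG' [F0' [G0' HFG]]]]]].
  assert (H := near_comp_vec _ [fun z => F' (z 0%nat) (z 1%nat); fun z => G' (z 0%nat) (z 1%nat)] HPQ).
  assert (H' : near (fun z => F (P (F' (z 0%nat) (z 1%nat)) (G' (z 0%nat) (z 1%nat)))
                    (Q (F' (z 0%nat) (z 1%nat)) (G' (z 0%nat) (z 1%nat))) = F' (z 0%nat) (z 1%nat) /\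
                   G (P (F' (z 0%nat) (z 1%nat)) (G' (z 0%nat) (z 1%nat)))
                    (Q (F' (z 0%nat) (z 1%nat)) (G' (z 0%nat) (z 1%nat))) = G' (z 0%nat) (z 1%nat))).
  { apply H; repeat constructor; assumption. }
  apply near_imp with (2 := near_and _ _ H' HFG).
  intros z [[A1 A2] [A3 A4]]. rewrite A3, A4 in A1, A2. rewrite A1, A2. now split.
Qed.

Lemma near_locally_2d (Q : R -> R -> Prop) : near (fun z => Q (z 0%nat) (z 1%nat)) -> locally_2d Q 0 0.
Proof.
  intros H. destruct (near_vec _ H) as [r [Hr Hv]]. exists (mkposreal r Hr).
  simpl. intros u v Hu Hv'. rewrite Rminus_0_r in Hu, Hv'.
  apply (Hv [u; v]). repeat constructor; assumption.
Qed.

Lemma local_diffeo_of_inverse F G P Q :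
  An2 F -> An2 G -> F 0 0 = 0 -> G 0 0 = 0 -> An2 P -> An2 Q ->
  near (fun z => F (P (z 0%nat) (z 1%nat)) (Q (z 0%nat) (z 1%nat)) = z 0%nat /\
                 G (P (z 0%nat) (z 1%nat)) (Q (z 0%nat) (z 1%nat)) = z 1%nat) ->
  near (fun z => P (F (z 0%nat) (z 1%nat)) (G (z 0%nat) (z 1%nat)) = z 0%nat /\
                 Q (F (z 0%nat) (z 1%nat)) (G (z 0%nat) (z 1%nat)) = z 1%nat) ->
  local_diffeo F G.
Proof.
  intros HF HG F0 G0 HP HQ H1 H2.
  split; [exact F0|]. split; [exact G0|].
  split; [now apply An2_smooth|]. split; [now apply An2_smooth|].
  exists P, Q. split; [now apply An2_smooth|]. split; [now apply An2_smooth|].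
  split.
  - exact (near_locally_2d (fun x y => P (F x y) (G x y) = x /\ Q (F x y) (G x y) = y) H2).
  - exact (near_locally_2d (fun x y => F (P x y) (Q x y) = x /\ G (P x y) (Q x y) = y) H1).
Qed.

(** * From sums over triples to power series, and back *)

Definition tri1 k := pr1 k.
Definition tri2 k := pr1 (pr2 k).
Definition tri3 k := pr2 (pr2 k).

Lemma tri_eqb i j l k :
  ((tri1 k =? i)%nat && (tri2 k =? j)%nat && (tri3 k =? l)%nat)%bool
  = (k =? Cantor.to_nat (i, Cantor.to_nat (j, l)))%nat.
Proof.
  unfold tri1, tri2, tri3. rewrite <- Bool.andb_assoc, pr_eqb. apply pr_eqb.
Qed.

Lemma tri_partial (v : nat -> nat -> nat -> R) n :
  (forall i j l, 0 <= v i j l) ->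
  sum_n (fun k => v (tri1 k) (tri2 k) (tri3 k)) n
  <= sum_n (fun i => sum_n (fun j => sum_n (fun l => v i j l) n) n) n.
Proof.
  intros Hv.
  apply Rle_trans with (1 := pairing_partial (fun i m => v i (pr1 m) (pr2 m)) n (fun i m => Hv _ _ _)).
  apply sum_n_m_le. intros i. apply (pairing_partial (v i) n). apply Hv.
Qed.

(** The triples are enumerated by two diagonal pairings.  The sum of the resulting series
    is the limit of the box sums, because each box sum is a sum over fibres. *)
Lemma series_of_sum3 (t : nat -> nat -> nat -> R) (s : R) : is_sum3 t s ->
  ex_series (fun k => Rabs (t (tri1 k) (tri2 k) (tri3 k))) /\
  is_series (fun k => t (tri1 k) (tri2 k) (tri3 k)) s.
Proof.
  intros [[M HM] Hs].
  destruct (ex_series_bounded (fun k => Rabs (t (tri1 k) (tri2 k) (tri3 k))) M) as [He _].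
  { intros k. apply Rabs_pos. }
  { intros n. apply Rle_trans with (2 := HM n).
    apply (tri_partial (fun i j l => Rabs (t i j l))). intros; apply Rabs_pos. }
  split; [exact He|].
  destruct (is_sum3_fibres tri1 tri2 tri3 _ He) as [_ Hl].
  assert (E : s = Series (fun k => t (tri1 k) (tri2 k) (tri3 k))).
  { apply is_lim_seq_unique in Hs. apply is_lim_seq_unique in Hl.
    assert (Heq : Finite s = Finite (Series (fun k => t (tri1 k) (tri2 k) (tri3 k)))).
    { rewrite <- Hs, <- Hl. apply Lim_seq_ext. intros n.
      apply sum_n_ext. intros i. apply sum_n_ext. intros j. apply sum_n_ext. intros l.
      rewrite (Series_ext _ (fun k => ind (k =? Cantor.to_nat (i, Cantor.to_nat (j, l)))%nat
         (t (tri1 k) (tri2 k) (tri3 k)))) by (intros k; now rewrite tri_eqb).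
      rewrite (is_series_unique _ _ (Series_single _ _)).
      unfold tri1, tri2, tri3, pr1, pr2. rewrite !Cantor.cancel_of_to. cbn [fst snd].
      rewrite !Cantor.cancel_of_to. reflexivity. }
    now injection Heq. }
  rewrite E. apply Series_correct, ex_series_Rabs, He.
Qed.

Lemma mon_repeat n i z : mon (repeat i n) z = z i ^ n.
Proof. induction n as [|n IH]; simpl; [reflexivity | now rewrite IH]. Qed.

Lemma An3_of_analytic B : analytic_near_0 B -> An3 B.
Proof.
  intros [c [r [Hr H]]].
  set (l := fun k => repeat 0%nat (tri1 k) ++ repeat 1%nat (tri2 k) ++ repeat 2%nat (tri3 k)).
  set (a := fun k => c (tri1 k) (tri2 k) (tri3 k)).
  assert (Hl : forall k z, mon (l k) z = z 0%nat ^ tri1 k * (z 1%nat ^ tri2 k * z 2%nat ^ tri3 k)).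
  { intros k z. unfold l. now rewrite !mon_app, !mon_repeat. }
  assert (Hh : in_box r (r / 2) (r / 2) (r / 2)).
  { unfold in_box. rewrite Rabs_pos_eq; lra. }
  destruct (series_of_sum3 _ _ (H _ _ _ Hh)) as [He _].
  exists (r / 2), (Series (fun k => Rabs (a k) * (r / 2) ^ length (l k))).
  split; [lra|]. exists a, l. split; [trivial|]. split; [|split; [lra|]].
  - apply ex_series_ext with (2 := He). intros k. real_eq.
    unfold l, a. rewrite !Rabs_mult, !(Rabs_pos_eq (_ ^ _)) by (apply pow_le; lra).
    rewrite !length_app, !repeat_length, !pow_add. ring.
  - intros z Hz.
    assert (Hin : in_box r (z 0%nat) (z 1%nat) (z 2%nat)).
    { repeat split; apply Rlt_trans with (r / 2); try lra; now apply box_le. }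
    destruct (series_of_sum3 _ _ (H _ _ _ Hin)) as [_ Hs].
    apply is_series_ext with (2 := Hs). intros k. real_eq. rewrite Hl. unfold a. ring.
Qed.

Definition cnt (i : nat) (l : list nat) : nat := count_occ Nat.eq_dec l i.
(** Monomials in the first three variables only; the others vanish at [vec [x; y; p]]. *)
Definition low (l : list nat) : bool := forallb (fun i => i <? 3)%nat l.

Lemma mon_low l x y p : mon l (vec [x; y; p]) =
  ind (low l) (x ^ cnt 0 l * y ^ cnt 1 l * p ^ cnt 2 l).
Proof.
  induction l as [|i l IH]; simpl; [ring|]. rewrite IH.
  destruct i as [|[|[|i]]]; unfold vec; simpl.
  - destruct (low l); simpl; ring.
  - destruct (low l); simpl; ring.
  - destruct (low l); simpl; ring.
  - destruct i; ring.
Qed.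

Section Coefficients.
Variables (S : list nat -> Prop) (r N : R) (f : pt -> R) (a : nat -> R) (l : nat -> list nat).
Hypothesis (Hr : 0 < r).
Hypothesis (HS : forall k, a k <> 0 -> S (l k)).
Hypothesis (He : ex_series (fun k => Rabs (a k) * r ^ length (l k))).
Hypothesis (Hf : forall z, box r z -> is_series (fun k => a k * mon (l k) z) (f z)).

Lemma term_summable x y p : Rabs x < r -> Rabs y < r -> Rabs p < r ->
  ex_series (fun k => Rabs (a k * mon (l k) (vec [x; y; p]))).
Proof.
  intros Hx Hy Hp. apply ex_series_dom with (2 := He). intros k. apply term_bound.
  intros i. apply box_weak. apply box_vec; [exact Hr | repeat constructor; assumption].
Qed.

Lemma f_series x y p : Rabs x < r -> Rabs y < r -> Rabs p < r ->
  f (vec [x; y; p]) = Series (fun k => a k * mon (l k) (vec [x; y; p])).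
Proof.
  intros Hx Hy Hp. symmetry. apply is_series_unique. apply Hf.
  apply box_vec; [exact Hr | repeat constructor; assumption].
Qed.

Lemma coef3 x y p : Rabs x < r -> Rabs y < r -> Rabs p < r ->
  is_sum3 (fun i j m => Series (fun k => ind ((cnt 0 (l k) =? i)%nat && (cnt 1 (l k) =? j)%nat
     && (cnt 2 (l k) =? m)%nat) (ind (low (l k)) (a k))) * x ^ i * y ^ j * p ^ m) (f (vec [x; y; p])).
Proof.
  intros Hx Hy Hp. rewrite f_series by assumption.
  destruct (is_sum3_fibres (fun k => cnt 0 (l k)) (fun k => cnt 1 (l k)) (fun k => cnt 2 (l k)) _
     (term_summable x y p Hx Hy Hp)) as [[M HM] HL].
  assert (E : forall i j m, Series (fun k => ind ((cnt 0 (l k) =? i)%nat && (cnt 1 (l k) =? j)%nat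
     && (cnt 2 (l k) =? m)%nat) (ind (low (l k)) (a k))) * x ^ i * y ^ j * p ^ m =
     Series (fun k => ind ((cnt 0 (l k) =? i)%nat && (cnt 1 (l k) =? j)%nat
     && (cnt 2 (l k) =? m)%nat) (a k * mon (l k) (vec [x; y; p])))).
  { intros i j m. rewrite !Rmult_assoc, <- Series_scal_r. apply Series_ext. intros k.
    rewrite mon_low.
    destruct (Nat.eqb_spec (cnt 0 (l k)) i), (Nat.eqb_spec (cnt 1 (l k)) j),
      (Nat.eqb_spec (cnt 2 (l k)) m); subst; simpl; try ring.
    destruct (low (l k)); simpl; ring. }
  split.
  - exists M. intros n. apply Rle_trans with (2 := HM n). right.
    apply sum_n_ext. intros i. apply sum_n_ext. intros j. apply sum_n_ext. intros m.
    now rewrite E.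
  - apply is_lim_seq_ext with (2 := HL). intros n.
    apply sum_n_ext. intros i. apply sum_n_ext. intros j. apply sum_n_ext. intros m.
    now rewrite E.
Qed.

(** The coefficient of [x ^ i * p ^ j]: evaluation at [x = p = 1] keeps the dependence
    on [y] only. *)
Definition coef (i j : nat) (y : R) : R :=
  Series (fun k => ind ((cnt 0 (l k) =? i)%nat && (cnt 2 (l k) =? j)%nat)
     (a k * mon (l k) (vec [1; y; 1]))).

Lemma mon_split l0 x y p :
  mon l0 (vec [x; y; p]) = mon l0 (vec [1; y; 1]) * (x ^ cnt 0 l0 * p ^ cnt 2 l0).
Proof. rewrite !mon_low, !pow1. destruct (low l0); simpl; ring. Qed.

Lemma coef_term x y p i j :
  coef i j y * x ^ i * p ^ j = Series (fun k => ind ((cnt 0 (l k) =? i)%nat && (cnt 2 (l k) =? j)%nat)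
     (a k * mon (l k) (vec [x; y; p]))).
Proof.
  unfold coef. rewrite Rmult_assoc, <- Series_scal_r. apply Series_ext. intros k.
  rewrite (mon_split (l k) x y p).
  destruct (Nat.eqb_spec (cnt 0 (l k)) i), (Nat.eqb_spec (cnt 2 (l k)) j); subst; simpl; ring.
Qed.

Lemma coef2 x y p : Rabs x < r -> Rabs y < r -> Rabs p < r ->
  is_sum2 (fun i j => coef i j y * x ^ i * p ^ j) (f (vec [x; y; p])).
Proof.
  intros Hx Hy Hp. rewrite f_series by assumption.
  destruct (is_sum2_fibres (fun k => cnt 0 (l k)) (fun k => cnt 2 (l k)) _
     (term_summable x y p Hx Hy Hp)) as [[M HM] HL].
  split.
  - exists M. intros n. apply Rle_trans with (2 := HM n). right.
    apply sum_n_ext. intros i. apply sum_n_ext. intros j. now rewrite coef_term.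
  - apply is_lim_seq_ext with (2 := HL). intros n.
    apply sum_n_ext. intros i. apply sum_n_ext. intros j. now rewrite coef_term.
Qed.

Lemma coef_zero i j y : (forall l0, S l0 -> cnt 0 l0 = i -> cnt 2 l0 <> j) -> coef i j y = 0.
Proof.
  intros H. unfold coef. rewrite (Series_ext _ (fun k => 0 * 0)).
  - rewrite Series_scal_l. ring.
  - intros k. destruct (Nat.eqb_spec (cnt 0 (l k)) i) as [E1|]; [|simpl; ring].
    destruct (Nat.eqb_spec (cnt 2 (l k)) j) as [E2|]; [|simpl; ring].
    destruct (Req_dec (a k) 0) as [->|Ha]; [simpl; ring|].
    now contradiction (H (l k) (HS k Ha) E1).
Qed.
End Coefficients.

(** * Right-hand sides in normal form *)

Lemma low_length l : low l = true -> length l = (cnt 0 l + cnt 1 l + cnt 2 l)%nat.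
Proof.
  induction l as [|i l IH]; simpl; [reflexivity|].
  intros H. apply Bool.andb_true_iff in H as [H1 H2]. specialize (IH H2).
  destruct i as [|[|[|i]]]; simpl in *; unfold cnt in *; simpl; try lia. discriminate.
Qed.

(** The exponents allowed by the normal form: [p ^ 4] divides the monomial, or
    [x ^ 2 * p ^ 2] does. *)
Definition normal_mon (l : list nat) : Prop :=
  (4 <= cnt 2 l)%nat \/ (2 <= cnt 0 l /\ 2 <= cnt 2 l)%nat.

Section Expansion.
Variables (r : R) (a : nat -> R) (l : nat -> list nat).
Hypothesis (Hr : 0 < r).
Hypothesis (HS : forall k, a k <> 0 -> normal_mon (l k)).
Hypothesis (He : ex_series (fun k => Rabs (a k) * r ^ length (l k))).

Lemma coef_summable i j y : Rabs y < r ->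
  ex_series (fun k => ind ((cnt 0 (l k) =? i)%nat && (cnt 2 (l k) =? j)%nat)
     (a k * mon (l k) (vec [1; y; 1]))).
Proof.
  intros Hy. assert (Hh : Rabs (r / 2) < r) by (rewrite Rabs_pos_eq; lra).
  assert (T := ex_series_ind (fun k => (cnt 0 (l k) =? i)%nat && (cnt 2 (l k) =? j)%nat)%bool _
     (term_summable r a l Hr He _ _ _ Hh Hy Hh)).
  apply ex_series_Rabs in T.
  apply (ex_series_scal_r (/ ((r / 2) ^ i * (r / 2) ^ j))) in T.
  apply ex_series_ext with (2 := T). intros k. real_eq.
  rewrite (mon_split (l k) (r / 2) y (r / 2)).
  assert (Hp : forall n, (r / 2) ^ n <> 0) by (intros n; apply pow_nonzero; lra).
  destruct (Nat.eqb_spec (cnt 0 (l k)) i), (Nat.eqb_spec (cnt 2 (l k)) j); subst; simpl; try ring.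
  field. split; apply Hp.
Qed.

Lemma low_part_bound x y p k : Rabs x < r -> Rabs y < r -> Rabs p < r ->
  Rabs (ind (cnt 0 (l k) <=? 1)%nat (a k * mon (l k) (vec [x; y; 1]) * p ^ (cnt 2 (l k) - 4)))
  <= Rabs (a k) * r ^ length (l k) * / r ^ 4.
Proof.
  intros Hx Hy Hp.
  assert (H0 : 0 <= Rabs (a k) * r ^ length (l k) * / r ^ 4).
  { apply Rmult_le_pos; [apply Rmult_le_pos; [apply Rabs_pos | apply pow_le; lra]|].
    apply Rlt_le, Rinv_0_lt_compat, pow_lt, Hr. }
  destruct (Nat.leb_spec (cnt 0 (l k)) 1) as [Hc|Hc]; cbn [ind]; [|now rewrite Rabs_R0].
  destruct (Req_dec (a k) 0) as [Ha|Ha].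
  { rewrite Ha, !Rmult_0_l, Rabs_R0, !Rmult_0_l. lra. }
  assert (H4 : (4 <= cnt 2 (l k))%nat) by (destruct (HS k Ha); lia).
  rewrite mon_low, pow1. destruct (low (l k)) eqn:Hlow.
  2: { cbn [ind]. rewrite Rmult_0_r, Rmult_0_l, Rabs_R0. exact H0. }
  rewrite (low_length _ Hlow). cbn [ind].
  rewrite Rmult_1_r, !Rabs_mult, <- !RPow_abs, !Rmult_assoc.
  apply Rmult_le_compat_l; [apply Rabs_pos|].
  replace (cnt 0 (l k) + cnt 1 (l k) + cnt 2 (l k))%nat with
    (cnt 0 (l k) + (cnt 1 (l k) + ((cnt 2 (l k) - 4) + 4)))%nat by lia.
  rewrite !pow_add.
  replace (r ^ cnt 0 (l k) * (r ^ cnt 1 (l k) * (r ^ (cnt 2 (l k) - 4) * r ^ 4)) * / r ^ 4) with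
    (r ^ cnt 0 (l k) * (r ^ cnt 1 (l k) * r ^ (cnt 2 (l k) - 4))).
  2: { field. lra. }
  assert (P : forall z n, Rabs z < r -> 0 <= Rabs z ^ n <= r ^ n).
  { intros z n Hz. split; [apply pow_le, Rabs_pos | apply pow_incr]. split; [apply Rabs_pos | lra]. }
  apply Rmult_le_compat; try apply P; auto.
  - apply Rmult_le_pos; apply P; auto.
  - apply Rmult_le_compat; apply P; auto.
Qed.

(** Terms with [x]-exponent at most 1 are divisible by [p ^ 4]; what is summed here is
    the quotient.  Where the exponent of [p] is less than 4 the coefficient is 0, so
    the truncated subtraction is harmless. *)
Lemma expansion_low x y p : Rabs x < r -> Rabs y < r -> Rabs p < r ->
  is_series (fun j => (coef a l 0 (j + 4) y + x * coef a l 1 (j + 4) y) * p ^ j)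
    (Series (fun k => ind (cnt 0 (l k) <=? 1)%nat
       (a k * mon (l k) (vec [x; y; 1]) * p ^ (cnt 2 (l k) - 4)))).
Proof.
  intros Hx Hy Hp.
  assert (Hv : ex_series (fun k => Rabs (ind (cnt 0 (l k) <=? 1)%nat
       (a k * mon (l k) (vec [x; y; 1]) * p ^ (cnt 2 (l k) - 4))))).
  { apply ex_series_dom with (fun k => Rabs (a k) * r ^ length (l k) * / r ^ 4).
    - intros k. now apply low_part_bound.
    - apply (ex_series_scal_r (/ r ^ 4)). exact He. }
  apply is_series_ext with (2 := is_series_fibres (fun k => (cnt 2 (l k) - 4)%nat) _ Hv).
  intros j. real_eq. unfold coef. rewrite <- Series_scal_l, <- Series_plus, <- Series_scal_r.
  - apply Series_ext. intros k. rewrite (mon_split (l k) x y 1), pow1.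
    destruct (Req_dec (a k) 0) as [Ha|Ha].
    { rewrite Ha, !Rmult_0_l, !ind_0. ring. }
    assert (HSk := HS k Ha). unfold normal_mon in HSk.
    destruct (Nat.leb_spec (cnt 0 (l k)) 1) as [Hc|Hc].
    + destruct (Nat.eqb_spec (cnt 2 (l k) - 4) j), (Nat.eqb_spec (cnt 2 (l k)) (j + 4)); try lia.
      * subst j. destruct (cnt 0 (l k)) as [|[|c]]; [| |lia]; simpl; ring.
      * rewrite !Bool.andb_false_r. simpl. ring.
    + destruct (Nat.eqb_spec (cnt 0 (l k)) 0), (Nat.eqb_spec (cnt 0 (l k)) 1); try lia.
      destruct (cnt 2 (l k) - 4 =? j)%nat; simpl; ring.
  - now apply coef_summable.
  - apply (ex_series_mult_l x). now apply coef_summable.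
Qed.

Lemma expansion_high x y p : Rabs x < r -> Rabs y < r -> Rabs p < r ->
  is_sum2 (fun i j => coef a l (i + 2) (j + 2) y * x ^ (i + 2) * p ^ (j + 2))
    (Series (fun k => ind (2 <=? cnt 0 (l k))%nat (a k * mon (l k) (vec [x; y; p])))).
Proof.
  intros Hx Hy Hp.
  assert (Hv := ex_series_ind (fun k => (2 <=? cnt 0 (l k))%nat) _ (term_summable r a l Hr He x y p Hx Hy Hp)).
  assert (E : forall i j, coef a l (i + 2) (j + 2) y * x ^ (i + 2) * p ^ (j + 2) =
    Series (fun k => ind ((cnt 0 (l k) - 2 =? i)%nat && (cnt 2 (l k) - 2 =? j)%nat)
      (ind (2 <=? cnt 0 (l k))%nat (a k * mon (l k) (vec [x; y; p]))))).
  { intros i j. rewrite coef_term. apply Series_ext. intros k.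
    destruct (Req_dec (a k) 0) as [Ha|Ha].
    { rewrite Ha, !Rmult_0_l, !ind_0. reflexivity. }
    assert (HSk := HS k Ha). unfold normal_mon in HSk. rewrite ind_and. f_equal.
    destruct (Nat.eqb_spec (cnt 0 (l k)) (i + 2)), (Nat.eqb_spec (cnt 2 (l k)) (j + 2)),
      (Nat.eqb_spec (cnt 0 (l k) - 2) i), (Nat.eqb_spec (cnt 2 (l k) - 2) j),
      (Nat.leb_spec 2 (cnt 0 (l k))); simpl; lia || reflexivity. }
  destruct (is_sum2_fibres (fun k => (cnt 0 (l k) - 2)%nat) (fun k => (cnt 2 (l k) - 2)%nat) _ Hv)
    as [[M HM] HL].
  split.
  - exists M. intros n. apply Rle_trans with (2 := HM n). right.
    apply sum_n_ext. intros i. apply sum_n_ext. intros j. now rewrite E.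
  - apply is_lim_seq_ext with (2 := HL). intros n.
    apply sum_n_ext. intros i. apply sum_n_ext. intros j. now rewrite E.
Qed.

Lemma expansion_total x y p : Rabs x < r -> Rabs y < r -> Rabs p < r ->
  Series (fun k => a k * mon (l k) (vec [x; y; p])) =
  p ^ 4 * Series (fun k => ind (cnt 0 (l k) <=? 1)%nat
       (a k * mon (l k) (vec [x; y; 1]) * p ^ (cnt 2 (l k) - 4)))
  + Series (fun k => ind (2 <=? cnt 0 (l k))%nat (a k * mon (l k) (vec [x; y; p]))).
Proof.
  intros Hx Hy Hp. rewrite <- Series_scal_l, <- Series_plus.
  - apply Series_ext. intros k. rewrite (mon_split (l k) x y p), (mon_split (l k) x y 1), pow1.
    destruct (Req_dec (a k) 0) as [Ha|Ha].
    { rewrite Ha, !Rmult_0_l, !ind_0. ring. }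
    assert (HSk := HS k Ha). unfold normal_mon in HSk.
    destruct (Nat.leb_spec (cnt 0 (l k)) 1), (Nat.leb_spec 2 (cnt 0 (l k))); try lia;
      cbn [ind]; [|ring].
    replace (p ^ cnt 2 (l k)) with (p ^ (cnt 2 (l k) - 4) * p ^ 4); [ring|].
    rewrite <- pow_add. f_equal. lia.
  - apply (ex_series_mult_l (p ^ 4)).
    apply ex_series_Rabs. apply ex_series_dom with (fun k => Rabs (a k) * r ^ length (l k) * / r ^ 4).
    + intros k. now apply low_part_bound.
    + apply (ex_series_scal_r (/ r ^ 4)). exact He.
  - apply ex_series_Rabs, ex_series_ind. now apply (term_summable r).
Qed.
End Expansion.

(** The two summands only produce monomials allowed by [normal_mon]; multiplying a series
    by a monomial shifts its list of monomials, so the coefficients excluded by the normal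
    form are sums without terms. *)
Lemma normal_expansion (A C Bt : R -> R -> R -> R) : An3 A -> An3 C ->
  (forall x y p, Bt x y p = x ^ 2 * p ^ 2 * A x y p + p ^ 4 * C x y p) ->
  analytic_near_0 Bt /\
    exists (Bc : nat -> nat -> R -> R) (r : R), 0 < r /\
      (forall x y p : R, in_box r x y p ->
         is_sum2 (fun i j => Bc i j y * x ^ i * p ^ j) (Bt x y p)) /\
      (forall y : R, Rabs y < r ->
         (forall i : nat, Bc i 0%nat y = 0 /\ Bc i 1%nat y = 0) /\
         Bc 0%nat 2%nat y = 0 /\ Bc 0%nat 3%nat y = 0 /\
         Bc 1%nat 2%nat y = 0 /\ Bc 1%nat 3%nat y = 0) /\
      (forall x y p : R, in_box r x y p ->
         exists s1 s2 : R,
           is_series (fun j : nat =>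
             (Bc 0%nat (j + 4)%nat y + x * Bc 1%nat (j + 4)%nat y) * p ^ j) s1 /\
           is_sum2 (fun i j : nat =>
             Bc (i + 2)%nat (j + 2)%nat y * x ^ (i + 2) * p ^ (j + 2)) s2 /\
           Bt x y p = p ^ 4 * s1 + s2).
Proof.
  intros HA HC HB. destruct (An_common _ _ HA HC) as [r [N [M [HA' HC']]]].
  assert (HAn : exists K, AnS normal_mon r K (fun z => 1 * mon [0; 0; 2; 2]%nat z * A (z 0%nat) (z 1%nat) (z 2%nat)
     + 1 * mon [2; 2; 2; 2]%nat z * C (z 0%nat) (z 1%nat) (z 2%nat))).
  { eexists. apply AnS_plus.
    - apply AnS_scal_mon with (2 := HA'). intros l _. right. unfold cnt; simpl. lia.
    - apply AnS_scal_mon with (2 := HC'). intros l _. left. unfold cnt; simpl. lia. }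
  destruct HAn as [K [Hr [a [l [HS [He [_ Hf]]]]]]].
  set (f := fun z : pt => Bt (z 0%nat) (z 1%nat) (z 2%nat)).
  assert (Hf' : forall z, box r z -> is_series (fun k => a k * mon (l k) z) (f z)).
  { intros z Hz. replace (f z) with (1 * mon [0; 0; 2; 2]%nat z * A (z 0%nat) (z 1%nat) (z 2%nat)
     + 1 * mon [2; 2; 2; 2]%nat z * C (z 0%nat) (z 1%nat) (z 2%nat)); [now apply Hf|].
    unfold f. rewrite HB. simpl. ring. }
  split.
  - exists (fun i j m => Series (fun k => ind ((cnt 0 (l k) =? i)%nat && (cnt 1 (l k) =? j)%nat
     && (cnt 2 (l k) =? m)%nat) (ind (low (l k)) (a k)))), r.
    split; [exact Hr|]. intros x y p [Hx [Hy Hp]].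
    exact (coef3 r f a l Hr He Hf' x y p Hx Hy Hp).
  - exists (coef a l), r. split; [exact Hr|]. split; [|split].
    + intros x y p [Hx [Hy Hp]]. exact (coef2 r f a l Hr He Hf' x y p Hx Hy Hp).
    + intros y Hy.
      assert (Z : forall i j, (j < 4)%nat -> (i < 2 \/ j < 2)%nat -> coef a l i j y = 0).
      { intros i j Hj Hij. apply (coef_zero normal_mon); [exact HS|].
        intros l0 [H1|[H1 H2]] E0 E2; lia. }
      repeat split; apply Z; lia.
    + intros x y p [Hx [Hy Hp]].
      eexists. eexists. split; [|split].
      * apply (expansion_low r a l Hr HS He x y p Hx Hy Hp).
      * apply (expansion_high r a l Hr HS He x y p Hx Hy Hp).
      * change (Bt x y p) with (f (vec [x; y; p])).
        rewrite (f_series r f a l Hr Hf' x y p Hx Hy Hp).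
        now apply (expansion_total r).
Qed.

(** * Expansion in the slope *)

(** Four successive divisions by the increment of the slope.  The first coefficient has
    to be recognized as the partial derivative, because it enters the equation of
    variations along a solution. *)
Lemma taylor_slope B : An3 B -> exists B1 B2 B3 H, An3 B1 /\ An3 B2 /\ An3 B3 /\ An4 H /\
  near (fun z => B (z 0%nat) (z 1%nat) (z 2%nat + z 3%nat) =
    B (z 0%nat) (z 1%nat) (z 2%nat) + B1 (z 0%nat) (z 1%nat) (z 2%nat) * z 3%nat
    + B2 (z 0%nat) (z 1%nat) (z 2%nat) * z 3%nat ^ 2 + B3 (z 0%nat) (z 1%nat) (z 2%nat) * z 3%nat ^ 3
    + z 3%nat ^ 4 * H (z 0%nat) (z 1%nat) (z 2%nat) (z 3%nat)) /\
  near (fun z => e3 B (z 0%nat) (z 1%nat) (z 2%nat) = B1 (z 0%nat) (z 1%nat) (z 2%nat)).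
Proof.
  intros HB.
  assert (HF : An4 (fun x y p s => B x y (p + s))).
  { apply (An_comp3 B); auto; try apply An_var; [apply An_plus; apply An_var | unfold pt0; ring]. }
  destruct (hadamard4 _ HF) as [G1 [HG1 E1]]. destruct (hadamard4 _ HG1) as [G2 [HG2 E2]].
  destruct (hadamard4 _ HG2) as [G3 [HG3 E3]]. destruct (hadamard4 _ HG3) as [H [HH E4]].
  assert (Hat0 : forall G, An4 G -> An3 (fun x y p => G x y p 0)).
  { intros G HG. apply (An_comp4 G); auto; try apply An_var. apply An_const. }
  exists (fun x y p => G1 x y p 0), (fun x y p => G2 x y p 0), (fun x y p => G3 x y p 0), H.
  do 3 (split; [now apply Hat0|]). split; [exact HH|]. split.
  - apply near_imp with (2 := near_and _ _ E1 (near_and _ _ E2 (near_and _ _ E3 E4))).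
    intros z [A1 [A2 [A3 A4]]]. rewrite A1, A2, A3, A4, Rplus_0_r. ring.
  - (* differentiate the first expansion at s = 0 *)
    destruct (near_vec _ E1) as [r [Hr V1]].
    assert (D4 := near_pd 3 _ HG1). destruct (near_vec _ D4) as [r' [Hr' V2]].
    assert (D3 := near_pd 2 _ HB).
    assert (Hm : 0 < Rmin r r') by now apply Rmin_pos.
    destruct (near_and _ _ D3 (ex_intro _ (Rmin r r') (conj Hm (fun z Hz => Hz)))) as [s [Hs V3]].
    exists s. split; [exact Hs|]. intros z Hz. destruct (V3 z Hz) as [Dz Hzr].
    set (x := z 0%nat). set (y := z 1%nat). set (p := z 2%nat).
    assert (Hi : forall i, Rabs (z i) < r /\ Rabs (z i) < r').
    { intros i. assert (Hb := box_le _ _ i Hzr). split;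
      [apply Rlt_le_trans with (1 := Hb), Rmin_l | apply Rlt_le_trans with (1 := Hb), Rmin_r]. }
    assert (Rr : Rabs 0 < r') by (rewrite Rabs_R0; lra).
    assert (DG : ex_derive (fun s => G1 x y p s) 0).
    { eexists. apply (V2 [x; y; p; 0]). repeat constructor; try apply Hi. exact Rr. }
    assert (DG' := Derive_correct _ _ DG).
    assert (K : is_derive (fun s => B x y (p + s)) 0 (G1 x y p 0)).
    { apply (D_ext_loc
        (fun s => B x y (p + 0) + s * G1 x y p s)).
      - apply filter_imp with (fun s => Rabs s < r); [|apply locally_abs_ball; rewrite Rabs_R0; lra].
        intros s' Hs'. symmetry. apply (V1 [x; y; p; s']). repeat constructor; try apply Hi. exact Hs'.
      - apply (deriv_val _ _ _ _ (D_plus _ _ _ _ _ (D_const _ _) (D_mult _ _ _ _ _ (D_id 0) DG'))). ring. }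
    assert (Dz' : is_derive (fun t => B x y t) (p + 0) (e3 B x y p)).
    { rewrite Rplus_0_r. exact Dz. }
    assert (Dc : is_derive (fun s => p + s) 0 1) by (auto_derive; [trivial | ring]).
    assert (K2 := D_comp (fun t => B x y t) (fun s => p + s) 0 _ _ Dz' Dc).
    rewrite <- (is_derive_unique _ _ _ K).
    symmetry. etransitivity; [apply (is_derive_unique _ _ _ K2)|]. apply Rmult_1_l.
Qed.

Lemma near_bounded f : An f -> exists M, 0 <= M /\ near (fun z => Rabs (f z) <= M).
Proof.
  intros [r [N Hf]]. exists N. split; [now apply AnS_N_nonneg in Hf|].
  exists r. split; [now apply AnS_pos in Hf|]. intros z. now apply (AnS_bound _ _ _ _ z Hf).
Qed.

(** * The curve of centres *)

Section NormalForm.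
Variables (B B1 B2 B3 : R -> R -> R -> R).
Hypotheses (HB : An3 B) (HB1 : An3 B1) (HB2 : An3 B2) (HB3 : An3 B3).

Definition val (F : R -> R -> R -> R) (z : pt) := F (z 0%nat) (z 1%nat) (z 2%nat).

(** The states of the system, all functions of [t] along the curve [s = 0]: the position
    [(g, h)] of the curve (indices 0, 1), the slope [b] of the solution through it
    (index 2), [gam = g'], the variations [mu] and [nu] of the solution and of its slope
    with [t], the speed [scale] of the parametrization of the solution, [kap = scale'].
    [mu] and [scale] are shifted so that the initial state is the origin. *)
Definition gam (z : pt) := z 3%nat.
Definition mu (z : pt) := 1 + z 4%nat.
Definition nu (z : pt) := z 5%nat.
Definition scale (z : pt) := 1 + z 6%nat.
Definition kap (z : pt) := z 7%nat.
(** The definition of [mu] as a variation at fixed abscissa, [mu = h' - b * g'], solved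
    for [h']; likewise [nu = b' - B * g'] for [b']. *)
Definition dh z := mu z + z 2%nat * gam z.
Definition db z := nu z + val B z * gam z.
(** Derivative of [F] along a solution, with respect to the abscissa. *)
Definition along F z := val (e1 F) z + z 2%nat * val (e2 F) z + val B z * val (e3 F) z.
(** Solution of [defect2 = 0] at [s = 0] for the derivative of [mu]. *)
Definition dmu z := 2 * gam z * (val B1 z * mu z - nu z) - nu z * gam z + val B2 z * mu z ^ 2
  + 2 * mu z * kap z / scale z.
(** Solution of [defect3 = 0] at [s = 0] for the derivative of [gam]. *)
Definition dgam z := - (gam z ^ 2 * (val B1 z * mu z - nu z) - dmu z * gam z
  + val B2 z * mu z ^ 2 * gam z) / mu z - val B3 z * mu z ^ 2.
(** The derivatives at [s = 0] that enter those of the defects: [dtB1] is the [t]-derivative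
    of [B1], [scale * dsn] and [dsw] are the [s]-derivatives of [n] and [w]. *)
Definition dtB1 z := gam z * val (e1 B1) z + dh z * val (e2 B1) z + db z * val (e3 B1) z.
Definition dsn z := val (e2 B) z * mu z + val B1 z * nu z.
Definition dsw z := scale z ^ 2 * (2 * nu z / mu z - val B1 z).
(** The [s]-derivative of [defect2] at [s = 0], as an affine function of the derivative
    [X] of [nu]; its linear coefficient is [- scale ^ 2 + 4 * scale ^ 2]. *)
Definition ds_defect2 X z :=
  2 * dsw z * gam z * (val B1 z * mu z - nu z) + 2 * scale z * kap z * (val B1 z * mu z - nu z)
  + 2 * scale z * gam z * (scale z * along B1 z * mu z + val B1 z * (scale z * nu z) - scale z * dsn z)
  - dsw z * nu z * gam z - scale z * (scale z * dsn z) * gam z - scale z * nu z * kap z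
  - (kap z * nu z + scale z * X) * scale z - dmu z * dsw z
  + scale z * along B2 z * mu z ^ 2 * scale z + val B2 z * (2 * mu z * (scale z * nu z)) * scale z
  + val B2 z * mu z ^ 2 * dsw z + 2 * (scale z * nu z) * kap z
  + 2 * mu z * (2 * scale z * kap z * (2 * nu z / mu z - val B1 z)
     + scale z ^ 2 * (2 * X / mu z - 2 * nu z * dmu z / mu z ^ 2 - dtB1 z)).
Definition dnu z := - ds_defect2 0 z / (3 * scale z ^ 2).
(** The [s]-derivative of [defect3] at [s = 0], as an affine function of the derivative
    [Y] of [kap]. *)
Definition ds_defect3 Y z :=
  2 * gam z * kap z * (val B1 z * mu z - nu z)
  + gam z ^ 2 * (scale z * along B1 z * mu z + val B1 z * (scale z * nu z) - scale z * dsn z)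
  - (kap z * nu z + scale z * dnu z) * gam z - dmu z * kap z
  + scale z * along B2 z * mu z ^ 2 * gam z + val B2 z * (2 * mu z * (scale z * nu z)) * gam z
  + val B2 z * mu z ^ 2 * kap z
  + scale z * along B3 z * mu z ^ 3 + val B3 z * (3 * mu z ^ 2 * (scale z * nu z))
  + scale z * nu z * dgam z + mu z * Y.
Definition dkap z := - ds_defect3 0 z / mu z.

Definition centre_field : nat -> pt -> R := fam [gam; dh; db; dgam; dmu; dnu; kap; dkap].

Lemma An_val F : An3 F -> An (val F).
Proof. trivial. Qed.

Lemma ds_defect2_dnu z : scale z <> 0 -> mu z <> 0 -> ds_defect2 (dnu z) z = 0.
Proof.
  intros Hk Hm.
  assert (E : ds_defect2 (dnu z) z = ds_defect2 0 z + 3 * scale z ^ 2 * dnu z) by (unfold ds_defect2; field; auto).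
  rewrite E. unfold dnu. field. auto.
Qed.

Lemma ds_defect3_dkap z : mu z <> 0 -> ds_defect3 (dkap z) z = 0.
Proof.
  intros Hm.
  assert (E : ds_defect3 (dkap z) z = ds_defect3 0 z + mu z * dkap z) by (unfold ds_defect3; ring).
  rewrite E. unfold dkap. field. auto.
Qed.

Ltac an3 := lazymatch goal with
  | |- An3 (e1 _) => apply An3_e1; an3
  | |- An3 (e2 _) => apply An3_e2; an3
  | |- An3 (e3 _) => apply An3_e3; an3
  | _ => assumption
  end.

Ltac an := lazymatch goal with
  | |- An (fun z => @?f z + @?g z) => apply (An_plus f g); an
  | |- An (fun z => @?f z - @?g z) => apply (An_minus f g); an
  | |- An (fun z => @?f z * @?g z) => apply (An_mult f g); an
  | |- An (fun z => @?f z / @?g z) => apply (An_div f g); [an | an | try assumption]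
  | |- An (fun z => - @?f z) => apply (An_opp f); an
  | |- An (fun z => @?f z ^ ?n) => apply (An_pow f n); an
  | |- An (fun z => val ?F z) => apply (An_val F); an3
  | |- An (fun _ => ?c) => apply An_const
  | |- An (fun z => z ?i) => apply An_var
  | |- An (fun z => ?f z) => change (An f); assumption
  | |- _ => assumption
  end.

Lemma An_gam : An gam. Proof. unfold gam. an. Qed.
Lemma An_mu : An mu. Proof. unfold mu. an. Qed.
Lemma An_nu : An nu. Proof. unfold nu. an. Qed.
Lemma An_scale : An scale. Proof. unfold scale. an. Qed.
Lemma An_kap : An kap. Proof. unfold kap. an. Qed.
Lemma mu_pt0 : mu pt0 <> 0. Proof. unfold mu, pt0. lra. Qed.
Lemma scale_pt0 : scale pt0 <> 0. Proof. unfold scale, pt0. lra. Qed.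

Lemma An_dh : An dh.
Proof. assert (H1 := An_gam). assert (H2 := An_mu). unfold dh. an. Qed.
Lemma An_db : An db.
Proof. assert (H1 := An_gam). assert (H2 := An_nu). unfold db. an. Qed.
Lemma An_along F : An3 F -> An (along F).
Proof. intros HF. unfold along. an. Qed.
Lemma An_dmu : An dmu.
Proof.
  assert (H1 := An_gam). assert (H2 := An_mu). assert (H3 := An_nu). assert (H4 := An_scale).
  assert (H5 := An_kap). assert (H6 := scale_pt0). unfold dmu. an.
Qed.
Lemma An_dgam : An dgam.
Proof.
  assert (H1 := An_gam). assert (H2 := An_mu). assert (H3 := An_nu). assert (H4 := An_dmu).
  assert (H6 := mu_pt0). unfold dgam. an.
Qed.
Lemma An_dsn : An dsn.
Proof. assert (H2 := An_mu). assert (H3 := An_nu). unfold dsn. an. Qed.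
Lemma An_dsw : An dsw.
Proof.
  assert (H2 := An_mu). assert (H3 := An_nu). assert (H4 := An_scale). assert (H6 := mu_pt0). unfold dsw. an.
Qed.
Lemma An_dtB1 : An dtB1.
Proof. assert (H1 := An_gam). assert (H2 := An_dh). assert (H3 := An_db). unfold dtB1. an. Qed.
Lemma An_ds_defect2 X : An X -> An (fun z => ds_defect2 (X z) z).
Proof.
  intros HX. assert (H1 := An_gam). assert (H2 := An_mu). assert (H3 := An_nu). assert (H4 := An_scale).
  assert (H5 := An_kap). assert (H6 := mu_pt0). assert (H7 := An_dmu). assert (H8 := An_dsn).
  assert (H9 := An_dsw). assert (H10 := An_dtB1). assert (H11 := An_along B1 HB1).
  assert (H12 := An_along B2 HB2).
  assert (H13 : mu pt0 ^ 2 <> 0) by now apply pow_nonzero.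
  unfold ds_defect2. an.
Qed.
Lemma An_dnu : An dnu.
Proof.
  assert (H1 := An_ds_defect2 (fun _ => 0) (An_const 0)). assert (H2 := An_scale).
  assert (H3 : 3 * scale pt0 ^ 2 <> 0).
  { apply Rmult_integral_contrapositive_currified; [lra | apply pow_nonzero, scale_pt0]. }
  unfold dnu. an.
Qed.
Lemma An_ds_defect3 : An (ds_defect3 0).
Proof.
  assert (H1 := An_gam). assert (H2 := An_mu). assert (H3 := An_nu). assert (H4 := An_scale).
  assert (H5 := An_kap). assert (H7 := An_dmu). assert (H8 := An_dsn).
  assert (H9 := An_dnu). assert (H10 := An_dgam). assert (H11 := An_along B1 HB1).
  assert (H12 := An_along B2 HB2). assert (H13 := An_along B3 HB3).
  unfold ds_defect3. an.
Qed.
Lemma An_dkap : An dkap.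
Proof. assert (H1 := An_ds_defect3). assert (H2 := An_mu). assert (H3 := mu_pt0). unfold dkap. an. Qed.

Lemma centre_exists : exists T : nat -> R -> R,
  (forall i, An1 (T i)) /\ (forall i, T i 0 = 0) /\
  near (fun z => forall i, is_derive (T i) (z 0%nat) (centre_field i (fun j => T j (z 0%nat)))).
Proof.
  destruct (analytic_flow centre_field (fun _ _ => 0)) as [u [Hu [Hu0 [_ Hud]]]].
  - apply AnF_fam.
    repeat (apply List.Forall_cons || apply List.Forall_nil).
    + apply An_gam. + apply An_dh. + apply An_db. + apply An_dgam.
    + apply An_dmu. + apply An_dnu. + apply An_kap. + apply An_dkap.
  - exists 1, 0. intros i. apply AnS_zero. lra.
  - reflexivity.
  - reflexivity.
  - exists (fun i t => u i (vec [t])). split; [|split].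
    + intros i. apply (An_comp_vec (u i) [fun z => z 0%nat]).
      * now apply An_of_AnF.
      * repeat constructor. apply An_var.
      * repeat constructor.
    + intros i. replace (vec [0]) with pt0; [apply Hu0|]. symmetry. apply vec_pt0. repeat constructor.
    + assert (H := near_comp_vec _ [fun z => z 0%nat] Hud).
      apply near_imp with (2 := H ltac:(repeat constructor; apply An_var) ltac:(repeat constructor)).
      intros z Hz i. specialize (Hz i).
      apply is_derive_ext with (2 := Hz). intros t. f_equal.
      apply functional_extensionality. intros [|[|j]]; reflexivity.
Qed.

(** * Coordinates adapted to a family of solutions *)

(** The states are [xi], [eta], the slope [q], [w - 1], [m - 1] and [n].  The first three
    equations say that [s -> (xi, eta)] parametrizes a solution with speed [w], the last
    two are its equation of variations for [(m, n)].  The equation for [w] is the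
    condition that the transformed equation has no term linear in the slope. *)
Definition frame_field : nat -> pt -> R := fam
  [fun z => 1 + z 3%nat;
   fun z => z 2%nat * (1 + z 3%nat);
   fun z => val B z * (1 + z 3%nat);
   fun z => (1 + z 3%nat) ^ 2 * (2 * z 5%nat / (1 + z 4%nat) - val B1 z);
   fun z => (1 + z 3%nat) * z 5%nat;
   fun z => (1 + z 3%nat) * (val (e2 B) z * (1 + z 4%nat) + val B1 z * z 5%nat)].

Lemma AnF_frame : AnF frame_field.
Proof.
  apply AnF_fam. repeat (apply List.Forall_cons || apply List.Forall_nil); an.
  unfold pt0; lra.
Qed.

Lemma frame_exists (T : nat -> R -> R) : (forall i, An1 (T i)) -> (forall i, T i 0 = 0) ->
  exists xi eta q w m n : R -> R -> R,
   (An2 xi /\ An2 eta /\ An2 q /\ An2 w /\ An2 m /\ An2 n) /\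
   (xi 0 0 = 0 /\ eta 0 0 = 0 /\ q 0 0 = 0 /\ w 0 0 = 1 /\ m 0 0 = 1 /\ n 0 0 = 0) /\
   near (fun z => xi 0 (z 0%nat) = T 0%nat (z 0%nat) /\ eta 0 (z 0%nat) = T 1%nat (z 0%nat) /\
      q 0 (z 0%nat) = T 2%nat (z 0%nat) /\ w 0 (z 0%nat) = 1 + T 6%nat (z 0%nat) /\
      m 0 (z 0%nat) = 1 + T 4%nat (z 0%nat) /\ n 0 (z 0%nat) = T 5%nat (z 0%nat)) /\
   near (fun z => let s := z 0%nat in let t := z 1%nat in
      d1 xi s t = w s t /\ d1 eta s t = q s t * w s t /\
      d1 q s t = B (xi s t) (eta s t) (q s t) * w s t /\
      d1 w s t = w s t ^ 2 * (2 * n s t / m s t - B1 (xi s t) (eta s t) (q s t)) /\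
      d1 m s t = w s t * n s t /\
      d1 n s t = w s t * (e2 B (xi s t) (eta s t) (q s t) * m s t
                           + B1 (xi s t) (eta s t) (q s t) * n s t)).
Proof.
  intros HT HT0.
  set (T1 := fun i (z : pt) => T i (z 1%nat)).
  assert (HT1 : forall i, An (T1 i)).
  { intros i. apply (An_comp1 (T i)); [apply HT | apply An_var | reflexivity]. }
  assert (HT10 : forall i, T1 i pt0 = 0) by (intros i; apply HT0).
  destruct (analytic_flow frame_field
     (fam [T1 0; T1 1; T1 2; T1 6; T1 4; T1 5]%nat)) as [u [Hu [Hu0 [Hui Hud]]]].
  { apply AnF_frame. }
  { apply AnF_fam. repeat constructor; apply HT1. }
  { apply fam_pt0. repeat constructor; apply HT10. }
  { reflexivity. }
  set (V := fun i s t => u i (vec [s; t])).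
  assert (HV : forall i, An2 (V i)).
  { intros i. apply (An_comp_vec (u i) [fun z => z 0%nat; fun z => z 1%nat]).
    - now apply An_of_AnF.
    - repeat constructor; apply An_var.
    - repeat constructor. }
  assert (HV0 : forall i, V i 0 0 = 0).
  { intros i. unfold V. replace (vec [0; 0]) with pt0; [apply Hu0|]. symmetry. apply vec_pt0. repeat constructor. }
  assert (HVd : near (fun z => forall i, d1 (V i) (z 0%nat) (z 1%nat) =
     frame_field i (fun j => V j (z 0%nat) (z 1%nat)))).
  { assert (H := near_comp_vec _ [fun z => z 0%nat; fun z => z 1%nat] Hud).
    apply near_imp with (2 := H ltac:(repeat constructor; apply An_var) ltac:(repeat constructor)).
    intros z Hz i. specialize (Hz i). apply is_derive_unique.
    apply is_derive_ext with (2 := Hz). intros t. unfold V. f_equal.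
    apply functional_extensionality. intros [|[|[|j]]]; reflexivity. }
  exists (V 0%nat), (V 1%nat), (V 2%nat), (fun s t => 1 + V 3%nat s t),
    (fun s t => 1 + V 4%nat s t), (V 5%nat).
  assert (H1 : forall i, An2 (fun s t => 1 + V i s t)).
  { intros i. apply An_plus; [apply An_const | apply HV]. }
  split; [|split; [|split]].
  - repeat split; (apply HV || apply H1).
  - repeat split; rewrite ?HV0; ring.
  - assert (H := near_comp_vec _ [fun _ => 0; fun z => z 0%nat] Hui).
    apply near_imp with (2 := H ltac:(repeat constructor; [apply An_const | apply An_var]) ltac:(repeat constructor)).
    intros z Hz.
    assert (Hz' : forall i, V i 0 (z 0%nat) = fam [T1 0; T1 1; T1 2; T1 6; T1 4; T1 5]%nat i (vec [0; z 0%nat])).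
    { intros i. specialize (Hz i). cbn [map] in Hz. rewrite <- Hz. unfold V. f_equal.
      apply functional_extensionality. intros [|[|[|j]]]; reflexivity. }
    split; [exact (Hz' 0%nat)|]. split; [exact (Hz' 1%nat)|]. split; [exact (Hz' 2%nat)|].
    split; [f_equal; exact (Hz' 3%nat)|]. split; [f_equal; exact (Hz' 4%nat) | exact (Hz' 5%nat)].
  - assert (D1 : forall i s t, d1 (fun s t => 1 + V i s t) s t = d1 (V i) s t).
    { intros i s t. unfold d1.
      destruct (Classical_Prop.classic (ex_derive (fun t0 => V i t0 t) s)) as [He|He].
      - rewrite Derive_plus; [rewrite Derive_const; ring | apply ex_derive_const | exact He].
      - unfold Derive. f_equal. apply Lim_ext. intros y. f_equal. ring. }
    apply near_imp with (2 := HVd). intros z Hz s t.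
    split; [exact (Hz 0%nat)|]. split; [exact (Hz 1%nat)|]. split; [exact (Hz 2%nat)|].
    split; [rewrite D1; exact (Hz 3%nat)|]. split; [rewrite D1; exact (Hz 4%nat) | exact (Hz 5%nat)].
Qed.
End NormalForm.

(** * The equation in the new coordinates *)

Section Frame.
Variables (B B1 B2 B3 : R -> R -> R -> R).
Hypotheses (HB : An3 B) (HB1 : An3 B1) (HB2 : An3 B2) (HB3 : An3 B3).
Hypothesis (HB1e : near (fun z => e3 B (z 0%nat) (z 1%nat) (z 2%nat) = B1 (z 0%nat) (z 1%nat) (z 2%nat))).
Variables (xi eta q w m n : R -> R -> R).
Hypotheses (Axi : An2 xi) (Aeta : An2 eta) (Aq : An2 q) (Aw : An2 w) (Am : An2 m) (An_n : An2 n).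
Hypotheses (xi0 : xi 0 0 = 0) (eta0 : eta 0 0 = 0) (q0 : q 0 0 = 0) (w0 : w 0 0 = 1) (m0 : m 0 0 = 1) (n0 : n 0 0 = 0).
Hypothesis Hs : near (fun z => let s := z 0%nat in let t := z 1%nat in
      d1 xi s t = w s t /\ d1 eta s t = q s t * w s t /\
      d1 q s t = B (xi s t) (eta s t) (q s t) * w s t /\
      d1 w s t = w s t ^ 2 * (2 * n s t / m s t - B1 (xi s t) (eta s t) (q s t)) /\
      d1 m s t = w s t * n s t /\
      d1 n s t = w s t * (e2 B (xi s t) (eta s t) (q s t) * m s t
                           + B1 (xi s t) (eta s t) (q s t) * n s t)).
Variable T : nat -> R -> R.
Hypothesis (HT0 : forall i, T i 0 = 0) (HTA : forall i, An1 (T i)).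
Hypothesis HTd : near (fun z => forall i, is_derive (T i) (z 0%nat)
   (centre_field B B1 B2 B3 i (fun j => T j (z 0%nat)))).
Hypothesis Hb : near (fun z => xi 0 (z 0%nat) = T 0%nat (z 0%nat) /\ eta 0 (z 0%nat) = T 1%nat (z 0%nat) /\
      q 0 (z 0%nat) = T 2%nat (z 0%nat) /\ w 0 (z 0%nat) = 1 + T 6%nat (z 0%nat) /\
      m 0 (z 0%nat) = 1 + T 4%nat (z 0%nat) /\ n 0 (z 0%nat) = T 5%nat (z 0%nat)).

Definition pullback (F : R -> R -> R -> R) s t := F (xi s t) (eta s t) (q s t).

Lemma An2_pullback F : An3 F -> An2 (pullback F).
Proof. intros HF. apply (An_comp3 F); assumption. Qed.

Lemma pullback_derive F : An3 F -> near (fun z => let s := z 0%nat in let t := z 1%nat in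
  is_derive (fun s => pullback F s t) s
    (w s t * (pullback (e1 F) s t + q s t * pullback (e2 F) s t + pullback B s t * pullback (e3 F) s t)) /\
  is_derive (fun t => pullback F s t) t
    (d2 xi s t * pullback (e1 F) s t + d2 eta s t * pullback (e2 F) s t + d2 q s t * pullback (e3 F) s t)).
Proof.
  intros HF. destruct (chain3 F HF) as [r [Hr C]].
  apply near_imp with (2 := near_and _ _ Hs (near_and _ _ (An_small _ r Axi xi0 Hr)
    (near_and _ _ (An_small _ r Aeta eta0 Hr) (near_and _ _ (An_small _ r Aq q0 Hr)
    (near_and _ _ (near_d xi Axi) (near_and _ _ (near_d eta Aeta) (near_d q Aq))))))).
  intros z [[S1 [S2 [S3 _]]] [L1 [L2 [L3 [[X1 X2] [[E1 E2] [Q1 Q2]]]]]]] s t.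
  rewrite S1 in X1. rewrite S2 in E1. rewrite S3 in Q1. split.
  - apply (deriv_val _ _ _ _ (C (fun s => xi s t) (fun s => eta s t) (fun s => q s t) s _ _ _ L1 L2 L3 X1 E1 Q1)).
    unfold pullback, s, t. ring.
  - exact (C (fun t => xi s t) (fun t => eta s t) (fun t => q s t) t _ _ _ L1 L2 L3 X2 E2 Q2).
Qed.

(** Schwarz's theorem turns an equation for [d1 F] into an evolution equation of [d2 F]. *)
Lemma mixed_val F (K K' : R -> R -> R) : An2 F ->
  near (fun z => d1 F (z 0%nat) (z 1%nat) = K (z 0%nat) (z 1%nat)) ->
  near (fun z => is_derive (fun t => K (z 0%nat) t) (z 1%nat) (K' (z 0%nat) (z 1%nat))) ->
  near (fun z => is_derive (fun s => d2 F s (z 1%nat)) (z 0%nat) (K' (z 0%nat) (z 1%nat))).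
Proof.
  intros HF E HK.
  apply near_imp with (2 := near_and _ _ (near_mixed F HF) (near_and _ _ (near_pd_ext 1 _ _ E)
     (near_and _ _ HK (near_d (d2 F) (An2_d2 F HF))))).
  intros z [M [P [D [D1 _]]]]. apply (deriv_val _ _ _ _ D1). rewrite M.
  etransitivity; [exact P|]. now apply is_derive_unique.
Qed.

Definition nonzero := near_and _ _ (near_neq0 _ Aw ltac:(cbn; unfold pt0; rewrite w0; lra))
   (near_neq0 _ Am ltac:(cbn; unfold pt0; rewrite m0; lra)).

Lemma frame_derivatives : near (fun z => let s := z 0%nat in let t := z 1%nat in
  (w s t <> 0 /\ m s t <> 0) /\
  (is_derive (fun s => xi s t) s (w s t) /\ is_derive (fun t => xi s t) t (d2 xi s t)) /\
  (is_derive (fun s => eta s t) s (q s t * w s t) /\ is_derive (fun t => eta s t) t (d2 eta s t)) /\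
  (is_derive (fun s => q s t) s (pullback B s t * w s t) /\ is_derive (fun t => q s t) t (d2 q s t)) /\
  (is_derive (fun s => w s t) s (w s t ^ 2 * (2 * n s t / m s t - pullback B1 s t)) /\ is_derive (fun t => w s t) t (d2 w s t)) /\
  (is_derive (fun s => m s t) s (w s t * n s t) /\ is_derive (fun t => m s t) t (d2 m s t)) /\
  (is_derive (fun s => n s t) s (w s t * (pullback (e2 B) s t * m s t + pullback B1 s t * n s t)) /\
   is_derive (fun t => n s t) t (d2 n s t))).
Proof.
  apply near_imp with (2 := near_and _ _ Hs (near_and _ _ nonzero (near_and _ _ (near_d xi Axi)
    (near_and _ _ (near_d eta Aeta) (near_and _ _ (near_d q Aq) (near_and _ _ (near_d w Aw)
    (near_and _ _ (near_d m Am) (near_d n An_n)))))))).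
  intros z [[S1 [S2 [S3 [S4 [S5 S6]]]]] [NZ [X [E [Q [W [M N]]]]]]] s t.
  rewrite S1 in X. rewrite S2 in E. rewrite S3 in Q. rewrite S4 in W. rewrite S5 in M. rewrite S6 in N.
  exact (conj NZ (conj X (conj E (conj Q (conj W (conj M N)))))).
Qed.

Lemma frame_mixed_derivatives : near (fun z => let s := z 0%nat in let t := z 1%nat in
  is_derive (fun s => d2 xi s t) s (d2 w s t) /\
  is_derive (fun s => d2 eta s t) s (d2 q s t * w s t + q s t * d2 w s t) /\
  is_derive (fun s => d2 q s t) s
    ((d2 xi s t * pullback (e1 B) s t + d2 eta s t * pullback (e2 B) s t + d2 q s t * pullback (e3 B) s t) * w s t
       + pullback B s t * d2 w s t) /\
  is_derive (fun s => d2 m s t) s (d2 w s t * n s t + w s t * d2 n s t) /\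
  is_derive (fun s => d2 w s t) s
    (2 * w s t * d2 w s t * (2 * n s t / m s t - pullback B1 s t)
     + w s t ^ 2 * (2 * d2 n s t / m s t - 2 * n s t * d2 m s t / m s t ^ 2
        - (d2 xi s t * pullback (e1 B1) s t + d2 eta s t * pullback (e2 B1) s t + d2 q s t * pullback (e3 B1) s t))) /\
  is_derive (fun s => d2 (d2 xi) s t) s (d2 (d2 w) s t)).
Proof.
  assert (M1 : near (fun z => is_derive (fun s => d2 xi s (z 1%nat)) (z 0%nat) (d2 w (z 0%nat) (z 1%nat)))).
  { apply (mixed_val xi w); [exact Axi | | ].
    - apply near_imp with (2 := Hs). intros z H. apply H.
    - apply near_imp with (2 := frame_derivatives). intros z H. apply H. }
  cbv zeta.
  refine (near_and _ _ M1 (near_and _ _ _ (near_and _ _ _ (near_and _ _ _ (near_and _ _ _ _))))).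
  - apply (mixed_val eta (fun s t => q s t * w s t) (fun s t => d2 q s t * w s t + q s t * d2 w s t)).
    + exact Aeta.
    + apply near_imp with (2 := Hs). intros z H. apply H.
    + apply near_imp with (2 := frame_derivatives). intros z [NZ [X [E [[Q1 Q2] [[W1 W2] [M N]]]]]].
      apply D_mult; assumption.
  - apply (mixed_val q (fun s t => pullback B s t * w s t) (fun s t =>
      (d2 xi s t * pullback (e1 B) s t + d2 eta s t * pullback (e2 B) s t + d2 q s t * pullback (e3 B) s t) * w s t
       + pullback B s t * d2 w s t)).
    + exact Aq.
    + apply near_imp with (2 := Hs). intros z H. apply H.
    + apply near_imp with (2 := near_and _ _ frame_derivatives (pullback_derive B HB)).
      intros z [[NZ [X [E [[Q1 Q2] [[W1 W2] [M N]]]]]] [_ PB]].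
      apply D_mult; assumption.
  - apply (mixed_val m (fun s t => w s t * n s t) (fun s t => d2 w s t * n s t + w s t * d2 n s t)).
    + exact Am.
    + apply near_imp with (2 := Hs). intros z H. apply H.
    + apply near_imp with (2 := frame_derivatives). intros z [NZ [X [E [Q [[W1 W2] [M [N1 N2]]]]]]].
      apply D_mult; assumption.
  - apply (mixed_val w (fun s t => w s t ^ 2 * (2 * n s t / m s t - pullback B1 s t)) (fun s t =>
      2 * w s t * d2 w s t * (2 * n s t / m s t - pullback B1 s t)
     + w s t ^ 2 * (2 * d2 n s t / m s t - 2 * n s t * d2 m s t / m s t ^ 2
        - (d2 xi s t * pullback (e1 B1) s t + d2 eta s t * pullback (e2 B1) s t + d2 q s t * pullback (e3 B1) s t)))).
    + exact Aw.
    + apply near_imp with (2 := Hs). intros z H. apply H.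
    + apply near_imp with (2 := near_and _ _ frame_derivatives (pullback_derive B1 HB1)).
      intros z [[[NZ1 NZ2] [X [E [Q [[W1 W2] [[M1' M2] [N1 N2]]]]]]] [_ PB]].
      eapply deriv_val; [der|]. field. exact NZ2.
  - apply (mixed_val (d2 xi) (d2 w) (d2 (d2 w))).
    + now apply An2_d2.
    + apply near_imp with (2 := M1). intros z H. now apply is_derive_unique.
    + apply near_imp with (2 := near_d (d2 w) (An2_d2 w Aw)). intros z H. apply H.
Qed.

Lemma at_s0 (P : pt -> Prop) : near P -> near (fun z => P (vec [0; z 0%nat])).
Proof.
  intros H. apply (near_comp_vec P [fun _ => 0; fun z => z 0%nat] H).
  - repeat constructor; [apply An_const | apply An_var].
  - repeat constructor.
Qed.

Lemma boundary_t F (f f' : R -> R) :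
  near (fun z => F 0 (z 0%nat) = f (z 0%nat)) ->
  near (fun z => is_derive f (z 0%nat) (f' (z 0%nat))) ->
  near (fun z => d2 F 0 (z 0%nat) = f' (z 0%nat)).
Proof.
  intros E D. apply near_imp with (2 := near_and _ _ (near_pd_ext 0 _ _ E) D).
  intros z [H1 H2]. etransitivity; [exact H1|]. now apply is_derive_unique.
Qed.

Let cp (t : R) : pt := fun j => T j t.

Lemma boundary : near (fun z => let t := z 0%nat in
  (xi 0 t = cp t 0%nat /\ eta 0 t = cp t 1%nat /\ q 0 t = cp t 2%nat /\
   w 0 t = scale (cp t) /\ m 0 t = mu (cp t) /\ n 0 t = nu (cp t)) /\
  d2 xi 0 t = gam (cp t) /\ d2 eta 0 t = dh (cp t) /\ d2 q 0 t = db B (cp t) /\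
  d2 w 0 t = kap (cp t) /\ d2 m 0 t = dmu B1 B2 (cp t) /\ d2 n 0 t = dnu B B1 B2 (cp t) /\
  d2 (d2 xi) 0 t = dgam B1 B2 B3 (cp t) /\ d2 (d2 w) 0 t = dkap B B1 B2 B3 (cp t)).
Proof.
  assert (DT : forall i, near (fun z => is_derive (T i) (z 0%nat) (centre_field B B1 B2 B3 i (cp (z 0%nat))))).
  { intros i. apply near_imp with (2 := HTd). intros z H. apply H. }
  assert (DT1 : forall i, near (fun z => is_derive (fun t => 1 + T i t) (z 0%nat) (centre_field B B1 B2 B3 i (cp (z 0%nat))))).
  { intros i. apply near_imp with (2 := DT i). intros z H.
    apply (deriv_val _ _ _ _ (D_plus _ _ _ _ _ (D_const 1 _) H)). ring. }
  assert (Ex : near (fun z => d2 xi 0 (z 0%nat) = T 3%nat (z 0%nat))).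
  { apply (boundary_t xi (T 0%nat) (T 3%nat)).
    - apply near_imp with (2 := Hb). intros z H. apply H.
    - exact (DT 0%nat). }
  assert (Ew : near (fun z => d2 w 0 (z 0%nat) = T 7%nat (z 0%nat))).
  { apply (boundary_t w (fun t => 1 + T 6%nat t) (T 7%nat)).
    - apply near_imp with (2 := Hb). intros z H. apply H.
    - exact (DT1 6%nat). }
  apply near_and; [exact Hb|].
  repeat apply near_and.
  - exact Ex.
  - apply (boundary_t eta (T 1%nat) (fun t => dh (cp t))).
    + apply near_imp with (2 := Hb). intros z H. apply H.
    + exact (DT 1%nat).
  - apply (boundary_t q (T 2%nat) (fun t => db B (cp t))).
    + apply near_imp with (2 := Hb). intros z H. apply H.
    + exact (DT 2%nat).
  - exact Ew.
  - apply (boundary_t m (fun t => 1 + T 4%nat t) (fun t => dmu B1 B2 (cp t))).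
    + apply near_imp with (2 := Hb). intros z H. apply H.
    + exact (DT1 4%nat).
  - apply (boundary_t n (T 5%nat) (fun t => dnu B B1 B2 (cp t))).
    + apply near_imp with (2 := Hb). intros z H. apply H.
    + exact (DT 5%nat).
  - apply (boundary_t (d2 xi) (T 3%nat) (fun t => dgam B1 B2 B3 (cp t))); [exact Ex | exact (DT 3%nat)].
  - apply (boundary_t (d2 w) (T 7%nat) (fun t => dkap B B1 B2 B3 (cp t))); [exact Ew | exact (DT 7%nat)].
Qed.

(** [m] and [n] are the variations of the solution and of its slope with [t], at fixed
    abscissa: both sides satisfy the same linear system in [s], with the same values
    at [s = 0]. *)
Lemma consistency : near (fun z => let s := z 0%nat in let t := z 1%nat in
  m s t = d2 eta s t - q s t * d2 xi s t /\ n s t = d2 q s t - pullback B s t * d2 xi s t).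
Proof.
  assert (AB1 := An2_pullback B1 HB1). assert (AB2 := An2_pullback (e2 B) (An3_e2 B HB)).
  destruct (near_bounded _ AB1) as [M1 [HM1 N1]]. destruct (near_bounded _ AB2) as [M2 [HM2 N2]].
  destruct (near_bounded _ Aw) as [M3 [HM3 N3]].
  assert (HE : near (fun z => e3 B (xi (z 0%nat) (z 1%nat)) (eta (z 0%nat) (z 1%nat)) (q (z 0%nat) (z 1%nat))
      = B1 (xi (z 0%nat) (z 1%nat)) (eta (z 0%nat) (z 1%nat)) (q (z 0%nat) (z 1%nat)))).
  { apply (near_comp_vec _ [fun z => xi (z 0%nat) (z 1%nat); fun z => eta (z 0%nat) (z 1%nat);
      fun z => q (z 0%nat) (z 1%nat)] HB1e); repeat constructor; assumption. }
  destruct (near_and _ _ frame_derivatives (near_and _ _ frame_mixed_derivatives (near_and _ _ (pullback_derive B HB)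
     (near_and _ _ N1 (near_and _ _ N2 (near_and _ _ N3 HE)))))) as [r1 [Hr1 Hall]].
  destruct boundary as [r2 [Hr2 Hbd]].
  set (r := Rmin r1 r2). assert (Hr : 0 < r) by now apply Rmin_pos.
  exists r. split; [exact Hr|]. intros z Hz. set (t := z 1%nat).
  set (C := M3 * (1 + M1 + M2)).
  assert (G := gronwall (fun s => m s t - (d2 eta s t - q s t * d2 xi s t))
                        (fun s => n s t - (d2 q s t - pullback B s t * d2 xi s t)) r C).
  cbv beta in G.
  assert (Ht : Rabs t < r) by now apply box_le.
  destruct (G) with (x := z 0%nat) as [G1 G2].
  - destruct (Hbd (vec [t])) as [[X [E [Q [W [M N]]]]] [X' [E' _]]].
    { apply box_vec; [exact Hr2|]. repeat constructor. apply Rlt_le_trans with (1 := Ht), Rmin_r. }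
    unfold vec in *; cbn in *. rewrite M, E', Q, X'. unfold dh. ring.
  - destruct (Hbd (vec [t])) as [[X [E [Q [W [M N]]]]] [X' [E' [Q' _]]]].
    { apply box_vec; [exact Hr2|]. repeat constructor. apply Rlt_le_trans with (1 := Ht), Rmin_r. }
    unfold vec, pullback in *; cbn in *. rewrite N, Q', X', X, E, Q. unfold db, val. ring.
  - intros s Hss.
    destruct (Hall (vec [s; t])) as [F [MX [PB [L1 [L2 [L3 HEB]]]]]].
    { apply box_vec; [exact Hr1|]. repeat constructor;
      [apply Rlt_le_trans with (1 := Hss), Rmin_l | apply Rlt_le_trans with (1 := Ht), Rmin_l]. }
    unfold vec in F, MX, PB, L1, L2, L3, HEB; cbn in F, MX, PB, L1, L2, L3, HEB.
    destruct F as [[NZ1 NZ2] [[X1 X2] [[E1 E2] [[Q1 Q2] [[W1 W2] [[M1' M2'] [N1' N2']]]]]]].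
    destruct MX as [MX [ME [MQ _]]]. destruct PB as [PB _].
    change (e3 B (xi s t) (eta s t) (q s t)) with (pullback (e3 B) s t) in HEB.
    change (B1 (xi s t) (eta s t) (q s t)) with (pullback B1 s t) in HEB.
    rewrite HEB in *.
    exists (w s t * (n s t - (d2 q s t - pullback B s t * d2 xi s t))),
      (w s t * (pullback (e2 B) s t * (m s t - (d2 eta s t - q s t * d2 xi s t))
         + pullback B1 s t * (n s t - (d2 q s t - pullback B s t * d2 xi s t)))).
    split; [|split; [|split]].
    + eapply deriv_val; [der|]. ring.
    + eapply deriv_val; [der|]. ring.
    + set (a := m s t - (d2 eta s t - q s t * d2 xi s t)).
      set (b := n s t - (d2 q s t - pullback B s t * d2 xi s t)).
      assert (Ha := Rabs_pos a). assert (Hbb := Rabs_pos b).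
      rewrite Rabs_mult. apply Rle_trans with (M3 * Rabs b); [apply Rmult_le_compat_r; assumption|].
      unfold C. rewrite Rmult_assoc. apply Rmult_le_compat_l; [exact HM3|]. nra.
    + set (a := m s t - (d2 eta s t - q s t * d2 xi s t)).
      set (b := n s t - (d2 q s t - pullback B s t * d2 xi s t)).
      assert (Ha := Rabs_pos a). assert (Hbb := Rabs_pos b).
      rewrite Rabs_mult. unfold C. rewrite Rmult_assoc.
      apply Rmult_le_compat; [apply Rabs_pos | apply Rabs_pos | exact L3 |].
      apply Rle_trans with (1 := Rabs_triang _ _). rewrite !Rabs_mult.
      apply Rle_trans with (M2 * Rabs a + M1 * Rabs b).
      * apply Rplus_le_compat; apply Rmult_le_compat_r; assumption.
      * nra.
  - now apply box_le.
  - cbn. split; [apply Rminus_diag_uniq in G1; exact G1 | apply Rminus_diag_uniq in G2; exact G2].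
Qed.

(** Up to the factor [m * w], the coefficients of the second and third power of the slope
    in the transformed equation. *)
Definition defect2 s t := 2 * w s t * d2 xi s t * (pullback B1 s t * m s t - n s t) - w s t * n s t * d2 xi s t
  - d2 m s t * w s t + pullback B2 s t * m s t ^ 2 * w s t + 2 * m s t * d2 w s t.
Definition defect3 s t := d2 xi s t ^ 2 * (pullback B1 s t * m s t - n s t) - d2 m s t * d2 xi s t
  + pullback B2 s t * m s t ^ 2 * d2 xi s t + pullback B3 s t * m s t ^ 3 + m s t * d2 (d2 xi) s t.

Ltac an2 := lazymatch goal with
  | |- An (fun z => @?f z + @?g z) => apply (An_plus f g); an2
  | |- An (fun z => @?f z - @?g z) => apply (An_minus f g); an2
  | |- An (fun z => @?f z * @?g z) => apply (An_mult f g); an2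
  | |- An (fun z => @?f z ^ ?k) => apply (An_pow f k); an2
  | |- An (fun z => d2 (d2 ?f) (z 0%nat) (z 1%nat)) => apply (An2_d2 (d2 f)); apply (An2_d2 f); assumption
  | |- An (fun z => d2 ?f (z 0%nat) (z 1%nat)) => apply (An2_d2 f); assumption
  | |- An (fun z => pullback ?F (z 0%nat) (z 1%nat)) => apply (An2_pullback F); assumption
  | |- An (fun _ => ?c) => apply An_const
  | |- _ => assumption
  end.

Lemma An2_defect2 : An2 defect2. Proof. unfold An2, defect2. an2. Qed.
Lemma An2_defect3 : An2 defect3. Proof. unfold An2, defect3. an2. Qed.

(** This is how [dmu] and [dgam] were chosen. *)
Lemma defects_boundary : near (fun z => let t := z 0%nat in defect2 0 t = 0 /\ defect3 0 t = 0).
Proof.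
  apply near_imp with (2 := near_and _ _ boundary (at_s0 _ nonzero)).
  intros z [[[X [E [Q [W [M N]]]]] [X' [E' [Q' [W' [M' [N' [X'' W'']]]]]]]] [NZ1 NZ2]] t.
  unfold vec in NZ1, NZ2; cbn in NZ1, NZ2.
  unfold defect2, defect3, pullback. unfold t. rewrite X, E, Q, W, M, N, X', W', M', X''.
  rewrite W in NZ1. rewrite M in NZ2.
  set (z0 := cp (z 0%nat)) in *.
  change (B1 (z0 0%nat) (z0 1%nat) (z0 2%nat)) with (val B1 z0).
  change (B2 (z0 0%nat) (z0 1%nat) (z0 2%nat)) with (val B2 z0).
  change (B3 (z0 0%nat) (z0 1%nat) (z0 2%nat)) with (val B3 z0).
  split.
  - unfold dmu. field. assumption.
  - unfold dgam. field. assumption.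
Qed.

(** This is how [dnu] and [dkap] were chosen. *)
Lemma defects_derive_boundary : near (fun z => let t := z 0%nat in d1 defect2 0 t = 0 /\ d1 defect3 0 t = 0).
Proof.
  apply near_imp with (2 := near_and _ _ boundary (near_and _ _ (at_s0 _ frame_derivatives) (near_and _ _ (at_s0 _ frame_mixed_derivatives)
    (near_and _ _ (at_s0 _ (pullback_derive B1 HB1)) (near_and _ _ (at_s0 _ (pullback_derive B2 HB2))
       (at_s0 _ (pullback_derive B3 HB3))))))).
  intros z [[[X [E [Q [W [M N]]]]] [X' [E' [Q' [W' [M' [N' [X'' W'']]]]]]]] [F [MX [[P1 _] [[P2 _] [P3 _]]]]]] t.
  unfold vec in F, MX, P1, P2, P3; cbn in F, MX, P1, P2, P3.
  fold t in X, E, Q, W, M, N, X', E', Q', W', M', N', X'', W''.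
  fold t in F, MX, P1, P2, P3.
  destruct F as [[NZ1 NZ2] [[X1 X2] [[E1 E2] [[Q1 Q2] [[W1 W2] [[M1 M2] [N1 N2]]]]]]].
  destruct MX as [MXX [ME [MQ [MM [MW MXX2]]]]].
  set (z0 := cp t) in *.
  assert (V : forall F, pullback F 0 t = val F z0).
  { intros F. unfold pullback. now rewrite X, E, Q. }
  assert (K := ds_defect2_dnu B B1 B2 z0). assert (K' := ds_defect3_dkap B B1 B2 B3 z0).
  rewrite <- W, <- M in K. rewrite <- M in K'. specialize (K NZ1 NZ2). specialize (K' NZ2).
  split.
  - apply is_derive_unique. unfold defect2.
    eapply deriv_val; [der|].
    rewrite !V, X', E', Q', W', M', N', W, M, N, Q.
    rewrite M in NZ2.
    transitivity (ds_defect2 B B1 B2 (dnu B B1 B2 z0) z0); [| exact K].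
    unfold ds_defect2, along, dsn, dtB1, dsw. change (z0 2%nat) with (cp t 2%nat). field. exact NZ2.
  - apply is_derive_unique. unfold defect3.
    eapply deriv_val; [der|].
    rewrite !V, X', W', M', N', X'', W'', W, M, N, Q.
    transitivity (ds_defect3 B B1 B2 B3 (dkap B B1 B2 B3 z0) z0); [| exact K'].
    unfold ds_defect3, along, dsn. ring.
Qed.

(** Hadamard's lemma twice. *)
Lemma divide_s2 F : An2 F -> near (fun z => F 0 (z 0%nat) = 0) -> near (fun z => d1 F 0 (z 0%nat) = 0) ->
  exists G, An2 G /\ near (fun z => F (z 0%nat) (z 1%nat) = z 0%nat ^ 2 * G (z 0%nat) (z 1%nat)).
Proof.
  intros HF F0 F1.
  destruct (hadamard2 F HF) as [A [HA EA]]. destruct (hadamard2 A HA) as [G [HG EG]].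
  exists G. split; [exact HG|].
  assert (F0' : near (fun z => F 0 (z 1%nat) = 0)).
  { apply (near_comp_vec _ [fun z => z 1%nat] F0); repeat constructor; apply An_var. }
  assert (F1' : near (fun z => d1 F 0 (z 1%nat) = 0)).
  { apply (near_comp_vec _ [fun z => z 1%nat] F1); repeat constructor; apply An_var. }
  assert (E1 : near (fun z => F (z 0%nat) (z 1%nat) = z 0%nat * A (z 0%nat) (z 1%nat))).
  { apply near_imp with (2 := near_and _ _ F0' EA). intros z [H1 H2]. rewrite H2, H1. ring. }
  (* the s-derivative of s * A at s = 0 is A *)
  assert (E2 : near (fun z => A 0 (z 1%nat) = 0)).
  { assert (P := near_pd_ext 0 _ _ E1).
    assert (P' := near_comp_vec _ [fun _ => 0; fun z => z 1%nat] P
       ltac:(repeat constructor; [apply An_const | apply An_var]) ltac:(repeat constructor)).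
    assert (D := near_comp_vec _ [fun _ => 0; fun z => z 1%nat] (near_d A HA)
       ltac:(repeat constructor; [apply An_const | apply An_var]) ltac:(repeat constructor)).
    apply near_imp with (2 := near_and _ _ F1' (near_and _ _ P' D)).
    intros z [H1 [H2 [H3 _]]]. cbn in H2, H3.
    assert (K : is_derive (fun s => s * A s (z 1%nat)) 0 (1 * A 0 (z 1%nat) + 0 * d1 A 0 (z 1%nat))).
    { apply (D_mult (fun s => s) (fun s => A s (z 1%nat))); [apply D_id | exact H3]. }
    apply is_derive_unique in K.
    assert (Z : d1 F 0 (z 1%nat) = Derive (fun s => s * A s (z 1%nat)) 0) by exact H2.
    assert (Z' := eq_trans Z K). rewrite H1 in Z'. lra. }
  apply near_imp with (2 := near_and _ _ E1 (near_and _ _ EG E2)).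
  intros z [H1 [H2 H3]]. rewrite H1, H2, H3. ring.
Qed.

Variable H : R -> R -> R -> R -> R.
Hypothesis (HH : An4 H).
Hypothesis Htaylor : near (fun z => B (z 0%nat) (z 1%nat) (z 2%nat + z 3%nat) =
    B (z 0%nat) (z 1%nat) (z 2%nat) + B1 (z 0%nat) (z 1%nat) (z 2%nat) * z 3%nat
    + B2 (z 0%nat) (z 1%nat) (z 2%nat) * z 3%nat ^ 2 + B3 (z 0%nat) (z 1%nat) (z 2%nat) * z 3%nat ^ 3
    + z 3%nat ^ 4 * H (z 0%nat) (z 1%nat) (z 2%nat) (z 3%nat)).
Variables E2 E3 : R -> R -> R.
Hypotheses (HE2 : An2 E2) (HE3 : An2 E3).
Hypothesis HR2 : near (fun z => defect2 (z 0%nat) (z 1%nat) = z 0%nat ^ 2 * E2 (z 0%nat) (z 1%nat)).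
Hypothesis HR3 : near (fun z => defect3 (z 0%nat) (z 1%nat) = z 0%nat ^ 2 * E3 (z 0%nat) (z 1%nat)).

Definition normal_quad s t tau := (E2 s t + tau * E3 s t) / (m s t * w s t).
Definition normal_quart s t tau := m s t ^ 3 / ((w s t + d2 xi s t * tau) * w s t)
   * H (xi s t) (eta s t) (q s t) (m s t * tau / (w s t + d2 xi s t * tau)).
(** The transformed right-hand side.  With [x' = w + xi_t * tau] the slope in the old
    coordinates is [q + m * tau / x'], so the remainder of order 4 in the expansion of
    [B] at the slope [q] carries a factor [tau ^ 4]. *)
Definition normal_rhs s t tau := s ^ 2 * tau ^ 2 * normal_quad s t tau + tau ^ 4 * normal_quart s t tau.

Lemma An3_normal_quad : An3 normal_quad.
Proof.
  unfold An3, normal_quad. apply An_div.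
  - apply An_plus; [exact HE2 | apply An_mult; [apply An_var | exact HE3]].
  - apply An_mult; assumption.
  - unfold pt0. rewrite m0, w0. lra.
Qed.

Lemma An3_normal_quart : An3 normal_quart.
Proof.
  assert (Hden : An (fun z => w (z 0%nat) (z 1%nat) + d2 xi (z 0%nat) (z 1%nat) * z 2%nat)).
  { apply An_plus; [exact Aw|]. apply An_mult; [apply An2_d2; exact Axi | apply An_var]. }
  assert (Hden0 : w (pt0 0%nat) (pt0 1%nat) + d2 xi (pt0 0%nat) (pt0 1%nat) * pt0 2%nat <> 0).
  { unfold pt0. rewrite w0. lra. }
  unfold An3, normal_quart. apply An_mult.
  - apply An_div.
    + apply An_pow. exact Am.
    + apply An_mult; [exact Hden | exact Aw].
    + apply Rmult_integral_contrapositive_currified; [exact Hden0 |]. unfold pt0. rewrite w0. lra.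
  - apply (An_comp4 H); try assumption.
    + apply An_div; [|exact Hden | exact Hden0]. apply An_mult; [exact Am | apply An_var].
    + unfold pt0. unfold Rdiv. ring.
Qed.

(** If the jet [(s, t, p)] moves along a solution of the old equation, the slope in the
    new coordinates is [w * sg / (m - xi_t * sg)], with [sg = p - q] the deviation from
    the slope of the solution of the family.  Its derivative is computed from [sg'] with
    the expansion of [B]; the terms of order 0 and 1 in [sg] cancel by the equations of
    the frame, those of order 2 and 3 are the defects. *)
Lemma slope_law : near (fun z => let s0 := z 0%nat in let t0 := z 1%nat in let p0 := z 2%nat in
  forall (s t p : R -> R) x, s x = s0 -> t x = t0 -> p x = p0 ->
   let sg := p0 - q s0 t0 in
   is_derive s x ((1 - d2 xi s0 t0 * (sg / m s0 t0)) / w s0 t0) ->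
   is_derive t x (sg / m s0 t0) ->
   is_derive p x (B (xi s0 t0) (eta s0 t0) p0) ->
   is_derive (fun x => w (s x) (t x) * (p x - q (s x) (t x)) /
       (m (s x) (t x) - d2 xi (s x) (t x) * (p x - q (s x) (t x)))) x
     (normal_rhs s0 t0 (w s0 t0 * sg / (m s0 t0 - d2 xi s0 t0 * sg)) *
       ((1 - d2 xi s0 t0 * (sg / m s0 t0)) / w s0 t0))).
Proof.
  assert (Ax := An2_d2 xi Axi).
  destruct (chain2 w Aw) as [r1 [Hr1 Cw]]. destruct (chain2 q Aq) as [r2 [Hr2 Cq]].
  destruct (chain2 m Am) as [r3 [Hr3 Cm]]. destruct (chain2 (d2 xi) Ax) as [r4 [Hr4 Cx]].
  destruct (common_radius4 r1 r2 r3 r4 Hr1 Hr2 Hr3 Hr4) as [r [Hr Lr]].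
  set (sgf := fun z : pt => z 2%nat - q (z 0%nat) (z 1%nat)).
  assert (Asg : An sgf) by (apply An_minus; [apply An_var | exact Aq]).
  assert (Asg0 : sgf pt0 = 0) by (unfold sgf, pt0; rewrite q0; ring).
  assert (HT4 : near (fun z => B (xi (z 0%nat) (z 1%nat)) (eta (z 0%nat) (z 1%nat)) (q (z 0%nat) (z 1%nat) + sgf z) =
    pullback B (z 0%nat) (z 1%nat) + pullback B1 (z 0%nat) (z 1%nat) * sgf z
    + pullback B2 (z 0%nat) (z 1%nat) * sgf z ^ 2 + pullback B3 (z 0%nat) (z 1%nat) * sgf z ^ 3
    + sgf z ^ 4 * H (xi (z 0%nat) (z 1%nat)) (eta (z 0%nat) (z 1%nat)) (q (z 0%nat) (z 1%nat)) (sgf z))).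
  { apply (near_comp_vec _ [fun z => xi (z 0%nat) (z 1%nat); fun z => eta (z 0%nat) (z 1%nat);
      fun z => q (z 0%nat) (z 1%nat); sgf] Htaylor); repeat constructor; assumption. }
  assert (Nd : near (fun z => m (z 0%nat) (z 1%nat) - d2 xi (z 0%nat) (z 1%nat) * sgf z <> 0)).
  { apply (near_neq0 (fun z => m (z 0%nat) (z 1%nat) - d2 xi (z 0%nat) (z 1%nat) * sgf z)).
    - apply An_minus; [exact Am | apply An_mult; [exact Ax | exact Asg]].
    - rewrite Asg0. unfold pt0. rewrite m0. lra. }
  apply near_imp with (2 := near_and _ _ frame_derivatives (near_and _ _ frame_mixed_derivatives (near_and _ _ consistency
    (near_and _ _ HT4 (near_and _ _ Nd (near_and _ _ HR2 (near_and _ _ HR3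
      (ex_intro _ r (conj Hr (fun z Hz => Hz)))))))))).
  intros z [F [MX [[Cons1 Cons2] [HT [ND [E2' [E3' Hbox]]]]]]] s0 t0 p0 s t p x Es Et Ep sg Ds Dt Dp.
  fold s0 t0 in F, MX, Cons1, Cons2, HT, ND, E2', E3'.
  unfold sgf in HT, ND. fold s0 t0 p0 in HT, ND. fold sg in HT, ND.
  destruct F as [[NZ1 NZ2] [[X1 X2] [[Et1 Et2] [[Q1 Q2] [[W1 W2] [[M1 M2] [N1 N2]]]]]]].
  destruct MX as [MXX _].
  assert (V1 : d1 w s0 t0 = w s0 t0 ^ 2 * (2 * n s0 t0 / m s0 t0 - pullback B1 s0 t0)) by now apply is_derive_unique.
  assert (V2 : d1 q s0 t0 = pullback B s0 t0 * w s0 t0) by now apply is_derive_unique.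
  assert (V3 : d1 m s0 t0 = w s0 t0 * n s0 t0) by now apply is_derive_unique.
  assert (V4 : d1 (d2 xi) s0 t0 = d2 w s0 t0) by now apply is_derive_unique.
  assert (Bs : Rabs (s x) < r) by (rewrite Es; now apply box_le).
  assert (Bt : Rabs (t x) < r) by (rewrite Et; now apply box_le).
  assert (Dw := Cw s t x _ _ ltac:(lra) ltac:(lra) Ds Dt).
  assert (Dq := Cq s t x _ _ ltac:(lra) ltac:(lra) Ds Dt).
  assert (Dm := Cm s t x _ _ ltac:(lra) ltac:(lra) Ds Dt).
  assert (Dx := Cx s t x _ _ ltac:(lra) ltac:(lra) Ds Dt).
  cbv beta in Dw, Dq, Dm, Dx. rewrite Es, Et in Dw, Dq, Dm, Dx.
  rewrite V1 in Dw. rewrite V2 in Dq. rewrite V3 in Dm. rewrite V4 in Dx.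
  replace p0 with (q s0 t0 + sg) in Dp by (unfold sg; ring). rewrite HT in Dp.
  assert (NDx : m (s x) (t x) - d2 xi (s x) (t x) * (p x - q (s x) (t x)) <> 0).
  { rewrite Es, Et, Ep. exact ND. }
  eapply deriv_val; [der|].
  rewrite Es, Et, Ep. fold sg.
  (* the value of sigma recovered from tau *)
  set (tau := w s0 t0 * sg / (m s0 t0 - d2 xi s0 t0 * sg)).
  assert (Hx' : w s0 t0 + d2 xi s0 t0 * tau = w s0 t0 * m s0 t0 / (m s0 t0 - d2 xi s0 t0 * sg)).
  { unfold tau. field. exact ND. }
  assert (Hsg : m s0 t0 * tau / (w s0 t0 + d2 xi s0 t0 * tau) = sg).
  { rewrite Hx'. unfold tau. field. repeat split; assumption. }
  assert (HBt : normal_rhs s0 t0 tau = tau ^ 2 * (defect2 s0 t0 + tau * defect3 s0 t0) / (m s0 t0 * w s0 t0)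
      + tau ^ 4 * (m s0 t0 ^ 3 / (w s0 t0 * m s0 t0 / (m s0 t0 - d2 xi s0 t0 * sg) * w s0 t0)
          * H (xi s0 t0) (eta s0 t0) (q s0 t0) sg)).
  { unfold normal_rhs, normal_quad, normal_quart. rewrite Hsg, Hx', E2', E3'. field. repeat split; assumption. }
  rewrite HBt. unfold defect2, defect3.
  assert (Dq2 : d2 q s0 t0 = n s0 t0 + pullback B s0 t0 * d2 xi s0 t0) by lra.
  rewrite Dq2. unfold tau. field. repeat split; assumption.
Qed.
End Frame.

(** * Solutions of second order equations *)

(** The abscissa is a state of the autonomous system; it is recognized as [s + th]. *)
Lemma ode_flow (B : R -> R -> R -> R) : An3 B -> exists U V : R -> R -> R -> R -> R,
  An4 U /\ An4 V /\ U 0 0 0 0 = 0 /\ V 0 0 0 0 = 0 /\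
  near (fun z => U 0 (z 1%nat) (z 2%nat) (z 3%nat) = z 2%nat /\ V 0 (z 1%nat) (z 2%nat) (z 3%nat) = z 3%nat) /\
  near (fun z => is_derive (fun th => U th (z 1%nat) (z 2%nat) (z 3%nat)) (z 0%nat) (V (z 0%nat) (z 1%nat) (z 2%nat) (z 3%nat)) /\
     is_derive (fun th => V th (z 1%nat) (z 2%nat) (z 3%nat)) (z 0%nat)
       (B (z 1%nat + z 0%nat) (U (z 0%nat) (z 1%nat) (z 2%nat) (z 3%nat)) (V (z 0%nat) (z 1%nat) (z 2%nat) (z 3%nat)))).
Proof.
  intros HB.
  destruct (analytic_flow (fam [fun _ => 1; fun z => z 2%nat; fun z => B (z 0%nat) (z 1%nat) (z 2%nat)])
     (fam [fun z => z 1%nat; fun z => z 2%nat; fun z => z 3%nat])) as [u [Hu [Hu0 [Hui Hud]]]].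
  { apply AnF_fam. repeat (apply List.Forall_cons || apply List.Forall_nil).
    - apply An_const. - apply An_var. - exact HB. }
  { apply AnF_fam. repeat constructor; apply An_var. }
  { apply fam_pt0. repeat constructor. }
  { reflexivity. }
  set (W := fun i th s t p => u i (vec [th; s; t; p])).
  assert (HW : forall i, An4 (W i)).
  { intros i. apply (An_comp_vec (u i) [fun z => z 0%nat; fun z => z 1%nat; fun z => z 2%nat; fun z => z 3%nat]).
    - now apply An_of_AnF.
    - repeat constructor; apply An_var.
    - repeat constructor. }
  assert (HW0 : forall i, W i 0 0 0 0 = 0).
  { intros i. unfold W. replace (vec [0; 0; 0; 0]) with pt0; [apply Hu0|]. symmetry. apply vec_pt0. repeat constructor. }
  destruct (near_vec _ Hui) as [r1 [Hr1 I]]. destruct (near_vec _ Hud) as [r2 [Hr2 D]].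
  assert (I' : forall s t p, Rabs s < r1 -> Rabs t < r1 -> Rabs p < r1 -> forall i,
      W i 0 s t p = vec [s; t; p] i).
  { intros s t p Hs Ht Hp i. unfold W.
    assert (H := I [0; s; t; p] ltac:(repeat constructor; try assumption; rewrite Rabs_R0; lra) i).
    replace (upd (vec [0; s; t; p]) 0 0) with (vec [0; s; t; p]) in H.
    - exact H.
    - apply functional_extensionality. intros [|j]; reflexivity. }
  assert (D' : forall th s t p, Rabs th < r2 -> Rabs s < r2 -> Rabs t < r2 -> Rabs p < r2 -> forall i,
      is_derive (fun th => W i th s t p) th (vec [1; W 2%nat th s t p; B (W 0%nat th s t p) (W 1%nat th s t p) (W 2%nat th s t p)] i)).
  { intros th s t p Hth Hs Ht Hp i.
    assert (H := D [th; s; t; p] ltac:(repeat constructor; assumption) i).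
    apply is_derive_ext with (2 := H). intros x. unfold W. f_equal.
    apply functional_extensionality. intros [|j]; reflexivity. }
  set (r := Rmin r1 r2). assert (Hr : 0 < r) by now apply Rmin_pos.
  assert (L1 : r <= r1) by apply Rmin_l. assert (L2 : r <= r2) by apply Rmin_r.
  assert (S : forall th s t p, Rabs th < r -> Rabs s < r -> Rabs t < r -> Rabs p < r -> W 0%nat th s t p = s + th).
  { intros th s t p Hth Hs Ht Hp.
    assert (K := constant_of_derive (fun th => W 0%nat th s t p - th) r).
    cbv beta in K. rewrite (I' s t p ltac:(lra) ltac:(lra) ltac:(lra) 0%nat) in K.
    assert (K' := K ltac:(intros y Hy; apply (deriv_val _ _ _ _ (D_minus _ _ _ _ _
      (D' y s t p ltac:(lra) ltac:(lra) ltac:(lra) ltac:(lra) 0%nat) (D_id y)));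
      apply Rminus_diag) th Hth).
    unfold vec in K'; simpl in K'. lra. }
  exists (W 1%nat), (W 2%nat).
  split; [apply HW|]. split; [apply HW|]. split; [apply HW0|]. split; [apply HW0|]. split.
  - exists r. split; [exact Hr|]. intros z Hz.
    assert (Hi := fun i => box_le r z i Hz).
    assert (Hi1 : forall i, Rabs (z i) < r1) by (intros i; specialize (Hi i); lra).
    split.
    + exact (I' _ _ _ (Hi1 1%nat) (Hi1 2%nat) (Hi1 3%nat) 1%nat).
    + exact (I' _ _ _ (Hi1 1%nat) (Hi1 2%nat) (Hi1 3%nat) 2%nat).
  - exists r. split; [exact Hr|]. intros z Hz.
    assert (Hi := fun i => box_le r z i Hz).
    assert (Hi2 : forall i, Rabs (z i) < r2) by (intros i; specialize (Hi i); lra).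
    rewrite <- (S (z 0%nat) (z 1%nat) (z 2%nat) (z 3%nat)) by apply Hi.
    split.
    + exact (D' _ _ _ _ (Hi2 0%nat) (Hi2 1%nat) (Hi2 2%nat) (Hi2 3%nat) 1%nat).
    + exact (D' _ _ _ _ (Hi2 0%nat) (Hi2 1%nat) (Hi2 2%nat) (Hi2 3%nat) 2%nat).
Qed.

(** Continuous induction: consider the supremum of the points up to which [Q] holds. *)
Lemma continuation (Q : R -> Prop) (x1 : R) : 0 <= x1 -> Q 0 ->
  (forall x, 0 <= x <= x1 -> Q x -> locally x Q) ->
  (forall x, 0 < x <= x1 -> (forall u, 0 <= u < x -> Q u) -> Q x) -> Q x1.
Proof.
  intros H0 HQ0 Hopen Hclosed.
  set (E := fun x => 0 <= x <= x1 /\ forall u, 0 <= u <= x -> Q u).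
  assert (HE0 : E 0).
  { split; [lra|]. intros u Hu. now replace u with 0 by lra. }
  destruct (completeness E) as [c [Hub Hlub]].
  { exists x1. intros x [Hx _]. lra. }
  { now exists 0. }
  assert (Hc0 : 0 <= c) by now apply Hub.
  assert (Hc1 : c <= x1) by (apply Hlub; intros x [Hx _]; lra).
  assert (Hbelow : forall u, 0 <= u < c -> Q u).
  { intros u Hu. destruct (Classical_Prop.classic (exists x, E x /\ u < x)) as [[x [[_ Hx] Hux]]|N].
    - apply Hx. lra.
    - assert (c <= u); [|lra]. apply Hlub. intros x Hx.
      destruct (Rle_lt_dec x u) as [L|L]; [exact L|]. contradiction N. now exists x. }
  assert (HQc : Q c).
  { destruct (Req_dec c 0) as [->|Hc]; [exact HQ0|]. apply Hclosed; [lra | exact Hbelow]. }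
  destruct (Req_dec c x1) as [E1|Hne]; [now rewrite <- E1|].
  destruct (Hopen c ltac:(lra) HQc) as [del Hdel].
  assert (Hd := cond_pos del).
  set (c' := Rmin x1 (c + del / 2)).
  assert (Hc' : c < c') by (apply Rmin_glb_lt; lra).
  assert (Hc'1 : c' <= x1) by apply Rmin_l. assert (Hc'2 : c' <= c + del / 2) by apply Rmin_r.
  assert (HE : E c').
  { split; [lra|]. intros u Hu. destruct (Rlt_le_dec u c) as [L|L].
    - apply Hbelow. lra.
    - apply Hdel. change (Rabs (u - c) < del). rewrite Rabs_pos_eq; lra. }
  apply Hub in HE. lra.
Qed.

(** As long as the jet stays in the box, the mean value theorem bounds its displacement,
    and this bound is strict.  The argument is about an arbitrary solution; the two
    half-lines are treated together by the sign [e]. *)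
Lemma jet_bound (B : R -> R -> R -> R) (r M d a b : R) (y : R -> R) :
  (forall x v p, Rabs x < r -> Rabs v < r -> Rabs p < r -> Rabs (B x v p) <= M) ->
  0 <= M -> d <= r -> d <= / 2 -> d * M <= r / 2 -> Rabs a < r / 2 -> Rabs b < r / 2 ->
  solves_ivp B d a b y -> forall x, Rabs x < d -> Rabs (y x) < r /\ Rabs (Derive y x) < r.
Proof.
  intros HB HM Hdr Hd2 HdM Ha Hb [Y0 [Y1 HY]].
  assert (key : forall e x1, (e = 1 \/ e = -1) -> 0 <= x1 < d ->
    Rabs (y (e * x1)) < r /\ Rabs (Derive y (e * x1)) < r).
  { intros e x1 He Hx1.
    assert (Hex : forall x, 0 <= x <= x1 -> Rabs (e * x) < d).
    { intros x Hx. rewrite Rabs_mult, (Rabs_pos_eq x) by lra.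
      replace (Rabs e) with 1; [lra|]. destruct He as [->| ->]; [now rewrite Rabs_R1 | now rewrite Rabs_m1]. }
    assert (Hee : Rabs e = 1) by (destruct He as [->| ->]; [apply Rabs_R1 | apply Rabs_m1]).
    assert (De : forall x, is_derive (fun x => e * x) x e).
    { intros x. auto_derive; [trivial | ring]. }
    assert (D0 : forall x, 0 <= x <= x1 -> is_derive (fun x => y (e * x)) x (e * Derive y (e * x))).
    { intros x Hx. destruct (HY _ (Hex x Hx)) as [E1 _]. apply Derive_correct in E1.
      exact (D_comp y (fun x => e * x) x _ _ E1 (De x)). }
    assert (D1 : forall x, 0 <= x <= x1 -> is_derive (fun x => Derive y (e * x)) x
        (e * B (e * x) (y (e * x)) (Derive y (e * x)))).
    { intros x Hx. destruct (HY _ (Hex x Hx)) as [_ E2].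
      exact (D_comp (Derive y) (fun x => e * x) x _ _ E2 (De x)). }
    set (Q := fun x => Rabs (y (e * x)) < r /\ Rabs (Derive y (e * x)) < r).
    change (Q x1). apply continuation; [lra | | |].
    - unfold Q. rewrite Rmult_0_r, Y0, Y1. lra.
    - intros x Hx [Q1 Q2]. apply filter_and.
      + apply (locally_abs_lt (fun x => y (e * x))); [eexists; apply D0; exact Hx | exact Q1].
      + apply (locally_abs_lt (fun x => Derive y (e * x))); [eexists; apply D1; exact Hx | exact Q2].
    - intros x Hx HQ.
      destruct (MVT_cor2 (fun x => y (e * x)) (fun x => e * Derive y (e * x)) 0 x ltac:(lra)) as [c [Hc1 Hc2]].
      { intros c Hc. apply is_derive_Reals. apply D0. lra. }
      destruct (MVT_cor2 (fun x => Derive y (e * x)) (fun x => e * B (e * x) (y (e * x)) (Derive y (e * x))) 0 x ltac:(lra)) as [c' [Hc1' Hc2']].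
      { intros c' Hc'. apply is_derive_Reals. apply D1. lra. }
      rewrite Rmult_0_r, Y0, Rminus_0_r in Hc1. rewrite Rmult_0_r, Y1, Rminus_0_r in Hc1'.
      destruct (HQ c ltac:(lra)) as [_ Q2]. destruct (HQ c' ltac:(lra)) as [Q1' Q2'].
      split.
      + replace (y (e * x)) with (a + e * Derive y (e * c) * x) by lra.
        apply Rle_lt_trans with (1 := Rabs_triang _ _).
        rewrite !Rabs_mult, Hee, (Rabs_pos_eq x) by lra.
        assert (0 <= Rabs (Derive y (e * c))) by apply Rabs_pos. nra.
      + replace (Derive y (e * x)) with (b + e * B (e * c') (y (e * c')) (Derive y (e * c')) * x) by lra.
        apply Rle_lt_trans with (1 := Rabs_triang _ _).
        rewrite !Rabs_mult, Hee, (Rabs_pos_eq x) by lra.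
        assert (HBc := HB (e * c') _ _ ltac:(apply Rlt_le_trans with d; [apply Hex; lra | lra]) Q1' Q2').
        assert (0 <= Rabs (B (e * c') (y (e * c')) (Derive y (e * c')))) by apply Rabs_pos. nra. }
  intros x Hx. destruct (Rle_lt_dec 0 x) as [L|L].
  - rewrite <- (Rmult_1_l x). apply key; [now left|]. rewrite Rabs_pos_eq in Hx; lra.
  - replace x with (-1 * - x) by ring. apply key; [now right|]. rewrite Rabs_left in Hx; lra.
Qed.

Lemma An3_lip (F : R -> R -> R -> R) : An3 F -> exists r C, 0 < r /\ 0 <= C /\
  forall s t p t' p', Rabs s < r -> Rabs t < r -> Rabs p < r -> Rabs t' < r -> Rabs p' < r ->
    Rabs (F s t p - F s t' p') <= C * (Rabs (t - t') + Rabs (p - p')).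
Proof.
  intros [r [N HF]]. assert (Hr := AnS_pos _ _ _ _ HF). assert (HN := AnS_N_nonneg _ _ _ _ HF).
  exists (r / 2), (N / (r / 2)). split; [lra|]. split; [apply Rdiv_le_0_compat; lra|].
  intros s t p t' p' Hs Ht Hp Ht' Hp'.
  assert (L := AnN_lip_pt r (r / 2) (Rabs (t - t') + Rabs (p - p')) N _ (vec [s; t; p]) (vec [s; t'; p']) HF ltac:(lra)).
  assert (A1 := Rabs_pos (t - t')). assert (A2 := Rabs_pos (p - p')).
  replace (N / (r / 2) * (Rabs (t - t') + Rabs (p - p'))) with
    (N * ((Rabs (t - t') + Rabs (p - p')) / (r - r / 2))) by (field; lra).
  apply L; intros [|[|[|i]]]; unfold vec; simpl; try lra.
  - destruct i; rewrite Rabs_R0; lra.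
  - destruct i; rewrite Rabs_R0; lra.
  - rewrite Rminus_diag, Rabs_R0. lra.
  - destruct i; rewrite Rminus_diag, Rabs_R0; lra.
Qed.

(** * Transformation of solutions *)

Lemma flow_solves (B : R -> R -> R -> R) (U V : R -> R -> R -> R -> R) (r : R) :
  (forall th s t p, Rabs th < r -> Rabs s < r -> Rabs t < r -> Rabs p < r ->
     is_derive (fun th => U th s t p) th (V th s t p) /\
     is_derive (fun th => V th s t p) th (B (s + th) (U th s t p) (V th s t p))) ->
  forall s0 t0 p0 d, Rabs s0 < r -> Rabs t0 < r -> Rabs p0 < r -> 0 < d <= r - Rabs s0 ->
  solves_ivp B d (U (0 - s0) s0 t0 p0) (V (0 - s0) s0 t0 p0) (fun s => U (s - s0) s0 t0 p0) /\
  forall s, Rabs s < d -> Derive (fun s => U (s - s0) s0 t0 p0) s = V (s - s0) s0 t0 p0.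
Proof.
  intros HF s0 t0 p0 d Hs0 Ht0 Hp0 Hd.
  assert (Hsh : forall s, Rabs s < d -> Rabs (s - s0) < r).
  { intros s Hs. apply Rle_lt_trans with (1 := Rabs_triang s (- s0)). rewrite Rabs_Ropp. lra. }
  assert (Dsh : forall s, is_derive (fun s => s - s0) s 1) by (intros s; auto_derive; [trivial | ring]).
  assert (DU : forall s, Rabs s < d -> is_derive (fun s => U (s - s0) s0 t0 p0) s (V (s - s0) s0 t0 p0)).
  { intros s Hs. destruct (HF (s - s0) s0 t0 p0 (Hsh s Hs) Hs0 Ht0 Hp0) as [D _].
    apply (deriv_val _ _ _ _ (D_comp (fun th => U th s0 t0 p0) (fun s => s - s0) s _ _ D (Dsh s))).
    ring. }
  assert (DV : forall s, Rabs s < d -> Derive (fun s => U (s - s0) s0 t0 p0) s = V (s - s0) s0 t0 p0).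
  { intros s Hs. now apply is_derive_unique, DU. }
  split; [|exact DV].
  split; [reflexivity|]. split; [apply DV; rewrite Rabs_R0; lra|].
  intros s Hs. split; [eexists; now apply DU|].
  rewrite DV by exact Hs.
  apply (D_ext_loc (fun s => V (s - s0) s0 t0 p0)).
  - apply filter_imp with (2 := locally_abs_ball s d Hs). intros y Hy. symmetry. now apply DV.
  - destruct (HF (s - s0) s0 t0 p0 (Hsh s Hs) Hs0 Ht0 Hp0) as [_ D].
    apply (deriv_val _ _ _ _ (D_comp (fun th => V th s0 t0 p0) (fun s => s - s0) s _ _ D (Dsh s))).
    replace (s0 + (s - s0)) with s by ring. ring.
Qed.

Section Transform.
Variables (B Bt : R -> R -> R -> R) (X Y : R -> R -> R) (tau : R -> R -> R -> R).
Hypotheses (HB : An3 B) (HBt : An3 Bt) (HX : An2 X) (HY : An2 Y) (Htau : An3 tau).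
Hypotheses (X0 : X 0 0 = 0) (Y0 : Y 0 0 = 0) (tau0 : tau 0 0 0 = 0).
Hypotheses (JY : d2 Y 0 0 = 1) (Jtau : e3 tau 0 0 0 = 1).
Hypothesis Hlaw : near (fun z => forall (yf pf : R -> R) x, x = z 0%nat -> yf x = z 1%nat -> pf x = z 2%nat ->
  is_derive yf x (z 2%nat) -> is_derive pf x (B (z 0%nat) (z 1%nat) (z 2%nat)) ->
  exists s', Rabs s' <= 2 /\
    is_derive (fun x => X x (yf x)) x s' /\
    is_derive (fun x => Y x (yf x)) x (s' * tau (z 0%nat) (z 1%nat) (z 2%nat)) /\
    is_derive (fun x => tau x (yf x) (pf x)) x
      (Bt (X (z 0%nat) (z 1%nat)) (Y (z 0%nat) (z 1%nat)) (tau (z 0%nat) (z 1%nat) (z 2%nat)) * s')).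

Variables U V : R -> R -> R -> R -> R.
Hypotheses (HU : An4 U) (HV : An4 V) (U0 : U 0 0 0 0 = 0) (V0 : V 0 0 0 0 = 0).
Hypothesis Hinit : near (fun z => U 0 (z 1%nat) (z 2%nat) (z 3%nat) = z 2%nat /\ V 0 (z 1%nat) (z 2%nat) (z 3%nat) = z 3%nat).
Hypothesis Hflow : near (fun z => is_derive (fun th => U th (z 1%nat) (z 2%nat) (z 3%nat)) (z 0%nat) (V (z 0%nat) (z 1%nat) (z 2%nat) (z 3%nat)) /\
     is_derive (fun th => V th (z 1%nat) (z 2%nat) (z 3%nat)) (z 0%nat)
       (Bt (z 1%nat + z 0%nat) (U (z 0%nat) (z 1%nat) (z 2%nat) (z 3%nat)) (V (z 0%nat) (z 1%nat) (z 2%nat) (z 3%nat)))).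

(** The jet of the solution at [x = 0] is written in the new coordinates and carried to
    [s = 0] by the flow [(U, V)] of the new equation. *)
Definition alpha a b := U (0 - X 0 a) (X 0 a) (Y 0 a) (tau 0 a b).
Definition beta a b := V (0 - X 0 a) (X 0 a) (Y 0 a) (tau 0 a b).

Lemma An2_flow0 F : An4 F -> An2 (fun a b => F (0 - X 0 a) (X 0 a) (Y 0 a) (tau 0 a b)).
Proof.
  intros HF.
  assert (AX : An (fun z => X 0 (z 0%nat))) by (apply (An_comp2 X); auto; [apply An_const | apply An_var]).
  assert (AY : An (fun z => Y 0 (z 0%nat))) by (apply (An_comp2 Y); auto; [apply An_const | apply An_var]).
  apply (An_comp4 F); auto.
  - apply An_minus; [apply An_const | exact AX].
  - apply (An_comp3 tau); auto; try apply An_var. apply An_const.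
  - unfold pt0. rewrite X0. ring.
Qed.

(** At the origin the flow does not move to the first order and the abscissa [X 0 a] is a
    function of [a] only, so the Jacobian matrix is triangular with 1 on the
    diagonal. *)
Lemma initial_diffeo : local_diffeo alpha beta.
Proof.
  assert (A0 : alpha 0 0 = 0) by (unfold alpha; rewrite X0, Y0, tau0, Rminus_0_r; exact U0).
  assert (B0 : beta 0 0 = 0) by (unfold beta; rewrite X0, Y0, tau0, Rminus_0_r; exact V0).
  destruct (near_vec _ Hinit) as [r [Hr I]].
  assert (I' : forall s t p, Rabs s < r -> Rabs t < r -> Rabs p < r -> U 0 s t p = t /\ V 0 s t p = p).
  { intros s t p Hs Ht Hp. apply (I [0; s; t; p]). repeat constructor; auto. rewrite Rabs_R0; lra. }
  assert (Z : Rabs 0 < r) by (rewrite Rabs_R0; lra).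
  assert (Hl : locally 0 (fun x : R => Rabs x < r)).
  { now apply locally_abs_ball. }
  assert (DX := proj2 (near_pt0 _ (near_d X HX))). assert (DY := proj2 (near_pt0 _ (near_d Y HY))).
  assert (Dt2 := near_pt0 _ (near_pd 1 _ Htau)). assert (Dt3 := near_pt0 _ (near_pd 2 _ Htau)).
  assert (DU := proj1 (near_pt0 _ Hflow)).
  change (is_derive (fun t => X 0 t) 0 (d2 X 0 0)) in DX.
  change (is_derive (fun t => Y 0 t) 0 (d2 Y 0 0)) in DY.
  change (is_derive (fun t => tau 0 t 0) 0 (e2 tau 0 0 0)) in Dt2.
  change (is_derive (fun t => tau 0 0 t) 0 (e3 tau 0 0 0)) in Dt3.
  change (is_derive (fun th => U th 0 0 0) 0 (V 0 0 0 0)) in DU.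
  assert (Ja : d1 alpha 0 0 = 1).
  { apply is_derive_unique. destruct (chain4 U HU) as [rU [HrU CU]].
    assert (ZU : Rabs 0 < rU) by (rewrite Rabs_R0; lra).
    assert (K := CU (fun a => 0 - X 0 a) (fun a => X 0 a) (fun a => Y 0 a) (fun a => tau 0 a 0) 0
       (0 - d2 X 0 0) (d2 X 0 0) (d2 Y 0 0) (e2 tau 0 0 0)).
    cbv beta in K. rewrite X0, Y0, tau0, Rminus_0_r in K.
    apply (deriv_val _ _ _ _ (K ZU ZU ZU ZU (D_minus _ _ _ _ _ (D_const 0 0) DX) DX DY Dt2)).
    assert (E0 : Derive (fun t => U t 0 0 0) 0 = 0) by exact (eq_trans (is_derive_unique _ _ _ DU) V0).
    assert (E1 : Derive (fun t => U 0 t 0 0) 0 = 0).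
    { rewrite (Derive_ext_loc _ (fun _ => 0)); [apply Derive_const|].
      apply filter_imp with (2 := Hl). intros x Hx. now apply I'. }
    assert (E2 : Derive (fun t => U 0 0 t 0) 0 = 1).
    { rewrite (Derive_ext_loc _ (fun t => t)); [apply Derive_id|].
      apply filter_imp with (2 := Hl). intros x Hx. now apply I'. }
    assert (E3 : Derive (fun t => U 0 0 0 t) 0 = 0).
    { rewrite (Derive_ext_loc _ (fun _ => 0)); [apply Derive_const|].
      apply filter_imp with (2 := Hl). intros x Hx. now apply I'. }
    rewrite E0, E1, E2, E3, JY. ring. }
  assert (Hl2 : locally 0 (fun b => Rabs (tau 0 0 b) < r)).
  { apply (locally_abs_lt (fun b => tau 0 0 b)); [eexists; exact Dt3 | rewrite tau0; exact Z]. }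
  assert (Jb : d2 alpha 0 0 = 0).
  { unfold d2, alpha. rewrite X0, Y0, Rminus_0_r.
    rewrite (Derive_ext_loc _ (fun _ => 0)); [apply Derive_const|].
    apply filter_imp with (2 := Hl2). intros b Hb. now apply I'. }
  assert (Jd : d2 beta 0 0 = 1).
  { unfold d2, beta. rewrite X0, Y0, Rminus_0_r.
    rewrite (Derive_ext_loc _ (fun b => tau 0 0 b)).
    - rewrite <- Jtau. now apply is_derive_unique.
    - apply filter_imp with (2 := Hl2). intros b Hb. now apply I'. }
  destruct (inverse_function alpha beta (An2_flow0 U HU) (An2_flow0 V HV) A0 B0) as [P [Q [HP [HQ [_ [_ [H1 H2]]]]]]].
  { rewrite Ja, Jb, Jd. lra. }
  exact (local_diffeo_of_inverse alpha beta P Q (An2_flow0 U HU) (An2_flow0 V HV) A0 B0 HP HQ H1 H2).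
Qed.

(** The differences between the transformed jet and the jet of the new solution are
    controlled by Gronwall's inequality: both satisfy the new equation as the abscissa
    [X] moves, and they agree at [x = 0]. *)
Lemma carries_solutions : transforms B X Y alpha beta Bt.
Proof.
  destruct (ode_flow B HB) as [U' [V' [HU' [HV' [_ [_ [Hi' Hf']]]]]]].
  destruct (near_vec _ Hflow) as [r2 [Hr2 F2]].
  destruct (near_vec _ Hinit) as [r1 [Hr1 I1]].
  destruct (An3_lip Bt HBt) as [r4 [C [Hr4 [HC Lip]]]].
  destruct (near_vec _ (near_and _ _ (An_small _ r4 HU U0 Hr4) (An_small _ r4 HV V0 Hr4))) as [r9 [Hr9 S9]].
  destruct (common_radius4 r1 r2 r4 r9 Hr1 Hr2 Hr4 Hr9) as [rho [Hrho [L1 [L2 [L4 L9]]]]].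
  assert (Hq : 0 < rho / 4) by lra.
  assert (SX := An_small _ (rho / 4) HX X0 Hq). assert (SY := An_small _ (rho / 4) HY Y0 Hq).
  assert (ST := An_small _ (rho / 4) Htau tau0 Hq).
  destruct (near_bounded _ HB) as [M [HM BM]].
  destruct (near_vec _ (near_and _ _ SX (near_and _ _ SY (near_and _ _ ST (near_and _ _ BM
    (near_and _ _ Hlaw (near_and _ _ Hi' Hf'))))))) as [r3 [Hr3 A3]].
  assert (Hd5 : 0 < r3 / (2 * (M + 1))) by (apply Rdiv_lt_0_compat; lra).
  destruct (common_radius4 (rho / 4) r3 (/ 2) (r3 / (2 * (M + 1))) Hq Hr3 ltac:(lra) Hd5)
    as [d [Hd [Ld1 [Ld2 [Ld3 Ld4]]]]].
  assert (LdM : d * M <= r3 / 2).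
  { apply Rle_trans with (r3 / (2 * (M + 1)) * (M + 1)).
    - apply Rmult_le_compat; lra.
    - right. field. lra. }
  assert (Z3 : Rabs 0 < r3) by (rewrite Rabs_R0; lra).
  exists d, (r3 / 2). split; [exact Hd|]. split; [lra|].
  intros a b Ha Hb. split.
  - assert (HF : forall th s t p, Rabs th < r3 -> Rabs s < r3 -> Rabs t < r3 -> Rabs p < r3 ->
     is_derive (fun th => U' th s t p) th (V' th s t p) /\
     is_derive (fun th => V' th s t p) th (B (s + th) (U' th s t p) (V' th s t p))).
    { intros th s t p H1 H2 H3 H4.
      destruct (A3 [th; s; t; p] ltac:(repeat constructor; assumption)) as [_ [_ [_ [_ [_ [_ K]]]]]]. exact K. }
    destruct (flow_solves B U' V' r3 HF 0 a b d Z3 ltac:(lra) ltac:(lra)) as [K _].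
    { rewrite Rabs_R0. lra. }
    destruct (A3 [0; 0; a; b] ltac:(repeat constructor; (assumption || lra))) as [_ [_ [_ [_ [_ [[K1 K2] _]]]]]].
    unfold vec in K1, K2; cbn in K1, K2.
    rewrite Rminus_0_r, K1, K2 in K. now exists (fun s => U' (s - 0) 0 a b).
  - intros y Hy.
    assert (Jet := jet_bound B r3 M d a b y).
    assert (Hjet : forall x, Rabs x < d -> Rabs (y x) < r3 /\ Rabs (Derive y x) < r3).
    { apply Jet; try assumption.
      intros x v p H1 H2 H3.
      destruct (A3 [x; v; p] ltac:(repeat constructor; assumption)) as [_ [_ [_ [K _]]]]. exact K. }
    clear Jet. destruct Hy as [Hy0 [Hy1 Hy]].
    set (s0 := X 0 a). set (t0 := Y 0 a). set (p0 := tau 0 a b).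
    assert (Small : forall x v p, Rabs x < r3 -> Rabs v < r3 -> Rabs p < r3 ->
       Rabs (X x v) < rho / 4 /\ Rabs (Y x v) < rho / 4 /\ Rabs (tau x v p) < rho / 4).
    { intros x v p H1 H2 H3.
      destruct (A3 [x; v; p] ltac:(repeat constructor; assumption)) as [K1 [K2 [K3 _]]]. now split. }
    destruct (Small 0 a b Z3 ltac:(lra) ltac:(lra)) as [Ss0 [St0 Sp0]].
    fold s0 in Ss0. fold t0 in St0. fold p0 in Sp0.
    assert (HF : forall th s t p, Rabs th < rho -> Rabs s < rho -> Rabs t < rho -> Rabs p < rho ->
     is_derive (fun th => U th s t p) th (V th s t p) /\
     is_derive (fun th => V th s t p) th (Bt (s + th) (U th s t p) (V th s t p))).
    { intros th s t p H1 H2 H3 H4. apply (F2 [th; s; t; p]). repeat constructor; lra. }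
    destruct (flow_solves Bt U V rho HF s0 t0 p0 d ltac:(lra) ltac:(lra) ltac:(lra)) as [K _].
    { lra. }
    exists (fun s => U (s - s0) s0 t0 p0). split; [exact K|].
    (* uniqueness: both graphs solve the new equation *)
    intros x Hx _.
    set (e := fun x => Y x (y x) - U (X x (y x) - s0) s0 t0 p0).
    set (f := fun x => tau x (y x) (Derive y x) - V (X x (y x) - s0) s0 t0 p0).
    destruct (gronwall e f d (2 * (1 + C))) with (x := x) as [He _].
    + unfold e. rewrite Hy0. fold s0 t0. rewrite Rminus_diag.
      destruct (I1 [0; s0; t0; p0] ltac:(repeat constructor; try lra; rewrite Rabs_R0; lra)) as [K1 _].
      unfold vec in K1; cbn in K1. rewrite K1. ring.
    + unfold f. rewrite Hy0, Hy1. fold s0 t0 p0. rewrite Rminus_diag.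
      destruct (I1 [0; s0; t0; p0] ltac:(repeat constructor; try lra; rewrite Rabs_R0; lra)) as [_ K1].
      unfold vec in K1; cbn in K1. rewrite K1. ring.
    + intros x' Hx'. destruct (Hjet x' Hx') as [J1 J2]. destruct (Hy x' Hx') as [E1 E2].
      apply Derive_correct in E1.
      assert (Rx : Rabs x' < r3) by lra.
      destruct (A3 [x'; y x'; Derive y x'] ltac:(repeat constructor; assumption)) as [_ [_ [_ [_ [Lw _]]]]].
      destruct (Lw y (Derive y) x' eq_refl eq_refl eq_refl E1 E2) as [s' [Hs' [DX [DY DT]]]].
      unfold vec in DY, DT; cbn in DY, DT.
      destruct (Small x' (y x') (Derive y x') Rx J1 J2) as [S1 [S2 S3]].
      assert (Sth : Rabs (X x' (y x') - s0) < rho).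
      { apply Rle_lt_trans with (1 := Rabs_triang (X x' (y x')) (- s0)). rewrite Rabs_Ropp. lra. }
      destruct (HF (X x' (y x') - s0) s0 t0 p0 Sth ltac:(lra) ltac:(lra) ltac:(lra)) as [DU DV].
      replace (s0 + (X x' (y x') - s0)) with (X x' (y x')) in DV by ring.
      destruct (S9 [X x' (y x') - s0; s0; t0; p0] ltac:(repeat constructor; lra)) as [SU SV].
      unfold vec in SU, SV; cbn in SU, SV.
      assert (Dsh : is_derive (fun x => X x (y x) - s0) x' s').
      { apply (deriv_val _ _ _ _ (D_minus _ _ _ _ _ DX (D_const s0 x'))). ring. }
      assert (DU' := D_comp (fun th => U th s0 t0 p0) (fun x => X x (y x) - s0) x' _ _ DU Dsh).
      assert (DV' := D_comp (fun th => V th s0 t0 p0) (fun x => X x (y x) - s0) x' _ _ DV Dsh).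
      exists (s' * f x'), (s' * (Bt (X x' (y x')) (Y x' (y x')) (tau x' (y x') (Derive y x'))
         - Bt (X x' (y x')) (U (X x' (y x') - s0) s0 t0 p0) (V (X x' (y x') - s0) s0 t0 p0))).
      assert (P1 := Rabs_pos (e x')). assert (P2 := Rabs_pos (f x')).
      split; [|split; [|split]].
      * apply (deriv_val _ _ _ _ (D_minus _ _ _ _ _ DY DU')). unfold f. ring.
      * apply (deriv_val _ _ _ _ (D_minus _ _ _ _ _ DT DV')). ring.
      * rewrite Rabs_mult. apply Rle_trans with (2 * Rabs (f x')); [apply Rmult_le_compat_r; assumption|]. nra.
      * rewrite Rabs_mult.
        assert (LL := Lip (X x' (y x')) (Y x' (y x')) (tau x' (y x') (Derive y x'))
          (U (X x' (y x') - s0) s0 t0 p0) (V (X x' (y x') - s0) s0 t0 p0)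
          ltac:(lra) ltac:(lra) ltac:(lra) SU SV).
        apply Rle_trans with (2 * (C * (Rabs (e x') + Rabs (f x')))).
        -- apply Rmult_le_compat; auto using Rabs_pos.
        -- nra.
    + exact Hx.
    + apply Rminus_diag_uniq. exact He.
Qed.
End Transform.

(** * The normal form *)

(** The coordinates are the inverse of [(xi, eta)], and the law of transformation is
    [slope_law] read along [x -> (X x (y x), Y x (y x))]; the speeds of that point follow
    from differentiating [xi (X, Y) = x] and [eta (X, Y) = y]. *)
Lemma normalizing_coordinates (B : R -> R -> R -> R) : An3 B ->
  exists (X Y : R -> R -> R) (tau Bt A C : R -> R -> R -> R),
    An2 X /\ An2 Y /\ An3 tau /\ An3 A /\ An3 C /\
    (forall x y p, Bt x y p = x ^ 2 * p ^ 2 * A x y p + p ^ 4 * C x y p) /\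
    X 0 0 = 0 /\ Y 0 0 = 0 /\ tau 0 0 0 = 0 /\ d2 Y 0 0 = 1 /\ e3 tau 0 0 0 = 1 /\
    local_diffeo X Y /\
    near (fun z => forall (yf pf : R -> R) x, x = z 0%nat -> yf x = z 1%nat -> pf x = z 2%nat ->
      is_derive yf x (z 2%nat) -> is_derive pf x (B (z 0%nat) (z 1%nat) (z 2%nat)) ->
      exists s', Rabs s' <= 2 /\
        is_derive (fun x => X x (yf x)) x s' /\
        is_derive (fun x => Y x (yf x)) x (s' * tau (z 0%nat) (z 1%nat) (z 2%nat)) /\
        is_derive (fun x => tau x (yf x) (pf x)) x
          (Bt (X (z 0%nat) (z 1%nat)) (Y (z 0%nat) (z 1%nat)) (tau (z 0%nat) (z 1%nat) (z 2%nat)) * s')).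
Proof.
  intros HB.
  destruct (taylor_slope B HB) as [B1 [B2 [B3 [H [HB1 [HB2 [HB3 [HH [Htay He3]]]]]]]]].
  destruct (centre_exists B B1 B2 B3 HB HB1 HB2 HB3) as [T [HTA [HT0 HTd]]].
  destruct (frame_exists B B1 HB HB1 T HTA HT0) as [xi [eta [q [w [m [n
    [[Axi [Aeta [Aq [Aw [Am An_n]]]]] [[xi0 [eta0 [q0 [w0 [m0 n0]]]]] [Hb Hs]]]]]]]]].
  assert (RB := defects_boundary B B1 B2 B3 xi eta q w m n Aw Am w0 m0 T HTd Hb).
  assert (RD := defects_derive_boundary B B1 B2 B3 HB HB1 HB2 HB3 xi eta q w m n Axi Aeta Aq Aw Am An_n
     xi0 eta0 q0 w0 m0 Hs T HTd Hb).
  assert (AR2 := An2_defect2 B1 B2 HB1 HB2 xi eta q w m n Axi Aeta Aq Aw Am An_n xi0 eta0 q0).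
  assert (AR3 := An2_defect3 B1 B2 B3 HB1 HB2 HB3 xi eta q m n Axi Aeta Aq Am An_n xi0 eta0 q0).
  destruct (divide_s2 _ AR2 (near_imp _ _ (fun z K => proj1 K) RB) (near_imp _ _ (fun z K => proj1 K) RD)) as [E2 [HE2 HR2]].
  destruct (divide_s2 _ AR3 (near_imp _ _ (fun z K => proj2 K) RB) (near_imp _ _ (fun z K => proj2 K) RD)) as [E3 [HE3 HR3]].
  assert (Cons := consistency B B1 B2 B3 HB HB1 He3 xi eta q w m n Axi Aeta Aq Aw Am An_n
     xi0 eta0 q0 w0 m0 Hs T HTd Hb).
  assert (Law := slope_law B B1 B2 B3 HB HB1 He3 xi eta q w m n Axi Aeta Aq Aw Am An_n
     xi0 eta0 q0 w0 m0 Hs T HTd Hb H Htay E2 E3 HR2 HR3).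
  assert (Hs0 := near_pt0 _ Hs). assert (Cons0 := near_pt0 _ Cons). unfold pt0 in Hs0, Cons0. cbv beta zeta in Hs0, Cons0.
  destruct Hs0 as [X1 [Et1 _]]. destruct Cons0 as [Cm _].
  assert (J1 : d1 xi 0 0 = 1) by (rewrite X1; exact w0).
  assert (J2 : d1 eta 0 0 = 0) by (rewrite Et1, q0; ring).
  assert (J3 : d2 eta 0 0 = 1) by (rewrite m0, q0 in Cm; lra).
  destruct (inverse_function xi eta Axi Aeta xi0 eta0) as [X [Y [HX [HY [X0 [Y0 [Hr Hl]]]]]]].
  { rewrite J1, J2, J3. lra. }
  set (Ax := An2_d2 xi Axi).
  set (sg := fun x y p => p - q (X x y) (Y x y)).
  set (tau := fun x y p => w (X x y) (Y x y) * sg x y p / (m (X x y) (Y x y) - d2 xi (X x y) (Y x y) * sg x y p)).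
  assert (L2 : forall F, An2 F -> An (fun z => F (X (z 0%nat) (z 1%nat)) (Y (z 0%nat) (z 1%nat)))).
  { intros F HF. now apply (An_comp2 F). }
  assert (Asg : An3 sg) by (apply An_minus; [apply An_var | now apply L2]).
  assert (sg0 : sg 0 0 0 = 0) by (unfold sg; rewrite X0, Y0, q0; ring).
  assert (Aden : An (fun z => m (X (z 0%nat) (z 1%nat)) (Y (z 0%nat) (z 1%nat))
     - d2 xi (X (z 0%nat) (z 1%nat)) (Y (z 0%nat) (z 1%nat)) * sg (z 0%nat) (z 1%nat) (z 2%nat))).
  { apply An_minus; [now apply L2 | apply An_mult; [now apply L2 | exact Asg]]. }
  assert (Htau : An3 tau).
  { apply An_div; [apply An_mult; [now apply L2 | exact Asg] | exact Aden |].
    unfold pt0. rewrite sg0, X0, Y0, m0. lra. }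
  assert (tau00 : tau 0 0 0 = 0) by (unfold tau; rewrite sg0; unfold Rdiv; ring).
  exists X, Y, tau, (normal_rhs xi eta q w m H E2 E3), (normal_quad w m E2 E3), (normal_quart xi eta q w m H).
  split; [exact HX|]. split; [exact HY|]. split; [exact Htau|].
  split; [exact (An3_normal_quad w m Aw Am w0 m0 E2 E3 HE2 HE3)|].
  split; [exact (An3_normal_quart xi eta q w m Axi Aeta Aq Aw Am xi0 eta0 q0 w0 H HH)|].
  split; [reflexivity|]. split; [exact X0|]. split; [exact Y0|]. split; [exact tau00|].
  destruct (near_vec _ Hr) as [rr [Hrr Vr]].
  destruct (chain2 xi Axi) as [rx [Hrx Cx]]. destruct (chain2 eta Aeta) as [re [Hre Ce]].
  destruct (chain2 X HX) as [rX [HrX CX]]. destruct (chain2 Y HY) as [rY [HrY CY]].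
  assert (Move : near (fun z => forall (yf : R -> R) x p, x = z 0%nat -> yf x = z 1%nat -> is_derive yf x p ->
     let s := X (z 0%nat) (z 1%nat) in let t := Y (z 0%nat) (z 1%nat) in
     exists s' t' : R, is_derive (fun x => X x (yf x)) x s' /\ is_derive (fun x => Y x (yf x)) x t' /\
      s' * d1 xi s t + t' * d2 xi s t = 1 /\ s' * d1 eta s t + t' * d2 eta s t = p)).
  { destruct (common_radius4 rX rY rr rr HrX HrY Hrr Hrr) as [r [Hrp R1]].
    apply near_imp with (2 := near_and _ _ (An_small _ rx HX X0 Hrx) (near_and _ _ (An_small _ rx HY Y0 Hrx)
      (near_and _ _ (An_small _ re HX X0 Hre) (near_and _ _ (An_small _ re HY Y0 Hre)
       (ex_intro _ r (conj Hrp (fun z Hz => Hz))))))).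
    intros z [S1 [S2 [S3 [S4 Hbox]]]] yf x p Ex Ey Dy s t.
    assert (Bx : Rabs x < r) by (rewrite Ex; now apply box_le).
    assert (By : Rabs (yf x) < r) by (rewrite Ey; now apply box_le).
    assert (Did : is_derive (fun x : R => x) x 1) by apply D_id.
    assert (DX := CX (fun x => x) yf x _ _ ltac:(lra) ltac:(lra) Did Dy).
    assert (DY := CY (fun x => x) yf x _ _ ltac:(lra) ltac:(lra) Did Dy).
    eexists. eexists. split; [exact DX|]. split; [exact DY|].
    assert (Es : X x (yf x) = s) by (unfold s; now rewrite <- Ex, <- Ey).
    assert (Et : Y x (yf x) = t) by (unfold t; now rewrite <- Ex, <- Ey).
    fold s in S1, S3. fold t in S2, S4.
    assert (Hloc : locally x (fun x => xi (X x (yf x)) (Y x (yf x)) = x /\ eta (X x (yf x)) (Y x (yf x)) = yf x)).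
    { apply filter_imp with (fun x => Rabs x < r /\ Rabs (yf x) < r).
      - intros x' [B1' B2']. apply (Vr [x'; yf x']). repeat constructor; lra.
      - apply filter_and.
        + apply (locally_abs_lt (fun x => x)); [eexists; exact Did | exact Bx].
        + apply locally_abs_lt; [eexists; exact Dy | exact By]. }
    assert (K1 := Cx (fun x => X x (yf x)) (fun x => Y x (yf x)) x _ _
       ltac:(cbv beta; rewrite Es; exact S1) ltac:(cbv beta; rewrite Et; exact S2) DX DY).
    assert (K2 := Ce (fun x => X x (yf x)) (fun x => Y x (yf x)) x _ _
       ltac:(cbv beta; rewrite Es; exact S3) ltac:(cbv beta; rewrite Et; exact S4) DX DY).
    apply is_derive_unique in K1. apply is_derive_unique in K2.
    cbv beta in K1, K2. rewrite Es, Et in K1, K2. split.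
    - etransitivity; [symmetry; exact K1|].
      etransitivity; [apply (Derive_ext_loc _ (fun x => x)) | apply Derive_id].
      apply filter_imp with (2 := Hloc). intros x' K. apply K.
    - etransitivity; [symmetry; exact K2|].
      etransitivity; [apply (Derive_ext_loc _ yf) | now apply is_derive_unique].
      apply filter_imp with (2 := Hloc). intros x' K. apply K. }
  split; [|split; [|split]].
  - destruct (near_pt0 _ (near_d X HX)) as [_ DX]. destruct (near_pt0 _ (near_d Y HY)) as [_ DY].
    unfold pt0 in DX, DY.
    assert (K := Ce (fun y => X 0 y) (fun y => Y 0 y) 0 _ _
      ltac:(cbv beta; rewrite X0, Rabs_R0; lra) ltac:(cbv beta; rewrite Y0, Rabs_R0; lra) DX DY).
    apply is_derive_unique in K. cbv beta in K. rewrite X0, Y0, J2, J3 in K.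
    assert (K' : Derive (fun y => eta (X 0 y) (Y 0 y)) 0 = 1).
    { etransitivity; [apply (Derive_ext_loc _ (fun y => y)) | apply Derive_id].
      apply filter_imp with (fun y => Rabs y < rr); [|apply locally_abs_ball; rewrite Rabs_R0; lra].
      intros y Hy.
      apply (Vr [0; y]). repeat constructor; [rewrite Rabs_R0; lra | exact Hy]. }
    assert (K'' := eq_trans (eq_sym K') K). lra.
  - apply is_derive_unique. unfold tau, sg. rewrite X0, Y0, q0, w0, m0.
    assert (Dp : is_derive (fun p : R => p) 0 1) by apply D_id.
    assert (NZ : 1 - d2 xi 0 0 * (0 - 0) <> 0) by lra.
    eapply deriv_val; [der|]. field.
  - exact (local_diffeo_of_inverse X Y xi eta HX HY X0 Y0 Axi Aeta Hl Hr).
  - assert (Hcomp : forall P : pt -> Prop, near P -> near (fun z => P (vec [X (z 0%nat) (z 1%nat); Y (z 0%nat) (z 1%nat); z 2%nat]))).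
    { intros P HP. apply (near_comp_vec P [fun z => X (z 0%nat) (z 1%nat); fun z => Y (z 0%nat) (z 1%nat); fun z => z 2%nat] HP).
      - repeat constructor; try assumption. apply An_var.
      - repeat constructor; assumption. }
    assert (NZ := nonzero w m Aw Am w0 m0).
    assert (NDen := near_neq0 _ Aden ltac:(unfold pt0; rewrite sg0, X0, Y0, m0; lra)).
    set (sp := fun z : pt => (1 - d2 xi (X (z 0%nat) (z 1%nat)) (Y (z 0%nat) (z 1%nat)) *
        (sg (z 0%nat) (z 1%nat) (z 2%nat) / m (X (z 0%nat) (z 1%nat)) (Y (z 0%nat) (z 1%nat))))
        / w (X (z 0%nat) (z 1%nat)) (Y (z 0%nat) (z 1%nat))).
    assert (Asp : An sp).
    { apply An_div; [|now apply L2 | unfold pt0; rewrite X0, Y0, w0; lra].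
      apply An_minus; [apply An_const|]. apply An_mult; [now apply L2|].
      apply An_div; [exact Asg | now apply L2 | unfold pt0; rewrite X0, Y0, m0; lra]. }
    assert (sp0 : sp pt0 = 1).
    { unfold sp, pt0. rewrite sg0, X0, Y0, w0, m0. field. }
    assert (Nsp := near_small sp 1 Asp Rlt_0_1).
    apply near_imp with (2 := near_and _ _ Move (near_and _ _ (Hcomp _ Law) (near_and _ _ (Hcomp _ Hs)
      (near_and _ _ (Hcomp _ Cons) (near_and _ _ (Hcomp _ NZ) (near_and _ _ NDen (near_and _ _ Nsp Hr))))))).
    intros z [Mv [Lw [S [Cn [Nz [Nd [Ns [I1 I2]]]]]]]] yf pf x Ex Ey Ep Dy Dp.
    unfold vec in Lw, S, Cn, Nz; cbn in Lw, S, Cn, Nz.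
    destruct (Mv yf x (z 2%nat) Ex Ey Dy) as [s' [t' [DX [DY [Q1 Q2]]]]].
    destruct S as [S1 [S2 _]]. destruct Cn as [Cn _]. destruct Nz as [Nw Nm].
    rewrite S1 in Q1. rewrite S2 in Q2.
    set (s := X (z 0%nat) (z 1%nat)) in *. set (t := Y (z 0%nat) (z 1%nat)) in *.
    assert (Esg : sg (z 0%nat) (z 1%nat) (z 2%nat) = z 2%nat - q s t) by reflexivity.
    assert (Et' : t' = (z 2%nat - q s t) / m s t).
    { apply (Rmult_eq_reg_r (m s t)); [|exact Nm].
      replace ((z 2%nat - q s t) / m s t * m s t) with (z 2%nat - q s t) by (field; exact Nm).
      rewrite Cn. 
      replace (t' * (d2 eta s t - q s t * d2 xi s t)) with
        ((s' * (q s t * w s t) + t' * d2 eta s t) - q s t * (s' * w s t + t' * d2 xi s t)) by ring.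
      rewrite Q1, Q2. ring. }
    assert (Es' : s' = (1 - d2 xi s t * ((z 2%nat - q s t) / m s t)) / w s t).
    { rewrite <- Et', <- Q1. field. exact Nw. }
    exists s'. split; [|split; [exact DX|split]].
    + assert (Esp : sp z = s') by (unfold sp; rewrite Es'; reflexivity).
      rewrite Esp, sp0 in Ns. apply Rabs_def2 in Ns. apply Rabs_le. lra.
    + apply (deriv_val _ _ _ _ DY). unfold tau. fold s t. rewrite Et', Es', Esg.
      rewrite Esg in Nd. field. repeat split; assumption.
    + assert (Dp' : is_derive pf x (B (xi s t) (eta s t) (z 2%nat))).
      { rewrite I1, I2. exact Dp. }
      assert (Es : X x (yf x) = s) by (unfold s; now rewrite <- Ex, <- Ey).
      assert (Et : Y x (yf x) = t) by (unfold t; now rewrite <- Ex, <- Ey).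
      rewrite Es' in DX. rewrite Et' in DY.
      assert (K := Lw (fun x => X x (yf x)) (fun x => Y x (yf x)) pf x Es Et Ep DX DY Dp').
      rewrite Es'. exact K.
Qed.

Theorem proposition1 (B : R -> R -> R -> R) (hB : analytic_near_0 B) :
  exists (X Y alpha beta : R -> R -> R) (Bt : R -> R -> R -> R),
    local_diffeo X Y /\ local_diffeo alpha beta /\
    analytic_near_0 Bt /\ transforms B X Y alpha beta Bt /\
    exists (Bc : nat -> nat -> R -> R) (r : R), 0 < r /\
      (forall x y p : R, in_box r x y p ->
         is_sum2 (fun i j => Bc i j y * x ^ i * p ^ j) (Bt x y p)) /\
      (forall y : R, Rabs y < r ->
         (forall i : nat, Bc i 0%nat y = 0 /\ Bc i 1%nat y = 0) /\
         Bc 0%nat 2%nat y = 0 /\ Bc 0%nat 3%nat y = 0 /\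
         Bc 1%nat 2%nat y = 0 /\ Bc 1%nat 3%nat y = 0) /\
      (forall x y p : R, in_box r x y p ->
         exists s1 s2 : R,
           is_series (fun j : nat =>
             (Bc 0%nat (j + 4)%nat y + x * Bc 1%nat (j + 4)%nat y) * p ^ j) s1 /\
           is_sum2 (fun i j : nat =>
             Bc (i + 2)%nat (j + 2)%nat y * x ^ (i + 2) * p ^ (j + 2)) s2 /\
           Bt x y p = p ^ 4 * s1 + s2).
Proof.
  assert (HB := An3_of_analytic B hB).
  destruct (normalizing_coordinates B HB) as [X [Y [tau [Bt [A [C
    [HX [HY [Htau [HA [HC [HBt [X0 [Y0 [tau0 [JY [Jtau [HXY Hlaw]]]]]]]]]]]]]]]]]].
  assert (ABt : An3 Bt).
  { apply (An_exteq (fun z => z 0%nat ^ 2 * z 2%nat ^ 2 * A (z 0%nat) (z 1%nat) (z 2%nat)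
       + z 2%nat ^ 4 * C (z 0%nat) (z 1%nat) (z 2%nat))).
    - intros z. symmetry. apply HBt.
    - apply An_plus; apply An_mult; try assumption.
      + apply An_mult; apply An_pow, An_var.
      + apply An_pow, An_var. }
  destruct (ode_flow Bt ABt) as [U [V [HU [HV [U0 [V0 [Hi Hf]]]]]]].
  destruct (normal_expansion A C Bt HA HC HBt) as [HBa Hexp].
  exists X, Y, (alpha X Y tau U), (beta X Y tau V), Bt.
  split; [exact HXY|]. split; [|split; [exact HBa|split; [|exact Hexp]]].
  - now apply (initial_diffeo Bt X Y tau).
  - now apply (carries_solutions B Bt X Y tau).
Qed.
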